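(* Let $r\ge 1$ and let $n_1,\ldots,n_r\ge 2$ be integers. Then, with $q=e^{2\pi\sqrt{-1}\tau}$, \[ \big(\mathfrak{z}^{\mathrm{sh}}\otimes\mathfrak{g}\big)\circ\Delta\big(I(n_1,\ldots,n_r)\big)=G_{n_1,\ldots,n_r}(\tau), \] where $\mathfrak{z}^{\mathrm{sh}}\otimes\mathfrak{g}:\mathcal{I}^1_\bullet\otimes\mathcal{I}^1_\bullet\to\mathbb{C}[[q]]$ denotes the $\mathbb{Q}$-linear map $a\otimes b\mapsto \mathfrak{z}^{\mathrm{sh}}(a)\,\mathfrak{g}(b)$.
   Context: Hopf algebra. Let $\mathcal{I}_\bullet$ be the $\mathbb{Q}$-vector space spanned by symbols $\mathbb{I}(a_0;a_1,\ldots,a_N;a_{N+1})$ ($N\ge 0$, $a_i\in\{0,1\}$; degree $N$) subject to: (I1) $\mathbb{I}(a;b):=\mathbb{I}(a;\emptyset;b)=1$ for $a,b\in\{0,1\}$; (I2) the product is the shuffle product: $\mathbb{I}(a_0;a_1,\ldots,a_N;a_{N+N'+1})\,\mathbb{I}(a_0;a_{N+1},\ldots,a_{N+N'};a_{N+N'+1})=\sum_{\sigma\in\Sigma(N,N')}\mathbb{I}(a_0;a_{\sigma^{-1}(1)},\ldots,a_{\sigma^{-1}(N+N')};a_{N+N'+1})$, where $\Sigma(N,N')$ is the set of $\sigma\in\mathfrak{S}_{N+N'}$ with $\sigma(1)<\cdots<\sigma(N)$ and $\sigma(N+1)<\cdots<\sigma(N+N')$; (I3) for $x\in\{0,1\}$,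 $\mathbb{I}(a_0;a_1,\ldots,a_N;a_{N+1})=\sum_{k=0}^N\mathbb{I}(a_0;a_1,\ldots,a_k;x)\,\mathbb{I}(x;a_{k+1},\ldots,a_N;a_{N+1})$; (I4) $\mathbb{I}(a;a_1,\ldots,a_N;a)=0$ for $N\ge1$. This is a commutative graded $\mathbb{Q}$-algebra, and a Hopf algebra with the Goncharov coproduct $\Delta\,\mathbb{I}(a_0;a_1,\ldots,a_N;a_{N+1})=\sum_{0\le k\le N}\sum_{0=i_0<i_1<\cdots<i_k<i_{k+1}=N+1}\prod_{p=0}^k\mathbb{I}(a_{i_p};a_{i_p+1},\ldots,a_{i_{p+1}-1};a_{i_{p+1}})\otimes\mathbb{I}(a_0;a_{i_1},\ldots,a_{i_k};a_{N+1})$. The element $\mathbb{I}(0;0;1)$ is primitive; let $\mathcal{I}^1_\bullet=\mathcal{I}_\bullet/\mathbb{I}(0;0;1)\mathcal{I}_\bullet$ be the quotient Hopf algebra, $I(\cdots)$ the image of $\mathbb{I}(\cdots)$, and $\Delta$ the induced coproduct (same formula with $I$). For integers $n_i\ge1$ put $I(n_1,\ldots,n_r)=I(0;1,0^{n_1-1},1,0^{n_2-1},\ldots,1,0^{n_r-1};1)$ (here $0^{m}$ means $m$ consecutive $0$'s), and $I()=1$; these elements ($r\ge0$) form a $\mathbb{Q}$-basis of $\mathcal{I}^1_\bullet$. Regularised MZVs. For $n_r\ge2$, $\zeta(n_1,\ldots,n_r)=\sum_{0<m_1<\cdots<m_r}m_1^{-n_1}\cdots m_r^{-n_r}$. Let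 $\mathfrak{H}=\mathbb{Q}\langle\mathbf{0},\mathbf{1}\rangle$, $\mathfrak{H}^1=\mathbb{Q}+\mathbf{1}\mathfrak{H}$, $\mathfrak{H}^0=\mathbb{Q}+\mathbf{1}\mathfrak{H}\mathbf{0}$, $\mathbf{n}=\mathbf{1}\mathbf{0}^{n-1}$, with shuffle product $uw\,\mathrm{sh}\,vw'=u(w\,\mathrm{sh}\,vw')+v(uw\,\mathrm{sh}\,w')$ ($u,v$ letters), $w\,\mathrm{sh}\,1=1\,\mathrm{sh}\,w=w$. The map $Z:\mathfrak{H}^0\to\mathbb{R}$, $\mathbf{n}_1\cdots\mathbf{n}_r\mapsto\zeta(n_1,\ldots,n_r)$ ($n_r\ge2$), $Z(1)=1$, is an algebra homomorphism for the shuffle product; let $Z^{\mathrm{sh}}:\mathfrak{H}^1\to\mathbb{R}[T]$ be the unique shuffle-algebra homomorphism extending $Z$ with $Z^{\mathrm{sh}}(\mathbf{1})=T$, and let $\zeta^{\mathrm{sh}}(n_1,\ldots,n_r)$ be the constant term of $Z^{\mathrm{sh}}(\mathbf{n}_1\cdots\mathbf{n}_r)$. Define $\mathfrak{z}^{\mathrm{sh}}:\mathcal{I}^1_\bullet\to\mathbb{R}$ $\mathbb{Q}$-linearly by $I(n_1,\ldots,n_r)\mapsto\zeta^{\mathrm{sh}}(n_1,\ldots,n_r)$, $1\mapsto1$. $q$-series. For $n_i\ge1$, $g_{n_1,\ldots,n_r}(q)=\frac{(-2\pi\sqrt{-1})^{n_1+\cdots+n_r}}{(n_1-1)!\cdots(n_r-1)!}\sum_{0<u_1<\cdots<u_r}\sum_{v_1,\ldots,v_r>0}v_1^{n_1-1}\cdots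 v_r^{n_r-1}q^{u_1v_1+\cdots+u_rv_r}$; define $\mathfrak{g}:\mathcal{I}^1_\bullet\to\mathbb{C}[[q]]$ $\mathbb{Q}$-linearly by $I(n_1,\ldots,n_r)\mapsto g_{n_1,\ldots,n_r}(q)$, $1\mapsto1$. Multiple Eisenstein series. For $\tau$ in the upper half-plane, a lattice point $l\tau+m$ ($l,m\in\mathbb{Z}$) satisfies $l\tau+m\succ0$ iff $l>0$, or $l=0$ and $m>0$; $\lambda\succ\lambda'$ means $\lambda-\lambda'\succ0$. For $n_1,\ldots,n_r\ge2$, $G_{n_1,\ldots,n_r}(\tau)=\lim_{L\to\infty}\lim_{M\to\infty}\sum\lambda_1^{-n_1}\cdots\lambda_r^{-n_r}$, the sum over $0\prec\lambda_1\prec\cdots\prec\lambda_r$ with $\lambda_i=l_i\tau+m_i$, $-L\le l_i\le L$, $-M\le m_i\le M$. *)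

(* Defs.v *)
From HB Require Import structures.
From mathcomp Require Import all_boot all_order all_algebra perm.
From mathcomp Require Import finmap monalg.
From mathcomp Require Import all_classical all_reals all_analysis.
From mathcomp Require Import complex.

Set Implicit Arguments.
Unset Strict Implicit.
Unset Printing Implicit Defensive.

Import Order.TTheory GRing.Theory Num.Theory.
Import numFieldNormedType.Exports.

Local Open Scope classical_set_scope.
Local Open Scope ring_scope.
Local Open Scope quotient_scope.
Local Open Scope complex_scope.

Section IdealQuotient.
Variables (K : comNzRingType) (A : comAlgType K) (G : set A).

Definition in_ideal (x : A) : Prop :=
  exists2 s : seq (A * A),
    forall p, p \in s -> G p.2 & x = \sum_(p <- s) p.1 * p.2.

(* The library only quotients by proper ideals, hence the proof argument. *)
Definition ideal_pred (_ : ~ in_ideal 1) : pred A := fun x => `[< in_ideal x >].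

Variable proper : ~ in_ideal 1.

Lemma ideal_pred_closed : idealr_closed (ideal_pred proper).
Proof.
split.
- by apply/asboolP; exists [::]; rewrite ?big_nil.
- by apply/negP => /asboolP.
- move=> a x y /asboolP [s Gs ->] /asboolP [t Gt ->]; apply/asboolP.
  exists ([seq (a * p.1, p.2) | p <- s] ++ t).
    move=> p; rewrite mem_cat => /orP [/mapP [q qs ->] /=|]; first exact: Gs.
    exact: Gt.
  rewrite big_cat big_map mulr_sumr; congr (_ + _).
  by apply: eq_bigr => p _; rewrite mulrA.
Qed.

HB.instance Definition _ := isIdealr.Build A (ideal_pred proper) ideal_pred_closed.

Definition ideal_idealr : idealr A := Idealr.clone A (ideal_pred proper) _.

Definition ideal_quotient : Type := {ideal_quot ideal_idealr}.

HB.instance Definition _ := GRing.ComNzRing.on ideal_quotient.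

Definition iq_proj (x : A) : ideal_quotient := \pi_({ideal_quot ideal_idealr}) x.

Lemma iq_proj_is_zmod_morphism : zmod_morphism iq_proj.
Proof. exact: pi_is_zmod_morphism. Qed.

Lemma iq_proj_is_monoid_morphism : monoid_morphism iq_proj.
Proof. exact: pi_is_monoid_morphism. Qed.

HB.instance Definition _ :=
  GRing.isZmodMorphism.Build A ideal_quotient iq_proj iq_proj_is_zmod_morphism.
HB.instance Definition _ :=
  GRing.isMonoidMorphism.Build A ideal_quotient iq_proj iq_proj_is_monoid_morphism.

Definition iq_scale (a : K) (x : ideal_quotient) : ideal_quotient :=
  iq_proj a%:A * x.

Lemma iq_scaleA a b x : iq_scale a (iq_scale b x) = iq_scale (a * b) x.
Proof. by rewrite /iq_scale mulrA -rmorphM /= -scalerAl mul1r scalerA. Qed.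

Lemma iq_scale1 : left_id 1 iq_scale.
Proof. by move=> x; rewrite /iq_scale scale1r rmorph1 mul1r. Qed.

Lemma iq_scaleDr : right_distributive iq_scale +%R.
Proof. by move=> a x y; rewrite /iq_scale mulrDr. Qed.

Lemma iq_scaleDl x : {morph iq_scale^~ x : a b / a + b}.
Proof. by move=> a b; rewrite /iq_scale scalerDl rmorphD /= mulrDl. Qed.

HB.instance Definition _ := GRing.Zmodule_isLmodule.Build K ideal_quotient
  iq_scaleA iq_scale1 iq_scaleDr iq_scaleDl.

Lemma iq_scaleAl (a : K) (x y : ideal_quotient) : a *: (x * y) = (a *: x) * y.
Proof. exact: mulrA. Qed.

HB.instance Definition _ :=
  GRing.Lmodule_isLalgebra.Build K ideal_quotient iq_scaleAl.
HB.instance Definition _ := GRing.Lalgebra_isComAlgebra.Build K ideal_quotient.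

Lemma iq_proj_is_scalable : scalable iq_proj.
Proof. by move=> a x; rewrite -[a *: x]mulr_algl rmorphM. Qed.

HB.instance Definition _ :=
  GRing.isScalable.Build K A ideal_quotient *:%R iq_proj iq_proj_is_scalable.

Lemma iq_projP x y : iq_proj x = iq_proj y <-> in_ideal (x - y).
Proof.
split=> [/eqP | h]; first by rewrite -Quotient.idealrBE => /asboolP.
by apply/eqP; rewrite -Quotient.idealrBE; apply/asboolP.
Qed.

Lemma iq_proj_surj (y : ideal_quotient) : exists x, y = iq_proj x.
Proof. by exists (repr (y : {ideal_quot ideal_idealr})); rewrite /iq_proj reprK. Qed.

End IdealQuotient.

Section Span.
Variables (K : nzRingType) (V : lmodType K) (G : set V).

Definition in_span (x : V) : Prop :=
  exists2 s : seq (K * V),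
    forall p, p \in s -> G p.2 & x = \sum_(p <- s) p.1 *: p.2.

Lemma in_span0 : in_span 0.
Proof. by exists [::]; rewrite ?big_nil. Qed.

Lemma in_spanP a x y : in_span x -> in_span y -> in_span (a *: x + y).
Proof.
move=> [s Gs ->] [t Gt ->]; exists ([seq (a * p.1, p.2) | p <- s] ++ t).
  move=> p; rewrite mem_cat => /orP [/mapP [q qs ->] /=|]; first exact: Gs.
  exact: Gt.
rewrite big_cat big_map scaler_sumr; congr (_ + _).
by apply: eq_bigr => p _; rewrite scalerA.
Qed.

Lemma in_spanZ a x : in_span x -> in_span (a *: x).
Proof. by move=> /(in_spanP a) /(_ in_span0); rewrite addr0. Qed.

End Span.

Section TensorProduct.
Variables (K : comNzRingType) (V W : lmodType K).

Inductive tensor_rel : {malg K[(V * W)%type]} -> Prop :=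
| tensor_relDl v v' w :
    tensor_rel (<< (v + v', w) >> - << (v, w) >> - << (v', w) >>)
| tensor_relDr v w w' :
    tensor_rel (<< (v, w + w') >> - << (v, w) >> - << (v, w') >>)
| tensor_relZl a v w : tensor_rel (<< (a *: v, w) >> - a *: << (v, w) >>)
| tensor_relZr a v w : tensor_rel (<< (v, a *: w) >> - a *: << (v, w) >>).

Definition in_tensor_rel := in_span tensor_rel.

Definition tensor_pred : pred {malg K[(V * W)%type]} :=
  fun x => `[< in_tensor_rel x >].

Lemma tensor_pred_closed : zmod_closed tensor_pred.
Proof.
split; first by apply/asboolP; exact: in_span0.
move=> x y /asboolP hx /asboolP hy; apply/asboolP.
by rewrite addrC -scaleN1r; apply: in_spanP.
Qed.

HB.instance Definition _ :=
  GRing.isZmodClosed.Build {malg K[(V * W)%type]} tensor_pred tensor_pred_closed.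

Definition tensor_zmod : zmodClosed {malg K[(V * W)%type]} :=
  GRing.ZmodClosed.clone _ tensor_pred _.

Definition tensor : Type := {ideal_quot tensor_zmod}.

HB.instance Definition _ := GRing.Zmodule.on tensor.

Definition tensor_proj (x : {malg K[(V * W)%type]}) : tensor :=
  \pi_({ideal_quot tensor_zmod}) x.

Lemma tensor_proj_is_zmod_morphism : zmod_morphism tensor_proj.
Proof. exact: pi_is_zmod_morphism. Qed.

HB.instance Definition _ := GRing.isZmodMorphism.Build
  {malg K[(V * W)%type]} tensor tensor_proj tensor_proj_is_zmod_morphism.

Lemma tensor_projP x y : tensor_proj x = tensor_proj y <-> in_tensor_rel (x - y).
Proof.
split=> [/eqP | h]; first by rewrite -Quotient.idealrBE => /asboolP.
by apply/eqP; rewrite -Quotient.idealrBE; apply/asboolP.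
Qed.

Definition tensor_repr (t : tensor) : {malg K[(V * W)%type]} :=
  repr (t : {ideal_quot tensor_zmod}).

Lemma tensor_reprK t : tensor_proj (tensor_repr t) = t.
Proof. exact: reprK. Qed.

Definition tensor_scale (a : K) (t : tensor) : tensor :=
  tensor_proj (a *: tensor_repr t).

Lemma tensor_scaleE a x : tensor_scale a (tensor_proj x) = tensor_proj (a *: x).
Proof.
apply/tensor_projP; rewrite -scalerBr; apply: in_spanZ.
by apply/tensor_projP; rewrite tensor_reprK.
Qed.

Lemma tensor_scaleA a b x :
  tensor_scale a (tensor_scale b x) = tensor_scale (a * b) x.
Proof. by rewrite -[x]tensor_reprK !tensor_scaleE scalerA. Qed.

Lemma tensor_scale1 : left_id 1 tensor_scale.
Proof. by move=> x; rewrite -[x]tensor_reprK tensor_scaleE scale1r. Qed.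

Lemma tensor_scaleDr : right_distributive tensor_scale +%R.
Proof.
move=> a x y; rewrite -[x]tensor_reprK -[y]tensor_reprK -raddfD /=.
by rewrite !tensor_scaleE scalerDr raddfD.
Qed.

Lemma tensor_scaleDl x : {morph tensor_scale^~ x : a b / a + b}.
Proof.
by move=> a b; rewrite -[x]tensor_reprK !tensor_scaleE scalerDl raddfD.
Qed.

HB.instance Definition _ := GRing.Zmodule_isLmodule.Build K tensor
  tensor_scaleA tensor_scale1 tensor_scaleDr tensor_scaleDl.

Definition tens (v : V) (w : W) : tensor := tensor_proj << (v, w) >>.

End TensorProduct.

(** The map induced on [V (x) W] by a bilinear map into a module over an
    extension ring of [K]. *)

Section TensorLift.
Variables (K : comNzRingType) (V W : lmodType K).
Variables (L : nzRingType) (s : {rmorphism K -> L}) (U : lmodType L).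
Implicit Type f : V -> W -> U.

Definition malg_lift f (x : {malg K[(V * W)%type]}) : U :=
  \sum_(p <- msupp x) s x@_p *: f p.1 p.2.

Definition tensor_lift f (t : tensor V W) : U := malg_lift f (tensor_repr t).

Lemma malg_liftEw f (d : {fset (V * W)%type}) x : (msupp x `<=` d)%fset ->
  malg_lift f x = \sum_(p <- d) s x@_p *: f p.1 p.2.
Proof.
move=> le; rewrite [LHS](big_fset_incl _ le) => //= p pd /mcoeff_outdom ->.
by rewrite raddf0 scale0r.
Qed.

Lemma malg_lift_is_linear f a x y :
  malg_lift f (a *: x + y) = s a *: malg_lift f x + malg_lift f y.
Proof.
pose d := (msupp (a *: x + y) `|` (msupp x `|` msupp y))%fset.
rewrite !(@malg_liftEw f d).
- rewrite scaler_sumr -big_split /=; apply: eq_bigr => p _.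
  by rewrite mcoeffD mcoeffZ rmorphD rmorphM /= scalerDl scalerA.
- by rewrite /d fsetUA fsubsetUr.
- by rewrite /d fsetUCA fsubsetUl.
- by rewrite /d fsubsetUl.
Qed.

Lemma malg_liftU f v w : malg_lift f << (v, w) >> = f v w.
Proof.
rewrite (malg_liftEw _ msuppU_le) big_seq_fset1 mcoeffUU /=.
by rewrite rmorph1 scale1r.
Qed.

Definition semibilinear f : Prop :=
  (forall a v v' w, f (a *: v + v') w = s a *: f v w + f v' w) /\
  (forall a v w w', f v (a *: w + w') = s a *: f v w + f v w').

Lemma malg_lift_rel f : semibilinear f ->
  forall x, in_tensor_rel x -> malg_lift f x = 0.
Proof.
move=> [hl hr].
have l0 : malg_lift f 0 = 0.
  by rewrite (@malg_liftEw f fset0) ?big_seq_fset0 // msupp0.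
have lP a x y : malg_lift f (a *: x + y) = s a *: malg_lift f x + malg_lift f y.
  exact: malg_lift_is_linear.
have lD x y : malg_lift f (x + y) = malg_lift f x + malg_lift f y.
  by rewrite -[x in LHS]scale1r lP rmorph1 scale1r.
have lZ a x : malg_lift f (a *: x) = s a *: malg_lift f x.
  by rewrite -[a *: x]addr0 lP l0 addr0.
have lN x : malg_lift f (- x) = - malg_lift f x.
  by have := lZ (-1) x; rewrite rmorphN1 !scaleN1r.
have rel0 x : tensor_rel x -> malg_lift f x = 0.
  case=> [v v' w|v w w'|a v w|a v w]; rewrite !lD !lN ?lZ !malg_liftU.
  - have := hl 1 v v' w; rewrite !scale1r rmorph1 scale1r => ->.
    by rewrite addrAC addrK subrr.
  - have := hr 1 v w w'; rewrite !scale1r rmorph1 scale1r => ->.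
    by rewrite addrAC addrK subrr.
  - have f0 : f 0 w = 0.
      have /eqP := hl 1 0 0 w; rewrite scale1r addr0 rmorph1 scale1r.
      by rewrite -subr_eq subrr => /eqP <-.
    by have := hl a v 0 w; rewrite addr0 f0 addr0 => ->; rewrite subrr.
  - have f0 : f v 0 = 0.
      have /eqP := hr 1 v 0 0; rewrite scale1r addr0 rmorph1 scale1r.
      by rewrite -subr_eq subrr => /eqP <-.
    by have := hr a v w 0; rewrite addr0 f0 addr0 => ->; rewrite subrr.
move=> x [t tG ->].
elim: t tG => [|p t IH] tG; first by rewrite big_nil.
rewrite big_cons lP rel0 ?scaler0 ?add0r; last by apply: tG; rewrite mem_head.
by apply: IH => q qt; apply: tG; rewrite in_cons qt orbT.
Qed.

Lemma tensor_lift_proj f : semibilinear f ->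
  forall x, tensor_lift f (tensor_proj x) = malg_lift f x.
Proof.
move=> hf x; apply/eqP; rewrite -subr_eq0 -scaleN1r addrC -(rmorphN1 s).
rewrite -malg_lift_is_linear (malg_lift_rel hf) // scaleN1r addrC.
by apply/tensor_projP; rewrite tensor_reprK.
Qed.

Lemma tensor_lift_tens f : semibilinear f ->
  forall v w, tensor_lift f (tens v w) = f v w.
Proof. by move=> hf v w; rewrite tensor_lift_proj // malg_liftU. Qed.

Lemma tensor_lift_is_linear f : semibilinear f ->
  forall a x y, tensor_lift f (a *: x + y) =
    s a *: tensor_lift f x + tensor_lift f y.
Proof.
move=> hf a x y; rewrite -[x]tensor_reprK -[y]tensor_reprK.
rewrite [a *: _]tensor_scaleE -raddfD !tensor_lift_proj //.
exact: malg_lift_is_linear.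
Qed.

End TensorLift.

(** The letters are [false] for 0 and [true] for 1; the symbol
    [(a, w, b)] stands for I(a; w; b). *)
Definition symb : choiceType := (bool * seq bool * bool)%type.

Definition symb_alg : comAlgType rat := {malg rat[{cmonom symb}]}.

Definition fsymb (a : bool) (w : seq bool) (b : bool) : symb_alg :=
  << ucm ((a, w, b) : symb) >>.

(** The set Sigma(N, N') of (0-indexed) shuffle permutations. *)
Definition is_shuffle (N N' : nat) (s : 'S_(N + N')) : bool :=
  [forall i : 'I_(N + N'), forall j : 'I_(N + N'),
    (i < j)%N && ((j < N)%N || (N <= i)%N) ==> (s i < s j)%N].

Definition shuffle_word (u v : seq bool) (s : 'S_(size u + size v)) : seq bool :=
  [seq nth false (u ++ v) (s^-1%g i) | i <- enum 'I_(size u + size v)].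

Lemma size_shuffle_word u v (s : 'S_(size u + size v)) :
  size (shuffle_word s) = (size u + size v)%N.
Proof. by rewrite size_map size_enum_ord. Qed.

Section SymbolRelations.
Variables (K : comNzRingType) (A : comAlgType K) (I : bool -> seq bool -> bool -> A).

(** Unit, shuffle product, path composition and triviality of closed paths. *)
Inductive symb_rel : set A :=
| symb_rel1 a b : symb_rel (I a [::] b - 1)
| symb_rel2 a u v b :
    symb_rel (I a u b * I a v b -
      \sum_(s : 'S_(size u + size v) | is_shuffle s) I a (shuffle_word s) b)
| symb_rel3 a w b x :
    symb_rel (I a w b -
      \sum_(k < (size w).+1) I a (take k w) x * I x (drop k w) b)
| symb_rel4 a w : w != [::] -> symb_rel (I a w a).

Lemma symb_rel_counit (F : comNzRingType) (e : {rmorphism A -> F}) :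
    (forall a w b, e (I a w b) = (w == [::])%:R) ->
  forall x, symb_rel x -> e x = 0.
Proof.
move=> eI x; case=> [a b|a u v b|a w b y|a w wN0].
- by rewrite rmorphB eI (rmorph1 e) subrr.
- rewrite rmorphB rmorphM rmorph_sum !eI.
  under eq_bigr do rewrite eI -size_eq0 size_shuffle_word addn_eq0 !size_eq0.
  have [u0|uN0] := eqVneq u [::]; last by rewrite mul0r big1 ?subrr.
  have [v0|vN0] := eqVneq v [::]; last by rewrite mulr0 big1 ?subrr.
  rewrite u0 v0 (big_pred1 (1%g : 'S_0)) ?mul1r ?subrr // => s /=.
  have -> : s = (1%g : 'S_0) by apply/permP => -[].
  by rewrite eqxx; apply/forallP => -[].
- rewrite rmorphB rmorph_sum eI.
  under eq_bigr do rewrite rmorphM !eI.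
  case: w => [|c w]; first by rewrite big_ord_recl big_ord0 mul1r addr0 subrr.
  by rewrite big_ord_recl /= mulr0 big1 ?addr0 ?subrr // => k _; rewrite mul0r.
- by rewrite eI (negPf wN0).
Qed.

Lemma ideal_counit (F : comNzRingType) (e : {rmorphism A -> F}) :
    (forall a w b, e (I a w b) = (w == [::])%:R) ->
  forall x, in_ideal symb_rel x -> e x = 0.
Proof.
move=> eI x [s sG ->]; rewrite rmorph_sum big_seq big1 // => p ps.
by rewrite rmorphM (symb_rel_counit eI (sG p ps)) mulr0.
Qed.

Lemma ideal_counit_proper (F : comNzRingType) (e : {rmorphism A -> F}) :
    (forall a w b, e (I a w b) = (w == [::])%:R) ->
  ~ in_ideal symb_rel 1.
Proof.
by move=> eI /(ideal_counit eI) /eqP; rewrite (rmorph1 e) oner_eq0.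
Qed.

Lemma quotient_proper (F : comNzRingType) (e : {rmorphism A -> F}) (z : A)
    (eI : forall a w b, e (I a w b) = (w == [::])%:R)
    (pf : ~ in_ideal symb_rel 1) :
  e z = 0 -> ~ in_ideal [set iq_proj pf z] 1.
Proof.
move=> ez [s sG /esym].
have -> : \sum_(p <- s) p.1 * p.2 = (\sum_(p <- s) p.1) * iq_proj pf z.
  rewrite mulr_suml [LHS]big_seq [RHS]big_seq.
  by apply: eq_bigr => p /sG ->.
have [y ->] := iq_proj_surj (\sum_(p <- s) p.1).
rewrite -rmorphM -(rmorph1 (iq_proj pf)) => /iq_projP /(ideal_counit eI).
rewrite rmorphB rmorphM rmorph1 ez mulr0 sub0r => /eqP.
by rewrite oppr_eq0 oner_eq0.
Qed.

End SymbolRelations.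

Definition counit_monom (m : {cmonom symb}) : rat :=
  (all (fun s : symb => s.1.2 == [::]) (finsupp m))%:R.

Lemma counit_monom_mmorphism : mmorphism counit_monom.
Proof.
split; last by rewrite /counit_monom mdom1.
move=> m1 m2; rewrite /counit_monom -natrM mulnb mdomD; congr ((nat_of_bool _)%:R).
apply/idP/andP.
- move=> /allP h; split; apply/allP => s hs; apply: h; rewrite in_fsetU hs //.
  by rewrite orbT.
- move=> [/allP h1 /allP h2]; apply/allP => s; rewrite in_fsetU.
  by case/orP; [exact: h1 | exact: h2].
Qed.

HB.instance Definition _ := isMultiplicative.Build {cmonom symb} rat counit_monom
  counit_monom_mmorphism.

Definition counit_symb : {rmorphism symb_alg -> rat} :=
  GRing.RMorphism.clone _ _ (mmap idfun counit_monom : symb_alg -> rat) _.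

Lemma counit_fsymb a w b : counit_symb (fsymb a w b) = (w == [::])%:R.
Proof.
rewrite /counit_symb /fsymb /= mmapU mul1r /counit_monom mdomU.
congr ((nat_of_bool _)%:R); apply/allP/idP => [h|h s].
  by apply: (h (a, w, b)); rewrite in_fset1.
by rewrite in_fset1 => /eqP ->.
Qed.

Lemma Ibul_proper : ~ in_ideal (symb_rel fsymb) 1.
Proof. exact: (ideal_counit_proper counit_fsymb). Qed.

Definition Ibul : comAlgType rat := ideal_quotient Ibul_proper.

Definition II (a : bool) (w : seq bool) (b : bool) : Ibul :=
  iq_proj Ibul_proper (fsymb a w b).

Lemma I1bul_proper : ~ in_ideal [set II false [:: false] true] 1.
Proof.
by apply: (quotient_proper counit_fsymb); rewrite counit_fsymb.
Qed.

Definition I1bul : comAlgType rat := ideal_quotient I1bul_proper.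

Definition I1 (a : bool) (w : seq bool) (b : bool) : I1bul :=
  iq_proj I1bul_proper (II a w b).

(** The word 1 0^(n_1 - 1) 1 0^(n_2 - 1) ... 1 0^(n_r - 1), for [n_i >= 1]. *)
Definition index_word (n : seq nat) : seq bool :=
  flatten [seq true :: nseq k.-1 false | k <- n].

Definition I1n (n : seq nat) : I1bul := I1 false (index_word n) true.

(** For [s = (a_0, a_1, ..., a_N, a_(N+1))] and
    [i = (i_0 = 0, i_1, ..., i_k, i_(k+1) = N+1)], the factor
    I(a_(i_p); a_(i_p + 1), ..., a_(i_(p+1) - 1); a_(i_(p+1))). *)
Definition goncharov_factor (s : seq bool) (i : seq nat) (p : nat) : I1bul :=
  let a j := nth false s j in
  let ip := nth 0%N i p in
  let ip1 := nth 0%N i p.+1 in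
  I1 (a ip) [seq a j | j <- index_iota ip.+1 ip1] (a ip1).

Definition goncharov_formula (a : bool) (w : seq bool) (b : bool) :
    tensor I1bul I1bul :=
  let N := size w in
  let s := a :: rcons w b in
  \sum_(k < N.+1)
   \sum_(i : k.-tuple 'I_N.+1 | path ltn 0%N [seq val j | j <- i])
    tens (\prod_(p < k.+1)
            goncharov_factor s (0%N :: rcons [seq val j | j <- i] N.+1) p)
         (I1 a [seq nth false s (val j) | j <- i] b).

Definition is_goncharov_coproduct
    (Delta : {linear I1bul -> tensor I1bul I1bul}) : Prop :=
  forall a w b, Delta (I1 a w b) = goncharov_formula a w b.

Definition word_alg : lalgType rat := {malg rat[{fmonom bool}]}.

Definition letter (c : bool) : word_alg := << fmu c >>.

Definition word (w : seq bool) : word_alg := \prod_(c <- w) letter c.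

Fixpoint word_shuffle (w : seq bool) : seq bool -> word_alg :=
  fix shuffle_w (w' : seq bool) : word_alg :=
    match w, w' with
    | [::], _ => word w'
    | _, [::] => word w
    | u :: w1, v :: w1' =>
        letter u * word_shuffle w1 w' + letter v * shuffle_w w1'
    end.

Definition shuffle (x y : word_alg) : word_alg :=
  \sum_(w <- msupp x) \sum_(w' <- msupp y)
    (x@_w * y@_w') *: word_shuffle w w'.

(** Q + 1H and Q + 1H0, where [letter true] is the letter 1. *)
Definition H1 : set word_alg := [set x | exists c y, x = c%:A + letter true * y].
Definition H0 : set word_alg :=
  [set x | exists c y, x = c%:A + letter true * y * letter false].

(** The index [(n_1, ..., n_r)] of a word 1 0^(n_1 - 1) ... 1 0^(n_r - 1). *)
Definition word_index (w : seq bool) : seq nat :=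
  foldl (fun n c => if c then rcons n 1%N else incr_nth n (size n).-1) [::] w.

Section Values.
Variable R : realType.

(** The multiple zeta value, as the limit over M of the sum over
    [0 < m_1 < ... < m_r < M]. *)
Definition mzv_trunc (n : seq nat) (M : nat) : R :=
  \sum_(m : (size n).-tuple 'I_M | path ltn 0%N [seq val j | j <- m])
    \prod_(i < size n) (val (tnth m i))%:R ^- nth 0%N n i.

Definition mzv (n : seq nat) : R := limn (mzv_trunc n).

(** Only meaningful on [H0]. *)
Definition Zmap (x : word_alg) : R :=
  \sum_(w <- msupp x) ratr x@_w * mzv (word_index w).

(** [Zsh], restricted to [H1], is a homomorphism of algebras from (H^1, sh) to
    R[T] that extends [Zmap] and maps the letter 1 to T. *)
Definition is_Zsh (Zsh : word_alg -> {poly R}) : Prop :=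
  [/\ forall a x y, H1 x -> H1 y -> Zsh (a *: x + y) = ratr a *: Zsh x + Zsh y,
      forall x y, H1 x -> H1 y -> Zsh (shuffle x y) = Zsh x * Zsh y,
      forall x, H0 x -> Zsh x = (Zmap x)%:P
    & Zsh (letter true) = 'X].

Definition zeta_sh (Zsh : word_alg -> {poly R}) (n : seq nat) : R :=
  (Zsh (word (index_word n)))`_0.

Definition is_zsh (Zsh : word_alg -> {poly R})
    (z : {linear I1bul -> R | ratr \; *%R}) : Prop :=
  forall n, all (leq 1) n -> z (I1n n) = zeta_sh Zsh n.

Definition two_pi_i : R[i] := 0 +i* (2 * pi).

(** A power series is the sequence of its coefficients; in the coefficient of
    [q^N], every [u_i] and [v_i] is at most [N]. *)
Definition gser (n : seq nat) : nat -> R[i] := fun N =>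
  (- two_pi_i) ^+ sumn n / (\prod_(k <- n) (k.-1)`!)%:R *
  \sum_(uv : (size n).-tuple 'I_N.+1 * (size n).-tuple 'I_N.+1 |
         [&& path ltn 0%N [seq val j | j <- uv.1],
             all (fun j : 'I_N.+1 => 0 < j)%N uv.2
           & (\sum_(i < size n) tnth uv.1 i * tnth uv.2 i == N)%N])
    \prod_(i < size n) (val (tnth uv.2 i))%:R ^+ (nth 0%N n i).-1.

Definition is_g (g : {linear I1bul -> (nat -> R[i]) | ratr \; *:%R}) : Prop :=
  forall n, all (leq 1) n -> g (I1n n) = gser n.

Definition tensor_zg (z : I1bul -> R) (g : I1bul -> (nat -> R[i])) :
    tensor I1bul I1bul -> (nat -> R[i]) :=
  tensor_lift (ratr : {rmorphism rat -> R[i]}) (fun a b => (z a)%:C *: g b).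

Lemma tensor_zg_tens (z : {linear I1bul -> R | ratr \; *%R})
    (g : {linear I1bul -> (nat -> R[i]) | ratr \; *:%R}) a b :
  tensor_zg z g (tens a b) = (z a)%:C *: g b.
Proof.
apply: tensor_lift_tens; split=> [k v v' w|k v w w'] /=.
  rewrite (linearP z) rmorphD rmorphM /=.
  by rewrite scalerDl scalerA -(fmorph_rat (real_complex R)).
by rewrite (linearP g) /= scalerDr !scalerA mulrC.
Qed.

Definition lattice_pos (x : int * int) : bool :=
  (0 < x.1) || (x.1 == 0) && (0 < x.2).

Definition lattice_lt (x y : int * int) : bool := lattice_pos (y - x).

Definition lattice_point (tau : R[i]) (x : int * int) : R[i] :=
  x.1%:~R * tau + x.2%:~R.

(** The pairs [(l, m)] with [-L <= l <= L] and [-M <= m <= M]. *)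
Definition box_point (L M : nat) (x : 'I_L.*2.+1 * 'I_M.*2.+1) : int * int :=
  (x.1%:Z - L%:Z, x.2%:Z - M%:Z).

Definition eisenstein_trunc (n : seq nat) (tau : R[i]) (L M : nat) : R[i] :=
  \sum_(x : (size n).-tuple ('I_L.*2.+1 * 'I_M.*2.+1)
        | path lattice_lt (0, 0) [seq box_point y | y <- x])
    \prod_(i < size n) lattice_point tau (box_point (tnth x i)) ^- nth 0%N n i.

Definition eisenstein_limM (n : seq nat) (tau : R[i]) (L : nat) : (R[i])^o :=
  limn (eisenstein_trunc n tau L : nat -> (R[i])^o).

Definition eisenstein (n : seq nat) (tau : R[i]) : (R[i])^o :=
  limn (eisenstein_limM n tau).

Definition cexp (z : R[i]) : R[i] :=
  (expR (complex.Re z))%:C * (cos (complex.Im z) +i* sin (complex.Im z)).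

End Values.

(* Main.v *)
(** Group the lattice points [l tau + m] by [l].  The row [l = 0] contributes a
    multiple zeta value; the row [l > 0] contributes, after the limit in [m], a
    multitangent function at [l tau].  A partial fraction decomposition writes a
    multitangent function as a combination of the monotangent functions
    [sum_m (x + m)^-k], [k >= 2], with multiple zeta values as coefficients, and
    the Lipschitz formula turns these into power series in [q^l]; summing over
    [0 < l_1 < ... < l_h] gives the series [g].
    On the other side, a term of the coproduct of [I(n_1, ..., n_r)] survives
    only if, after an initial segment of [n], each block of consecutive indices
    is replaced by a single index [k]; the shuffle relations, path composition
    and reversal show that [z^sh] of the factor of a block is the coefficient
    of weight [k] in the corresponding multitangent function. *)

Require Import Defs.
From HB Require Import structures.
From mathcomp Require Import all_boot all_order all_algebra perm.
From mathcomp Require Import finmap monalg.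
From mathcomp Require Import all_classical all_reals all_analysis.
From mathcomp Require Import complex ring lra zify.

Set Implicit Arguments.
Unset Strict Implicit.
Unset Printing Implicit Defensive.

Import Order.TTheory GRing.Theory Num.Theory.
Import numFieldNormedType.Exports.

Local Open Scope ring_scope.
Local Open Scope complex_scope.

(** * Sums over increasing sequences *)

(** The partial fraction decomposition is applied before the limit in M, to the finite sum over -M
    <= m <= M. There it is exact, but the coefficient at the pole -m still depends on m and M;
    dominated convergence replaces it by its limit. That limit consists of Taylor coefficients of
    nested sums, and their recursion (differentiation raises one exponent) is the one that I(0;0;1)
    = 0 and the shuffle product impose on I(0;0^b,...;1): this is why the two sides agree
    coefficient by coefficient. The obstacle is weight 1, whose monotangent sums do not converge
    absolutely: only differences of two of them are dominated, and their coefficient is shown to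
    vanish analytically, not by a relation among zeta values. Since all n_i >= 2, removing leading
    zeros leads only to words that begin with 1 and end with 0, so [Zsh] enters only through the
    shuffle product of convergent values. The Lipschitz formula is obtained without contour
    integrals or product expansions, from the distribution relation of the sum of m^j x^m over
    dyadic roots. Both sides end in the same finite sum [refine_sum]. *)

Section Chain.
Variables (K : comNzRingType) (T : Type).
Implicit Types (f : nat -> T -> K) (xs ys : seq T) (n : seq nat).

(** The common form of all nested sums below: the order of the list [xs] encodes the strict
    inequalities, and an index [k] placed at a point [x] contributes [f k x]. Values in an arbitrary
    commutative ring let the same lemmas serve numbers and polynomials. *)
Fixpoint chain f xs n : K :=
  if xs is x :: xs' then
    chain f xs' n + (if n is k :: n' then f k x * chain f xs' n' else 0)
  else (n == [::])%:R.

Lemma chain_nil f xs : chain f xs [::] = 1.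
Proof. by elim: xs => [|x xs IH] //=; rewrite IH addr0. Qed.

(** Splitting the range deconcatenates the index: an increasing choice uses points of [xs] before
    points of [ys]. This is what separates the rows of the lattice. *)
Lemma chain_cat f xs ys n :
  chain f (xs ++ ys) n =
  \sum_(i < (size n).+1) chain f xs (take i n) * chain f ys (drop i n).
Proof.
elim: xs n => [|x xs IH] n /=.
  rewrite big_ord_recl /= take0 drop0 eqxx mul1r big1 ?addr0 // => i _.
  case: n i => [[]//|k n i]; rewrite /= mul0r //.
rewrite IH; case: n => [|k n].
  by rewrite !addr0 !big_ord_recl !big_ord0 /= !addr0.
rewrite big_ord_recl [RHS]big_ord_recl /= IH addr0 -addrA; congr (_ + _).
rewrite mulr_sumr -big_split /=; apply: eq_bigr => i _.
by rewrite mulrDl mulrA.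
Qed.

Lemma chain_rcons f xs x n k :
  chain f (rcons xs x) (rcons n k) =
  chain f xs (rcons n k) + chain f xs n * f k x.
Proof.
elim: xs n => [|y xs IH] n /=.
  case: n => [|j [|? n]] /=; rewrite ?mul1r ?mulr1 ?mulr0 ?addr0 ?mul0r ?addr0 //.
rewrite IH; case: n => [|j n] /=.
  have -> : chain f (rcons xs x) [::] = chain f xs [::] by rewrite !chain_nil.
  by rewrite !chain_nil addr0 mul1r; ring.
by rewrite IH; ring.
Qed.

Lemma chain_rev f xs n : chain f (rev xs) (rev n) = chain f xs n.
Proof.
elim: xs n => [|x xs IH] n /=.
  by rewrite -!size_eq0 size_rev.
rewrite rev_cons; case: n => [|k n]; first by rewrite !chain_nil addr0.
by rewrite rev_cons chain_rcons -rev_cons !IH mulrC.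
Qed.

Lemma eq_chain_in (P : pred nat) f g xs n : all P n ->
  (forall k, P k -> f k =1 g k) -> chain f xs n = chain g xs n.
Proof.
move=> Pn e; elim: xs n Pn => [|x xs IH] [|k n] //=.
  by rewrite IH.
by move=> /andP [Pk Pn]; rewrite !IH //= ?Pk // e.
Qed.

Lemma eq_chain f g xs n : (forall k, f k =1 g k) -> chain f xs n = chain g xs n.
Proof. by move=> e; apply: (@eq_chain_in predT) => //; apply/allP. Qed.

End Chain.

Lemma chain_map (K : comNzRingType) (S T : Type) (h : S -> T)
    (f : nat -> T -> K) xs n :
  chain f (map h xs) n = chain (fun k => f k \o h) xs n.
Proof. by elim: xs n => [|x xs IH] n //=; case: n => [|k n]; rewrite !IH. Qed.

Lemma chain_rmorph (K L : comNzRingType) (h : {rmorphism K -> L}) (T : Type)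
    (f : nat -> T -> K) xs n :
  h (chain f xs n) = chain (fun k x => h (f k x)) xs n.
Proof.
elim: xs n => [|x xs IH] n /=; first by rewrite rmorph_nat.
by case: n => [|k n]; rewrite rmorphD ?rmorph0 ?rmorphM !IH.
Qed.

Fixpoint sublists (T : Type) (ys : seq T) : seq (seq T) :=
  if ys is y :: ys' then sublists ys' ++ map (cons y) (sublists ys')
  else [:: [::]].

Lemma mem_sublists (T : eqType) (s ys : seq T) :
  (s \in sublists ys) = subseq s ys.
Proof.
elim: ys s => [|y ys IH] s; first by rewrite inE; case: s.
rewrite [LHS]mem_cat IH; case: s => [|x s]; first by rewrite !sub0seq.
have -> : (x :: s \in [seq y :: i | i <- sublists ys]) = (x == y) && subseq s ys.
  rewrite -IH; apply/mapP/andP => [[u us [-> ->]]|[/eqP -> us]]; first by rewrite eqxx.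
  by exists s.
rewrite /=; case: eqP => [->|_]; last by rewrite orbF.
apply/orP/idP => [[|//]|]; last by right.
by move=> h; apply: subseq_trans h; apply: subseq_cons.
Qed.

Lemma uniq_sublists (T : eqType) (ys : seq T) : uniq ys -> uniq (sublists ys).
Proof.
elim: ys => [|y ys IH] //= /andP [yys /IH u]; rewrite cat_uniq u /=.
rewrite map_inj_uniq ?u ?andbT; last by move=> ? ? [].
apply/hasPn => _ /mapP [s _ ->]; rewrite mem_sublists.
by apply: contra yys => /mem_subseq; apply; rewrite mem_head.
Qed.

Lemma size_sublists (T : eqType) (ys s : seq T) :
  s \in sublists ys -> (size s <= size ys)%N.
Proof. by rewrite mem_sublists => /size_subseq. Qed.

(** An increasing tuple is determined by its set of values, hence is a subsequence of the sorted
    list [ys] of all values above [u0]. This passes from the tuples of the definitions to recursion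
    on lists. *)
Lemma big_path_tuple (V : nmodType) (T : finType) (U : eqType) (f : T -> U)
    (e : rel U) (u0 : U) (ys : seq U) (k : nat) (G : seq U -> V) :
    injective f -> irreflexive e -> transitive e -> sorted e ys ->
    (forall u, u \in ys -> exists y, u = f y) ->
    (forall y, e u0 (f y) = (f y \in ys)) ->
  \sum_(t : k.-tuple T | path e u0 (map f t)) G (map f t) =
  \sum_(s <- sublists ys | size s == k) G s.
Proof.
move=> f_inj e_irr e_tr ys_s ys_f ysP.
have ys_u : uniq ys by apply: sorted_uniq ys_s.
have mem_path s : (exists t : k.-tuple T, path e u0 (map f t) /\ s = map f t)
    <-> (subseq s ys /\ size s = k).
  split=> [[t [pt ->]]|[ss sk]].
    split; last by rewrite size_map size_tuple.
    have tys : {subset map f t <= ys}.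
      move=> _ /mapP [x xt ->]; rewrite -ysP.
      by move: pt; rewrite path_sortedE // => /andP [/allP h _]; apply: h; apply: map_f.
    have -> : map f t = [seq y <- ys | y \in map f t].
      apply: (irr_sorted_eq e_tr e_irr) (path_sorted pt) _ _ => [|x].
        exact: sorted_filter.
      by rewrite mem_filter andb_idr //; apply: tys.
    exact: filter_subseq.
  have [t ts] : exists t : seq T, s = map f t.
    have : all [in ys] s by apply/allP/mem_subseq.
    elim: {ss sk} s => [|x s IH] /=; first by exists [::].
    by move=> /andP [/ys_f [y ->] /IH [t ->]]; exists (y :: t).
  have tk : size t == k by rewrite -sk ts size_map.
  exists (Tuple tk); rewrite /= -ts; split=> //.
  rewrite path_sortedE // (subseq_sorted e_tr ss) // andbT.
  apply/allP => x xs; have := mem_subseq ss xs.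
  by case/ys_f: (mem_subseq ss xs) => y ->; rewrite ysP.
have tmap_inj : injective (fun t : k.-tuple T => map f t).
  by move=> t t' /(inj_map f_inj) /val_inj.
rewrite -big_filter -[RHS]big_filter.
rewrite -[LHS](big_map (fun t : k.-tuple T => map f t) predT G).
apply: perm_big; apply: uniq_perm.
- by rewrite map_inj_uniq // filter_uniq // index_enum_uniq.
- by rewrite filter_uniq // uniq_sublists.
move=> s; rewrite mem_filter mem_sublists.
apply/mapP/andP => [[t]|[/eqP sk ss]].
  rewrite mem_filter => /andP [pt _] st.
  have [|? ->] := (mem_path s).1; first by exists t.
  by rewrite eqxx.
have [t [pt st]] := (mem_path s).2 (conj ss sk); exists t => //.
by rewrite mem_filter pt mem_index_enum.
Qed.

Lemma chain_sublists (K : comNzRingType) (T : Type) (x0 : T)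
    (f : nat -> T -> K) ys n :
  chain f ys n = \sum_(s <- sublists ys | size s == size n)
    \prod_(i < size n) f (nth 0%N n i) (nth x0 s i).
Proof.
elim: ys n => [|y ys IH] n /=.
  rewrite big_mkcond big_seq1; case: n => [|k n] //=.
  by rewrite big_ord0.
rewrite big_cat /= -IH big_map; congr (_ + _).
case: n => [|k n]; first by rewrite big_pred0.
rewrite IH mulr_sumr; apply: eq_big => [s|s _] //=.
by rewrite [RHS]big_ord_recl.
Qed.

Lemma sum_path_tuple (K : comNzRingType) (T : finType) (U : eqType) (f : T -> U)
    (e : rel U) (u0 : U) (ys : seq U) (n : seq nat) (F : nat -> U -> K) :
    injective f -> irreflexive e -> transitive e -> sorted e ys ->
    (forall u, u \in ys -> exists y, u = f y) ->
    (forall y, e u0 (f y) = (f y \in ys)) ->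
  \sum_(t : (size n).-tuple T | path e u0 (map f t))
     \prod_(i < size n) F (nth 0%N n i) (f (tnth t i)) = chain F ys n.
Proof.
move=> f_inj e_irr e_tr ys_s ys_f ysP; rewrite (chain_sublists u0).
rewrite -(big_path_tuple _ _ f_inj e_irr e_tr ys_s ys_f ysP) /=.
apply: eq_bigr => t _; apply: eq_bigr => i _.
by rewrite (nth_map (tnth_default t i)) ?size_tuple // -tnth_nth.
Qed.

(** * Evaluation of the coproduct *)

Section Coproduct.
Variables (A : pzRingType) (V : nmodType) (I : bool -> seq bool -> bool -> A).
Implicit Types (a b c : bool) (u v w gap : seq bool) (Psi : A -> seq bool -> V).

(** The sum of [Psi x v] over the terms [x (x) v] of the coproduct of
    [I a (gap ++ w) b] in which no letter of [gap] is selected. *)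
Fixpoint coproduct_sum b a gap w Psi : V :=
  if w is c :: w' then
    coproduct_sum b a (rcons gap c) w' Psi +
    coproduct_sum b c [::] w' (fun x v => Psi (I a gap c * x) (c :: v))
  else Psi (I a gap b) [::].

Lemma eq_coproduct_sum b a gap w Psi Psi' : (forall x v, Psi x v = Psi' x v) ->
  coproduct_sum b a gap w Psi = coproduct_sum b a gap w Psi'.
Proof.
elim: w a gap Psi Psi' => [|c w IH] a gap Psi Psi' e /=; first exact: e.
by congr (_ + _); apply: IH => *; apply: e.
Qed.

Lemma coproduct_sum0 b a gap w Psi : (forall x v, Psi x v = 0) ->
  coproduct_sum b a gap w Psi = 0.
Proof.
elim: w a gap Psi => [|c w IH] a gap Psi e /=; first exact: e.
by rewrite !IH ?addr0.
Qed.

End Coproduct.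

Section GoncharovFormula.
Variables (A : comPzRingType) (V : nmodType) (I : bool -> seq bool -> bool -> A).
Variables (b : bool) (s : seq bool).

Definition interval_factor (i j : nat) : A :=
  I (nth false s i) [seq nth false s k | k <- index_iota i.+1 j] (nth false s j).

Definition interval_prod (last i0 : nat) (js : seq nat) : A :=
  \prod_(p < (size js).+1) interval_factor (nth 0%N (i0 :: rcons js last) p)
                                           (nth 0%N (i0 :: rcons js last) p.+1).

Lemma interval_prod_cons last i0 j js :
  interval_prod last i0 (j :: js) = interval_factor i0 j * interval_prod last j js.
Proof. by rewrite /interval_prod big_ord_recl. Qed.

Lemma interval_prod_nil last i0 :
  interval_prod last i0 [::] = interval_factor i0 last.
Proof. by rewrite /interval_prod big_ord_recl big_ord0 mulr1. Qed.

(** Induction on the letters not yet read: the next one either extends the current interval or is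
    selected and closes it. The interval starts at position [i0], so the letters strictly between
    [i0] and [m] form the gap. *)
Lemma sum_sublists_coproduct (Psi : A -> seq bool -> V) w m i0 :
    (i0 < m)%N -> (forall j, (j < size w)%N -> nth false s (m + j) = nth false w j) ->
    nth false s (m + size w) = b ->
  \sum_(js <- sublists (iota m (size w)))
     Psi (interval_prod (m + size w) i0 js) [seq nth false s j | j <- js] =
  coproduct_sum I b (nth false s i0) [seq nth false s j | j <- index_iota i0.+1 m] w Psi.
Proof.
elim: w m i0 Psi => [|c w IH] m i0 Psi im ws sb /=.
  by rewrite big_seq1 /= interval_prod_nil /interval_factor sb addn0.
have sm : nth false s m = c by have := ws 0%N isT; rewrite addn0.
have e : (m + (size w).+1)%N = (m.+1 + size w)%N by rewrite addnS.
have ws' j : (j < size w)%N -> nth false s (m.+1 + j) = nth false w j.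
  by move=> jw; rewrite addSnnS (ws j.+1).
have sb' : nth false s (m.+1 + size w) = b by rewrite -e.
rewrite big_cat big_map /= e; congr (_ + _).
  rewrite IH //; last by rewrite ltnS ltnW.
  congr (coproduct_sum _ _ _ _ _ _).
  rewrite -sm -map_rcons; congr map.
  by rewrite /index_iota subSn // -[(m - _).+1]addn1 iotaD cats1 subnKC.
under eq_bigr do rewrite interval_prod_cons {1}/interval_factor /= sm.
rewrite (IH m.+1 m (fun x v => Psi (I (nth false s i0)
  [seq nth false s k | k <- index_iota i0.+1 m] c * x) (c :: v))) //.
by rewrite /index_iota subnn sm.
Qed.

End GoncharovFormula.

(** Positions 0 and N + 1 hold the endpoints; [path ltn 0] confines the selected positions to 1,
    ..., N, which are the letters of [w]. *)
Lemma sum_tuples_coproduct (A : comPzRingType) (V : nmodType)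
    (I : bool -> seq bool -> bool -> A) (Psi : A -> seq bool -> V) a w b :
  \sum_(k < (size w).+1)
   \sum_(i : k.-tuple 'I_(size w).+1 | path ltn 0%N [seq val j | j <- i])
    Psi (\prod_(p < k.+1) interval_factor I (a :: rcons w b)
           (nth 0%N (0%N :: rcons [seq val j | j <- i] (size w).+1) p)
           (nth 0%N (0%N :: rcons [seq val j | j <- i] (size w).+1) p.+1))
        [seq nth false (a :: rcons w b) (val j) | j <- i] =
  coproduct_sum I b a [::] w Psi.
Proof.
set N := size w; set s := a :: rcons w b.
pose G js := Psi (interval_prod I s N.+1 0 js) [seq nth false s j | j <- js].
transitivity (\sum_(k < N.+1) \sum_(i : k.-tuple 'I_N.+1 | path ltn 0%N (map val i))
    G (map val i)).
  apply: eq_bigr => k _; apply: eq_bigr => i _.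
  by rewrite /G /interval_prod size_map size_tuple -map_comp.
transitivity (\sum_(js <- sublists (iota 1 N)) G js).
  transitivity (\sum_(k < N.+1) \sum_(js <- sublists (iota 1 N) | size js == k) G js).
    apply: eq_bigr => k _.
    apply: (big_path_tuple (e := ltn)) => //.
    - by move=> x; rewrite /= ltnn.
    - exact: ltn_trans.
    - exact: iota_ltn_sorted.
    - by move=> u; rewrite mem_iota => /andP [_ uN]; exists (Ordinal uN).
    - by move=> y; rewrite mem_iota /= add1n ltn_ord andbT.
  under eq_bigr do rewrite big_mkcond.
  rewrite exchange_big /= big_seq [RHS]big_seq; apply: eq_bigr => js jsN.
  have sN : (size js < N.+1)%N by rewrite ltnS -(size_iota 1 N) size_sublists.
  rewrite (bigD1 (Ordinal sN)) //= eqxx big1 ?addr0 // => k.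
  by rewrite -val_eqE /= eq_sym => /negPf ->.
have := @sum_sublists_coproduct A V I b s Psi w 1 0.
rewrite add1n -/N /= => -> //.
- by move=> j jN; rewrite /= nth_rcons jN.
- by rewrite nth_rcons /N ltnn eqxx.
Qed.

Lemma goncharov_formulaE (V : nmodType) (h : tensor I1bul I1bul -> V) a w b :
    {morph h : x y / x + y} -> h 0 = 0 ->
  h (goncharov_formula a w b) =
  coproduct_sum I1 b a [::] w (fun x v => h (tens x (I1 a v b))).
Proof.
move=> hD h0; rewrite -sum_tuples_coproduct /goncharov_formula.
rewrite (big_morph h hD h0); apply: eq_bigr => k _.
by rewrite (big_morph h hD h0).
Qed.

(** * Shuffle permutations as shuffles of lists *)

Section ListShuffles.
Variable T : Type.

Fixpoint shuffles (u : seq T) : seq T -> seq (seq T) :=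
  fix shuffles_u (v : seq T) : seq (seq T) :=
    match u, v with
    | [::], _ => [:: v]
    | _, [::] => [:: u]
    | x :: u', y :: v' =>
        map (cons x) (shuffles u' v) ++ map (cons y) (shuffles_u v')
    end.

Lemma shuffles0s v : shuffles [::] v = [:: v].
Proof. by case: v. Qed.

Lemma shuffless0 u : shuffles u [::] = [:: u].
Proof. by case: u. Qed.

Lemma shuffles_cons x u y v :
  shuffles (x :: u) (y :: v) =
  map (cons x) (shuffles u (y :: v)) ++ map (cons y) (shuffles (x :: u) v).
Proof. by []. Qed.

(** The mask [m] tells from which of the two words each letter is drawn; masks are the link between
    shuffles of lists and shuffle permutations. *)
Fixpoint riffle (x0 : T) (m : seq bool) (u v : seq T) : seq T :=
  if m is c :: m' then
    if c then head x0 u :: riffle x0 m' (behead u) v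
    else head x0 v :: riffle x0 m' u (behead v)
  else [::].

Lemma size_riffle x0 m u v : size (riffle x0 m u v) = size m.
Proof. by elim: m u v => [|[] m IH] u v //=; rewrite IH. Qed.

Lemma nth_riffle x0 m u v i : (i < size m)%N ->
  nth x0 (riffle x0 m u v) i =
  if nth false m i then nth x0 u (count id (take i m))
  else nth x0 v (count negb (take i m)).
Proof.
elim: m u v i => [|c m IH] u v [|i] //=.
  by case: c; rewrite /= nth0.
by rewrite ltnS => im; case: c; rewrite /= IH //; case: ifP => _;
  rewrite ?nth_behead // add0n.
Qed.

End ListShuffles.

Lemma shuffles_riffle (T : Type) (x0 : T) u v :
  shuffles u v =
  [seq riffle x0 m u v | m <- shuffles (nseq (size u) true) (nseq (size v) false)].
Proof.
have r_l u' : riffle x0 (nseq (size u') true) u' [::] = u'.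
  by elim: u' => [|x u' IH] //=; rewrite IH.
have r_r v' : riffle x0 (nseq (size v') false) [::] v' = v'.
  by elim: v' => [|x v' IH] //=; rewrite IH.
elim: u v => [|x u IHu] v; first by rewrite !shuffles0s /= r_r.
elim: v => [|y v IHv]; first by rewrite !shuffless0 /= r_l.
rewrite [size _]/= [size (y :: v)]/= ![nseq _.+1 _]/= !shuffles_cons map_cat -!map_comp.
rewrite IHu IHv -!map_comp; congr (_ ++ _).
Qed.

Lemma mem_shuffles_nseq p q (m : seq bool) :
  (m \in shuffles (nseq p true) (nseq q false)) =
  (count id m == p) && (count negb m == q).
Proof.
have consP c (s : seq (seq bool)) m' : (c :: m' \in map (cons c) s) = (m' \in s).
  by apply: mem_map => ? ? [].
have consN c (s : seq (seq bool)) m' : (c :: m' \in map (cons (~~ c)) s) = false.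
  by apply/mapP => -[? _ [/eqP]]; case: c.
have nilN c (s : seq (seq bool)) : ([::] \in map (cons c) s) = false.
  by apply/mapP => -[].
have mt (p' : nat) m' : (m' == nseq p' true) = (count id m' == p') && (count negb m' == 0%N).
  elim: m' p' => [|[] m' IH] [|p'] //=; rewrite ?add0n ?add1n ?eqSS //.
  - by rewrite eqseq_cons IH.
  - by rewrite andbF.
  - by rewrite eqseq_cons andbF.
have mf (q' : nat) m' : (m' == nseq q' false) = (count id m' == 0%N) && (count negb m' == q').
  elim: m' q' => [|[] m' IH] [|q'] //=; rewrite ?add0n ?add1n ?eqSS //.
  - by rewrite andbF.
  - by rewrite eqseq_cons IH.
elim: p q m => [|p IHp] q m; first by rewrite shuffles0s inE mf.
elim: q m => [|q IHq] m; first by rewrite shuffless0 inE mt.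
rewrite ![nseq _.+1 _]/= shuffles_cons mem_cat.
case: m => [|[] m]; first by rewrite !nilN.
  by rewrite consP (consN true) orbF (IHp q.+1) /= add1n add0n eqSS.
by rewrite consP (consN false) (IHq m) /= add1n add0n eqSS.
Qed.

Lemma uniq_shuffles_nseq p q : uniq (shuffles (nseq p true) (nseq q false)).
Proof.
elim: p q => [|p IHp] q; first by rewrite shuffles0s.
elim: q => [|q IHq]; first by rewrite shuffless0.
rewrite ![nseq _.+1 _]/= shuffles_cons cat_uniq !map_inj_uniq ?(IHp q.+1) ?IHq ?andbT;
  try by move=> ? ? [].
by apply/hasPn => _ /mapP [? _ ->]; apply/mapP => -[].
Qed.

Section ShufflePermutations.
Variables p q : nat.
Local Notation n := (p + q)%N.

(** When [P i] means that position [i] of the shuffled word holds a letter of the first word, this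
    is the index of that letter in the concatenation: its rank within its own word, shifted by [p]
    for the second word. *)
Definition block_rank (P : pred 'I_n) (i : 'I_n) : nat :=
  if P i then #|[set j : 'I_n | (j < i)%N && P j]|
  else (p + #|[set j : 'I_n | (j < i)%N && ~~ P j]|)%N.

Lemma take_enum_ord i : (i <= n)%N ->
  take i (enum 'I_n) = [seq j <- enum 'I_n | (val j < i)%N].
Proof.
move=> le_i; apply: (inj_map val_inj); rewrite map_take val_enum_ord.
rewrite take_iota (minn_idPl le_i) -(filter_map val (fun j => (j < i)%N)).
by rewrite val_enum_ord -(filter_iota_ltn 0 le_i).
Qed.

Lemma count_take_mask (P : pred 'I_n) i : (i <= n)%N ->
  count id (take i [seq P j | j <- enum 'I_n]) = #|[set j : 'I_n | (j < i)%N && P j]|.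
Proof.
move=> le_i; rewrite -map_take count_map take_enum_ord // -sum1_count.
rewrite big_filter_cond big_enum_cond /= -sum1_card.
by apply: eq_bigl => j; rewrite inE.
Qed.

Definition perm_mask (s : 'S_n) : seq bool := [seq ((s^-1)%g j < p)%N | j <- enum 'I_n].

Lemma is_shuffleP (s : 'S_n) : reflect
  (forall i j : 'I_n, (i < j)%N -> (j < p)%N || (p <= i)%N -> (s i < s j)%N)
  (is_shuffle s).
Proof.
apply: (iffP forallP) => [h i j ij b|h i].
  by have := forallP (h i) j; rewrite ij b.
by apply/forallP => j; apply/implyP => /andP [ij b]; apply: h.
Qed.

Lemma card_ord_lt k : (k <= n)%N -> #|[set j : 'I_n | (j < k)%N]| = k.
Proof.
move=> le_k; have := @count_take_mask predT k le_k.
rewrite -map_take count_map (eq_count (a2 := predT)) // count_predT.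
rewrite size_takel ?size_enum_ord // => {2}->.
by apply: eq_card => j; rewrite !inE andbT.
Qed.

(** A shuffle permutation is increasing on each block, so counting the earlier positions that hold
    letters of the same word recovers the index. Hence the mask determines the permutation. *)
Lemma shuffle_rank (s : 'S_n) (i : 'I_n) : is_shuffle s ->
  (s^-1)%g i = block_rank (fun j => (s^-1)%g j < p)%N i :> nat.
Proof.
move=> /is_shuffleP sh; rewrite /block_rank.
have [k kE] : exists k, k = (s^-1)%g i by eexists.
have ik : i = s k by rewrite kE permKV.
rewrite -kE.
have mono (a b : 'I_n) : ((a < p) = (b < p))%N -> (s a < s b)%N = (a < b)%N.
  move=> ab; apply/idP/idP => [|lt_ab]; last first.
    by apply: sh => //; rewrite -ab (leqNgt p) orbN.
  case: (ltngtP a b) => // [ba|/val_inj ->]; last by rewrite ltnn.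
  have : (s b < s a)%N by apply: sh => //; rewrite ab (leqNgt p) orbN.
  by move=> /ltnW; rewrite leqNgt => /negPf ->.
have eqS (P : pred 'I_n) :
    #|[set j : 'I_n | (j < i)%N && P ((s^-1)%g j)]| =
    #|[set j : 'I_n | (s j < s k)%N && P j]|.
  rewrite -[RHS](card_imset _ (perm_inj (s := s))); apply: eq_card => j; rewrite !inE.
  apply/idP/imsetP => [h|[a]].
    by exists ((s^-1)%g j); rewrite ?permKV // inE permKV -?ik.
  by rewrite inE => h ->; rewrite permK ik.
rewrite (eqS (fun j => j < p)%N) (eqS (fun j => ~~ (j < p)%N)).
case: ifPn => kp.
  rewrite -{1}(card_ord_lt (ltnW (ltn_ord k))); apply: eq_card => j; rewrite !inE.
  case: (boolP (j < p)%N) => jp; first by rewrite mono ?kp ?jp ?andbT.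
  rewrite andbF; apply/negP => jk; move/negP: jp; apply.
  exact: ltn_trans jk kp.
have pk : (p <= k)%N by rewrite leqNgt.
have pn : (p <= n)%N by rewrite leq_addr.
rewrite -{1}(card_ord_lt (ltnW (ltn_ord k))).
transitivity (#|[set j : 'I_n | (j < p)%N]| +
              #|[set j : 'I_n | (s j < s k)%N && ~~ (j < p)%N]|)%N; last first.
  by rewrite card_ord_lt.
rewrite -cardsUI.
have -> : [set j : 'I_n | (j < p)%N] :&:
          [set j : 'I_n | (s j < s k)%N && ~~ (j < p)%N] = finset.set0.
  by apply/finset.setP => j; rewrite !inE; case: (j < p)%N; rewrite ?andbF.
rewrite cards0 addn0; apply: eq_card => j; rewrite !inE.
case: (boolP (j < p)%N) => jp; first by rewrite (leq_trans jp pk).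
by rewrite mono ?andbT // (negPf jp) (negPf kp).
Qed.

Lemma perm_mask_inj : {in @is_shuffle p q &, injective perm_mask}.
Proof.
move=> s t ss st e; apply: invg_inj; apply/permP => i; apply: ord_inj.
rewrite (shuffle_rank i ss) (shuffle_rank i st).
have eP j : ((s^-1)%g j < p)%N = ((t^-1)%g j < p)%N.
  by move/eq_in_map: e => -> //; rewrite mem_enum.
rewrite /block_rank eP; case: ifP => _.
  by apply: eq_card => j; rewrite !inE eP.
by congr (_ + _)%N; apply: eq_card => j; rewrite !inE eP.
Qed.

Lemma perm_mask_count (s : 'S_n) :
  (count id (perm_mask s) == p) && (count negb (perm_mask s) == q).
Proof.
have c : count id (perm_mask s) = p.
  have := @count_take_mask (fun j => (s^-1)%g j < p)%N n (leqnn _).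
  rewrite take_oversize; last by rewrite size_map size_enum_ord.
  move=> ->.
  rewrite -[RHS](card_ord_lt (leq_addr q p)) -[RHS](card_imset _ (perm_inj (s := s))).
  apply: eq_card => j; rewrite !inE ltn_ord; apply/idP/imsetP => [h|[a]].
    by exists ((s^-1)%g j); rewrite ?permKV // inE.
  by rewrite inE => h ->; rewrite permK.
have := count_predC id (perm_mask s); rewrite {1}c size_map size_enum_ord => /addnI cN.
by apply/andP; split; apply/eqP.
Qed.

(** [block_rank] sends the positions of the first word below [p] and the others to [p] or beyond,
    increasingly on each kind; it is therefore a bijection, and its inverse is the shuffle
    sought. *)
Lemma perm_mask_surj (m : seq bool) : count id m = p -> count negb m = q ->
  exists2 s : 'S_n, is_shuffle s & perm_mask s = m.
Proof.
move=> mp mq; have sm : size m = n by rewrite -mp -mq -(count_predC id m).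
pose P (j : 'I_n) := nth false m j.
have mE : m = [seq P j | j <- enum 'I_n].
  by rewrite -[LHS](mkseq_nth false) sm /mkseq -val_enum_ord -map_comp.
have cP : #|[set j : 'I_n | P j]| = p.
  have := @count_take_mask P n (leqnn _).
  rewrite -mE take_oversize ?sm // mp => e; apply: etrans (esym e).
  by apply: eq_card => j; rewrite !inE ltn_ord.
have cNP : #|[set j : 'I_n | ~~ P j]| = q.
  have := cardsC [set j : 'I_n | P j]; rewrite card_ord cP => /addnI e.
  by apply: etrans e; apply: eq_card => j; rewrite !inE.
have sub_lt (Q : pred 'I_n) (i : 'I_n) :
    Q i -> (#|[set j : 'I_n | (j < i)%N && Q j]| < #|[set j : 'I_n | Q j]|)%N.
  move=> Qi; apply: proper_card; apply/fintype.properP; split.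
    by apply/fintype.subsetP => j; rewrite !inE => /andP [].
  by exists i; rewrite !inE ?Qi // ltnn.
have rank_lt (Q : pred 'I_n) (i k : 'I_n) : Q i -> (i < k)%N ->
    (#|[set j : 'I_n | (j < i)%N && Q j]| < #|[set j : 'I_n | (j < k)%N && Q j]|)%N.
  move=> Qi ik; apply: proper_card; apply/fintype.properP; split.
    by apply/fintype.subsetP => j; rewrite !inE => /andP [ji ->]; rewrite (ltn_trans ji ik).
  by exists i; rewrite !inE ?Qi ?ik // ltnn.
have r_lt i : (block_rank P i < n)%N.
  rewrite /block_rank; case: ifPn => Pi.
    by rewrite ltn_addr // (leq_trans (sub_lt P i Pi)) // cP.
  by rewrite ltn_add2l (leq_trans (sub_lt (fun j => ~~ P j) i Pi)) // cNP.
have rP i : (block_rank P i < p)%N = P i.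
  rewrite /block_rank; case: ifPn => Pi; first by rewrite (leq_trans (sub_lt P i Pi)) // cP.
  by rewrite ltnNge leq_addr.
have r_mono i k : P i = P k -> (i < k)%N -> (block_rank P i < block_rank P k)%N.
  move=> Pik ik; rewrite /block_rank Pik; case: ifPn => Pk.
    by apply: rank_lt; rewrite ?Pik.
  by rewrite ltn_add2l; apply: (rank_lt (fun j => ~~ P j)); rewrite ?Pik.
pose f i := Ordinal (r_lt i).
have f_inj : injective f.
  move=> i k /(congr1 val) /= e; have Pik : P i = P k by rewrite -!rP e.
  apply: val_inj; case: (ltngtP i k) => // lt_ik.
    by have := r_mono _ _ Pik lt_ik; rewrite e ltnn.
  by have := r_mono _ _ (esym Pik) lt_ik; rewrite e ltnn.
exists ((perm f_inj)^-1)%g.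
  apply/is_shuffleP => i j.
  set a := ((perm f_inj)^-1 i)%g; set c := ((perm f_inj)^-1 j)%g.
  have -> : i = f a by rewrite -permE permKV.
  have -> : j = f c by rewrite -permE permKV.
  move=> /= fac b.
  have Pac : P a = P c.
    case/orP: b => h.
      by rewrite -!rP h (ltn_trans fac h).
    by rewrite -!rP !ltnNge h (leq_trans h (ltnW fac)).
  case: (ltngtP a c) => // [lt_ca|/val_inj ac].
    by have := ltn_trans fac (r_mono _ _ (esym Pac) lt_ca); rewrite ltnn.
  by move: fac; rewrite ac ltnn.
rewrite /perm_mask [RHS]mE; apply: eq_map => j.
by rewrite invgK permE /= rP.
Qed.

Lemma sum_is_shuffle (V : nmodType) (G : seq bool -> V) :
  \sum_(s : 'S_n | is_shuffle s) G (perm_mask s) =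
  \sum_(m <- shuffles (nseq p true) (nseq q false)) G m.
Proof.
rewrite -big_filter -[LHS](big_map perm_mask predT G).
apply: perm_big; apply: uniq_perm.
- rewrite map_inj_in_uniq ?filter_uniq ?index_enum_uniq // => s t.
  rewrite !mem_filter => /andP [ss _] /andP [st _]; exact: perm_mask_inj.
- exact: uniq_shuffles_nseq.
move=> m; rewrite mem_shuffles_nseq; apply/mapP/andP => [[s _ ->]|[/eqP mp /eqP mq]].
  by apply/andP; exact: perm_mask_count.
have [s ss sm] := perm_mask_surj mp mq; exists s => //.
by rewrite mem_filter ss mem_index_enum.
Qed.

End ShufflePermutations.

Lemma shuffle_word_riffle u v (s : 'S_(size u + size v)) : is_shuffle s ->
  shuffle_word s = riffle false (perm_mask s) u v.
Proof.
move=> ss; apply: (@eq_from_nth _ false).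
  by rewrite size_shuffle_word size_riffle size_map size_enum_ord.
move=> i; rewrite size_shuffle_word => i_lt.
rewrite nth_riffle; last by rewrite size_map size_enum_ord.
have i_e : (i < size (enum 'I_(size u + size v)))%N by rewrite size_enum_ord.
have ie : nth (Ordinal i_lt) (enum 'I_(size u + size v)) i = Ordinal i_lt.
  by apply: val_inj; rewrite /= nth_enum_ord.
rewrite /shuffle_word /perm_mask !(nth_map (Ordinal i_lt) _ _ i_e) ie.
have cN : count negb (take i [seq ((s^-1)%g j < size u)%N | j <- enum 'I_(size u + size v)]) =
    #|[set j : 'I_(size u + size v) | (j < i)%N && ~~ ((s^-1)%g j < size u)%N]|.
  rewrite -(@count_take_mask _ _ (fun j => ~~ ((s^-1)%g j < size u)%N)) ?(ltnW i_lt) //.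
  by rewrite -!map_take !count_map.
rewrite nth_cat; have := shuffle_rank (Ordinal i_lt) ss; rewrite /block_rank.
case: (boolP ((s^-1)%g (Ordinal i_lt) < size u)%N) => h ->.
  by rewrite count_take_mask // ltnW.
by rewrite cN addKn.
Qed.

Lemma sum_shuffle_word (V : nmodType) (G : seq bool -> V) u v :
  \sum_(s : 'S_(size u + size v) | is_shuffle s) G (shuffle_word s) =
  \sum_(w <- shuffles u v) G w.
Proof.
rewrite (shuffles_riffle false) big_map -sum_is_shuffle.
by apply: eq_bigr => s ss; rewrite shuffle_word_riffle.
Qed.

(** * Consequences of the relations between symbols *)

Arguments index_word : simpl never.

Lemma nseq_cat_cons (T : Type) (x : T) b s : nseq b x ++ x :: s = nseq b.+1 x ++ s.
Proof. by elim: b => [|b IH] //=; rewrite IH. Qed.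

(** [I (0; 0^b, 1, 0^(m_1 - 1), ..., 1, 0^(m_p - 1); 1)]. *)
Definition zero_shift (A : Type) (I : bool -> seq bool -> bool -> A) b m : A :=
  I false (nseq b false ++ index_word m) true.

Section SymbolIdentities.
Variables (A : comAlgType rat) (I : bool -> seq bool -> bool -> A).
Hypothesis I_nil : forall a b, I a [::] b = 1.
Hypothesis I_shuffle : forall a u v b,
  I a u b * I a v b = \sum_(w <- shuffles u v) I a w b.
Hypothesis I_path : forall a w b x,
  I a w b = \sum_(k < (size w).+1) I a (take k w) x * I x (drop k w) b.
Hypothesis I_loop : forall a w, w != [::] -> I a w a = 0.
Hypothesis I_zero : I false [:: false] true = 0.

Section Alternating.
Variable (V : zmodType) (G : seq bool -> V).

(** Telescoping by first letters. The words of term k that start with the next letter of [v]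
    reappear, with the opposite sign, in term k + 1, where that letter heads the reversed prefix;
    only the words of term 0 that start with [c] survive. *)
Lemma alternating_shuffles_cons c u v :
  \sum_(k < (size v).+1)
     (\sum_(w <- shuffles (catrev (take k v) (c :: u)) (drop k v)) G w) *~ (-1) ^+ k =
  \sum_(w <- shuffles u v) G (c :: w).
Proof.
elim: v c u => [|d v IH] c u.
  by rewrite big_ord_recl big_ord0 /= expr0 shuffless0 !big_seq1 addr0 mulr1z.
rewrite big_ord_recl expr0 mulr1z take0 drop0 [catrev _ _]/= shuffles_cons.
rewrite big_cat !big_map /= -[RHS]addr0 -addrA; congr (_ + _).
rewrite -(IH d (c :: u)) -big_split /= big1 // => k _.
by rewrite exprS mulN1r mulrNz addrN.
Qed.

(** The antipode identity of the shuffle algebra, whose antipode is reversal with sign. *)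
Lemma alternating_shuffles w : w != [::] ->
  \sum_(k < (size w).+1)
     (\sum_(x <- shuffles (rev (take k w)) (drop k w)) G x) *~ (-1) ^+ k = 0.
Proof.
case: w => // d v _; rewrite big_ord_recl expr0 mulr1z /= big_seq1.
have <- : \sum_(w <- shuffles [::] v) G (d :: w) = G (d :: v).
  by rewrite shuffles0s big_seq1.
rewrite -alternating_shuffles_cons -big_split /= big1 // => k _.
by rewrite exprS mulN1r mulrNz addrN.
Qed.

End Alternating.

(** Composing the closed path at 1 through 0 gives a vanishing sum of products, and the antipode
    identity gives the same relation for reversed words. Both are solved for their last term, and
    strong induction on the length compares the others. *)
Lemma I_reverse w : I true w false = (-1) ^+ size w * I false (rev w) true.
Proof.
have [m] := ubnP (size w); elim: m w => // m IH w wm.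
have [->|wN0] := eqVneq w [::]; first by rewrite !I_nil mulr1.
have := I_path true w true false; rewrite I_loop // big_ord_recr /= => /esym.
rewrite take_size drop_size I_nil mulr1 => /eqP; rewrite addrC addr_eq0 => /eqP ->.
have := alternating_shuffles (fun x => I false x true) wN0.
rewrite big_ord_recr /= take_size drop_size -I_shuffle I_nil mulr1.
rewrite -mulrzl rmorphXn rmorphN1 => /eqP; rewrite addrC addr_eq0 => /eqP ->.
congr (- _); apply: eq_bigr => k _.
have kw : size (take k w) = k by rewrite size_takel // ltnW.
rewrite IH ?kw; last by apply: leq_trans (ltn_ord k) _; rewrite -ltnS.
by rewrite -I_shuffle -mulrzl rmorphXn rmorphN1 mulrA.
Qed.

(** The place just before [v] is counted in the second sum, so the run of [a] zeros contributes the
    multiplicity [a] and not [a + 1]. *)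
Lemma sum_insert_zero (V : nmodType) (G : seq bool -> V) a v :
  \sum_(w <- shuffles [:: false] (nseq a false ++ v)) G w =
  G (nseq a.+1 false ++ v) *+ a +
  \sum_(w <- shuffles [:: false] v) G (nseq a false ++ w).
Proof.
elim: a G => [|a IH] G; first by rewrite mulr0n add0r.
rewrite (shuffles_cons false [::] false (nseq a false ++ v)).
rewrite shuffles0s big_cat /= big_seq1 big_map.
by rewrite (IH (fun w => G (false :: w))) addrA -mulrS.
Qed.

Lemma index_word_cons k n :
  index_word (k :: n) = true :: nseq k.-1 false ++ index_word n.
Proof. by []. Qed.

Lemma index_word_cat m n : index_word (m ++ n) = index_word m ++ index_word n.
Proof. by rewrite /index_word map_cat flatten_cat. Qed.

(** A block 1 0^(k - 1) offers k places for a new zero after its 1, and each of them turns k into k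
    + 1. *)
Lemma sum_insert_zero_index (V : nmodType) (G : seq bool -> V) m : all (leq 1) m ->
  \sum_(w <- shuffles [:: false] (index_word m)) G w =
  G (false :: index_word m) +
  \sum_(i < size m) G (index_word (incr_nth m i)) *+ nth 0%N m i.
Proof.
elim: m G => [|k m IH] G; first by rewrite big_ord0 addr0 big_seq1.
move=> /andP [k0 m0]; rewrite index_word_cons shuffles_cons shuffles0s big_cat.
rewrite /= big_seq1 big_map; congr (_ + _).
rewrite (sum_insert_zero (fun w => G (true :: w))).
rewrite (IH (fun w => G (true :: nseq k.-1 false ++ w))) // big_ord_recl /=.
rewrite addrA; congr (_ + _).
case: k k0 => // k _; rewrite index_word_cons /= mulrSr; congr (_ + _).
by rewrite nseq_cat_cons.
Qed.


(** Multiplying by I(0;0;1) = 0 and expanding the shuffle product: a zero inserted in the leading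
    run gives b + 1 times the left-hand side, one inserted elsewhere raises an index. Leading zeros
    are thus removed one at a time. *)
Lemma zero_shiftS b m : all (leq 1) m ->
  zero_shift I b.+1 m =
  - (b.+1%:R^-1 : rat) *: \sum_(i < size m) zero_shift I b (incr_nth m i) *+ nth 0%N m i.
Proof.
move=> m1; rewrite /zero_shift; have := I_shuffle false [:: false] (nseq b false ++ index_word m) true.
rewrite I_zero mul0r sum_insert_zero.
rewrite (sum_insert_zero_index (fun w => I false (nseq b false ++ w) true)) //.
rewrite nseq_cat_cons addrA -mulrSr.
move=> /esym /eqP; rewrite addr_eq0 => /eqP e.
rewrite scaleNr -scalerN -e -scaler_nat scalerA mulVf ?scale1r //.
Qed.

End SymbolIdentities.

(** * The coproduct of an index word, block by block *)

Section Refinement.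
Variables (A : pzRingType) (V : zmodType) (B : seq nat -> nat -> A) (W : nat).

(** The sum of [Psi (B n^1 k_1 * ... * B n^h k_h) (k_1, ..., k_h)] over the
    decompositions of [n] into nonempty blocks [n^1 ... n^h] and over
    [2 <= k_j < W]; the fuel [p] must be at least [size n]. *)
Fixpoint refine_sum (p : nat) (n : seq nat) (Psi : A -> seq nat -> V) : V :=
  if n is [::] then Psi 1 [::] else
  if p is p'.+1 then
    \sum_(i < size n) \sum_(2 <= k < W)
      refine_sum p' (drop i.+1 n) (fun y ks => Psi (B (take i.+1 n) k * y) (k :: ks))
  else 0.

Lemma refine_sum_nil p Psi : refine_sum p [::] Psi = Psi 1 [::].
Proof. by case: p. Qed.

Lemma refine_sum_cons p n Psi : n != [::] ->
  refine_sum p.+1 n Psi = \sum_(i < size n) \sum_(2 <= k < W)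
      refine_sum p (drop i.+1 n) (fun y ks => Psi (B (take i.+1 n) k * y) (k :: ks)).
Proof. by case: n. Qed.

Lemma eq_refine_sum p n Psi Psi' :
    (forall x ks, all (leq 2) ks -> Psi x ks = Psi' x ks) ->
  refine_sum p n Psi = refine_sum p n Psi'.
Proof.
elim: p n Psi Psi' => [|p IH] [|m n] Psi Psi' e //; try exact: e.
rewrite !refine_sum_cons //; apply: eq_bigr => i _; rewrite !big_nat.
by apply: eq_bigr => k /andP [k2 _]; apply: IH => x ks ks2; apply: e; rewrite /= k2.
Qed.

End Refinement.

Section CoproductIndexWord.
Variables (A : pzRingType) (V : zmodType) (I : bool -> seq bool -> bool -> A).
Hypothesis I_nil : forall a b, I a [::] b = 1.
Hypothesis I_loop : forall a w, w != [::] -> I a w a = 0.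
Implicit Types (Psi : A -> seq bool -> V).

Definition additive_left Psi := forall v, {morph Psi^~ v : x y / x + y}.

Local Notation Delta := (coproduct_sum I true).

Lemma additive_left0 Psi v : additive_left Psi -> Psi 0 v = 0.
Proof. by move=> aPsi; apply: (addIr (Psi 0 v)); rewrite -aPsi !add0r. Qed.

Lemma additive_left_sum (J : Type) (r : seq J) (P : pred J) (x : J -> A) Psi v :
    additive_left Psi ->
  Psi (\sum_(j <- r | P j) x j) v = \sum_(j <- r | P j) Psi (x j) v.
Proof. by move=> aPsi; apply: (big_morph (Psi^~ v)) => //; apply: additive_left0. Qed.

Lemma coproduct_sum_sum (J : Type) (r : seq J) (P : pred J) a gap w
    (Psi : J -> A -> seq bool -> V) :
  Delta a gap w (fun x v => \sum_(j <- r | P j) Psi j x v) =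
  \sum_(j <- r | P j) Delta a gap w (Psi j).
Proof.
elim: w a gap Psi => [|c w IH] a gap Psi //=.
by rewrite !IH -big_split.
Qed.

(** Selecting [a] would produce I(a; gap; a) with a nonempty gap, which vanishes; so the letter
    joins the gap. *)
Lemma coproduct_sum_loop a gap w Psi : additive_left Psi -> gap != [::] ->
  Delta a gap (a :: w) Psi = Delta a (rcons gap a) w Psi.
Proof.
move=> aPsi gap0 /=; rewrite [X in _ + X]coproduct_sum0 ?addr0 // => x v.
by rewrite I_loop // mul0r additive_left0.
Qed.

Lemma rcons_neq0 (T : eqType) (s : seq T) x : rcons s x != [::].
Proof. by case: s. Qed.

Lemma coproduct_sum_loops a gap c w Psi : additive_left Psi -> gap != [::] ->
  Delta a gap (nseq c a ++ w) Psi = Delta a (gap ++ nseq c a) w Psi.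
Proof.
move=> aPsi; elim: c gap => [|c IH] gap gap0; first by rewrite cats0.
rewrite [nseq c.+1 a ++ w]/= coproduct_sum_loop // IH ?rcons_neq0 //.
by rewrite cat_rcons.
Qed.

Lemma coproduct_sum_zeros gap c w Psi :
  Delta true gap (nseq c false ++ w) Psi =
  \sum_(i < c) Delta false [::] (nseq (c - i.+1) false ++ w)
     (fun x v => Psi (I true (gap ++ nseq i false) false * x) (false :: v)) +
  Delta true (gap ++ nseq c false) w Psi.
Proof.
elim: c gap => [|c IH] gap; first by rewrite big_ord0 add0r cats0.
rewrite big_ord_recl /= IH subn1 /= cats0 cat_rcons addrC -!addrA; congr (_ + _).
congr (_ + _); apply: eq_bigr => i _; rewrite subSS.
by apply: eq_coproduct_sum => x v; rewrite cat_rcons.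
Qed.

(** The terms whose last selected letter is the first letter [1] of
    [index_word n], resp. the recursion on the blocks of [n] they satisfy. *)
Definition after_one n Psi := Delta true [::] (behead (index_word n)) Psi.

Definition select_one n Psi : V :=
  if n is [::] then Psi 1 [::] else after_one n (fun x v => Psi x (true :: v)).

(** Every zero met here comes after a nonempty gap that starts at 0, so the next selected letter is
    a 1 and opens a block of [n]; [i = size n] is the case where nothing more is selected. *)
Lemma coproduct_sum_false gap n Psi : additive_left Psi -> all (leq 1) n ->
  Delta false gap (index_word n) Psi =
  \sum_(i < (size n).+1) select_one (drop i n)
    (fun x v => Psi (I false (gap ++ index_word (take i n)) true * x) v).
Proof.
move=> aPsi; elim: n gap => [|m n IH] gap n1.
  by rewrite big_ord_recl big_ord0 addr0 /= cats0 mulr1.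
case/andP: n1 => m1 n1; rewrite big_ord_recl take0 drop0 cats0.
rewrite [LHS]/= addrC; congr (_ + _).
rewrite coproduct_sum_loops ?rcons_neq0 // IH //; apply: eq_bigr => i _.
by rewrite /= index_word_cons /= cat_rcons -!catA.
Qed.

(** After a 1 with nonempty gap only a 0 can be selected, and the endpoint 1 forbids selecting
    nothing. [s] is the block of the selected zero and [i] the number of zeros that precede it in
    this block. *)
Lemma coproduct_sum_true gap n Psi : additive_left Psi -> gap != [::] ->
    all (leq 1) n ->
  Delta true gap (index_word n) Psi =
  \sum_(s < size n) \sum_(i < (nth 0%N n s).-1)
    Delta false [::] (nseq ((nth 0%N n s).-1 - i.+1) false ++ index_word (drop s.+1 n))
      (fun x v => Psi (I true (gap ++ index_word (take s n) ++ true :: nseq i false) false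
                         * x) (false :: v)).
Proof.
move=> aPsi; elim: n gap => [|m n IH] gap gap0 n1.
  by rewrite big_ord0 /= I_loop // additive_left0.
case/andP: n1 => m1 n1; rewrite big_ord_recl index_word_cons.
rewrite coproduct_sum_loop // coproduct_sum_zeros IH //; last by case: gap gap0.
congr (_ + _).
  by apply: eq_bigr => i _ /=; rewrite drop0; apply: eq_coproduct_sum => x v; rewrite cat_rcons.
apply: eq_bigr => s _; apply: eq_bigr => i _; apply: eq_coproduct_sum => x v.
have -> : index_word (take (lift ord0 s) (m :: n)) =
          true :: nseq m.-1 false ++ index_word (take s n) by [].
by rewrite -!catA cat_rcons /= -!catA.
Qed.

(** Indices at least 2 ensure that a 0 follows the selected 1, so the gap is nonempty when the next
    1 is reached. [behead] removes that selected 1, the left endpoint of the interval. *)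
Lemma after_oneE n Psi : additive_left Psi -> all (leq 2) n -> n != [::] ->
  after_one n Psi =
  \sum_(s < size n) \sum_(i < (nth 0%N n s).-1)
    Delta false [::] (nseq ((nth 0%N n s).-1 - i.+1) false ++ index_word (drop s.+1 n))
      (fun x v => Psi (I true (behead (index_word (take s n) ++ true :: nseq i false)) false
                         * x) (false :: v)).
Proof.
case: n => // m n aPsi /andP [m2 n2] _; rewrite /after_one index_word_cons.
rewrite big_ord_recl [behead _]/= coproduct_sum_zeros coproduct_sum_true //; last 2 first.
- by case: m m2 => [|[]].
- by apply: sub_all n2 => k; apply: ltnW.
congr (_ + _).
  by apply: eq_bigr => i _ /=; rewrite drop0; apply: eq_coproduct_sum.
apply: eq_bigr => s _; apply: eq_bigr => i _; apply: eq_coproduct_sum => x v.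
have -> : index_word (take (lift ord0 s) (m :: n)) =
          true :: nseq m.-1 false ++ index_word (take s n) by [].
by rewrite /= -!catA.
Qed.

(** Zeros that follow a selected 0 can be selected one by one with factor I(0;;0) = 1. Once one is
    skipped the rest of the run must be skipped too, so the only choice is the number [j] of zeros
    kept. *)
Lemma coproduct_sum_zero_run c n Psi : additive_left Psi -> all (leq 1) n ->
  Delta false [::] (nseq c false ++ index_word n) Psi =
  \sum_(j < c.+1) \sum_(i < (size n).+1) select_one (drop i n)
    (fun x v => Psi (zero_shift I (c - j) (take i n) * x) (nseq j false ++ v)).
Proof.
move=> aPsi n1; elim: c Psi aPsi => [|c IH] Psi aPsi.
  by rewrite big_ord_recl big_ord0 addr0 coproduct_sum_false.
rewrite big_ord_recl subn0 /=; congr (_ + _).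
  by rewrite coproduct_sum_loops // coproduct_sum_false.
have aPsi' : additive_left (fun x v => Psi x (false :: v)) by move=> v x y; apply: aPsi.
rewrite -(IH _ aPsi'); apply: eq_coproduct_sum => x v.
by rewrite I_nil mul1r.
Qed.

Lemma sum_triangle (F : nat -> nat -> V) N :
  \sum_(s < N) \sum_(i < N - s) F s (s + i)%N = \sum_(i < N) \sum_(s < i.+1) F s i.
Proof.
elim: N => [|N IH]; first by rewrite !big_ord0.
rewrite [RHS]big_ord_recr /= -IH big_ord_recr /= subSnn big_ord1 addn0.
rewrite [\sum_(s < N.+1) F s N]big_ord_recr /= addrA -big_split /=.
congr (_ + _); apply: eq_bigr => s _.
have sN : (s <= N)%N by apply: ltnW.
by rewrite subSn // big_ord_recr /= subnKC.
Qed.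

Lemma sum_triangle_sym (F : nat -> nat -> V) m :
  \sum_(a < m) \sum_(j < m - a) F a j = \sum_(j < m) \sum_(a < m - j) F a j.
Proof.
have tri (G : nat -> nat -> V) :
    \sum_(a < m) \sum_(j < m - a) G a j = \sum_(i < m) \sum_(s < i.+1) G s (i - s)%N.
  rewrite -(sum_triangle (fun s i => G s (i - s)%N)); apply: eq_bigr => a _.
  by apply: eq_bigr => j _; rewrite addKn.
rewrite tri (tri (fun j a => F a j)); apply: eq_bigr => i _.
rewrite (reindex_inj rev_ord_inj); apply: eq_bigr => s _ /=.
by rewrite subSS subKn // -ltnS.
Qed.

Variable W : nat.

(** In the run of zeros of n_s, [a] zeros are skipped, k - 1 are selected and n_s - k - a are
    skipped again; together with the 1 selected before them the selected zeros spell the index [k].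
    All other letters lie in the two gaps. *)
Definition block_coef n k : A :=
  \sum_(s < size n) if (k <= nth 0%N n s)%N then
    \sum_(a < (nth 0%N n s - k).+1)
       I true (behead (index_word (take s n) ++ true :: nseq a false)) false *
       zero_shift I (nth 0%N n s - k - a) (drop s.+1 n)
  else 0.

(** A first zero and [j] further ones are selected, so the new index is k = j + 2: this is where k
    >= 2 comes from. The common bound [W] makes the range of [k] independent of the block. *)
Lemma sum_block (F : nat -> nat -> V) m : (2 <= m)%N -> (m < W)%N ->
  \sum_(a < m.-1) \sum_(j < m.-1 - a) F a j =
  \sum_(2 <= k < W) if (k <= m)%N then \sum_(a < (m - k).+1) F a (k - 2)%N else 0.
Proof.
move=> m2 mW; rewrite sum_triangle_sym.
transitivity (\sum_(2 <= k < m.+1) \sum_(a < (m - k).+1) F a (k - 2)%N); last first.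
  by rewrite (big_nat_widen 2 m.+1 W) // big_mkcond.
rewrite -[in RHS](add0n 2%N) big_addn big_mkord -subn1.
have -> : (m.+1 - 2 = m - 1)%N by lia.
apply: eq_bigr => j _; rewrite addnK.
by have -> // : ((m - (j + 2)).+1 = m - 1 - j)%N by have := ltn_ord j; lia.
Qed.

Lemma eq_select_one n Psi Psi' : (forall x v, Psi x v = Psi' x v) ->
  select_one n Psi = select_one n Psi'.
Proof. by case: n => [|m n] e /=; [exact: e | apply: eq_coproduct_sum => *; apply: e]. Qed.

Lemma select_one0 n Psi : (forall x v, Psi x v = 0) -> select_one n Psi = 0.
Proof. by case: n => [|m n] e /=; [exact: e | apply: coproduct_sum0 => *; apply: e]. Qed.

Lemma select_one_sum (J : Type) (r : seq J) (P : pred J) n (x : J -> A) Psi g :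
    additive_left Psi ->
  select_one n (fun y v => Psi ((\sum_(j <- r | P j) x j) * y) (g v)) =
  \sum_(j <- r | P j) select_one n (fun y v => Psi (x j * y) (g v)).
Proof.
move=> aPsi; case: n => [|m n] /=.
  by rewrite mulr_suml additive_left_sum.
rewrite /after_one -coproduct_sum_sum; apply: eq_coproduct_sum => y v.
by rewrite mulr_suml additive_left_sum.
Qed.

Lemma after_one_blocks n Psi : additive_left Psi -> n != [::] ->
    all (leq 2) n -> all (fun m => m < W)%N n ->
  after_one n Psi = \sum_(i < size n) \sum_(2 <= k < W)
    select_one (drop i.+1 n)
      (fun x v => Psi (block_coef (take i.+1 n) k * x) (nseq k.-1 false ++ v)).
Proof.
move=> aPsi n0 n2 nW; rewrite after_oneE //.
have n1 : all (leq 1) n by apply: sub_all n2 => k; apply: ltnW.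
pose G s i a j := select_one (drop i.+1 n) (fun x v =>
  Psi (I true (behead (index_word (take s n) ++ true :: nseq a false)) false *
       zero_shift I (nth 0%N n s - 2 - j - a) (take (i - s) (drop s.+1 n)) * x)
      (nseq j.+1 false ++ v)).
pose H s i := \sum_(a < (nth 0%N n s).-1) \sum_(j < (nth 0%N n s).-1 - a) G s i a j.
(* The first gap ends inside block [s] and the second one just after block [s + i]. Reindexing by
   the last block makes [take i.+1 n] the piece that collapses to a single index. *)
transitivity (\sum_(s < size n) \sum_(i < size n - s) H s (s + i)%N).
  apply: eq_bigr => s _; rewrite exchange_big /=; apply: eq_bigr => a _.
  rewrite coproduct_sum_zero_run; last 2 first.
  - by move=> v x y; rewrite mulrDr aPsi.
  - by rewrite -(cat_take_drop s.+1 n) all_cat in n1; case/andP: n1.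
  rewrite exchange_big /= size_drop -subSn // subSS; apply: eq_bigr => i _.
  rewrite -subSn // subSS; apply: eq_bigr => j _; rewrite drop_drop.
  have -> : (i + s.+1 = (s + i).+1)%N by lia.
  rewrite /G addKn; apply: eq_select_one => x v.
  rewrite mulrA; congr (Psi (_ * zero_shift I _ _ * _) _); lia.
rewrite sum_triangle; apply: eq_bigr => i _.
under [RHS]eq_bigr do rewrite select_one_sum //.
rewrite exchange_big /= size_takel //; apply: eq_bigr => s _.
have si : (s < i.+1)%N := ltn_ord s.
have sN : (s < size n)%N by apply: leq_trans si _.
have ns : nth 0%N (take i.+1 n) s = nth 0%N n s by rewrite nth_take.
have ns2 : (2 <= nth 0%N n s)%N by apply: (allP n2); apply: mem_nth.
have nsW : (nth 0%N n s < W)%N by apply: (allP nW); apply: mem_nth.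
rewrite /H sum_block // !big_nat; apply: eq_bigr => k /andP [k2 kW].
rewrite ns; case: ifP => kn; last first.
  by rewrite select_one0 // => x v; rewrite mul0r additive_left0.
rewrite select_one_sum //; apply: eq_bigr => a _; rewrite /G.
have -> : (nth 0%N n s - 2 - (k - 2) - a = nth 0%N n s - k - a)%N by lia.
have -> : (k - 2).+1 = k.-1 by lia.
rewrite take_takel; last by apply: ltnW.
have -> : drop s.+1 (take i.+1 n) = take (i - s) (drop s.+1 n).
  by rewrite take_drop addnS subnK // -ltnS.
by rewrite take_drop.
Qed.

Lemma refine_sumE p n Psi : additive_left Psi -> (size n <= p)%N ->
    all (leq 2) n -> all (fun m => m < W)%N n ->
  select_one n Psi = refine_sum block_coef W p n (fun x ks => Psi x (index_word ks)).
Proof.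
elim: p n Psi => [|p IH] n Psi aPsi; first by case: n.
case: n => [//|m n] np n2 nW; rewrite refine_sum_cons // [LHS]/= after_one_blocks //.
  apply: eq_bigr => i _; apply: eq_bigr => k _; rewrite (IH (drop i.+1 (m :: n))).
  - by apply: eq_refine_sum.
  - by move=> v x y; rewrite mulrDr aPsi.
  - by rewrite size_drop; move: np => /=; lia.
  - by apply/allP => j /mem_drop; apply: (allP n2).
  - by apply/allP => j /mem_drop; apply: (allP nW).
Qed.

Theorem coproduct_index_word n Psi : additive_left Psi ->
    all (leq 2) n -> all (fun m => m < W)%N n ->
  Delta false [::] (index_word n) Psi =
  \sum_(i < (size n).+1) refine_sum block_coef W (size n) (drop i n)
    (fun x ks => Psi (I false (index_word (take i n)) true * x) (index_word ks)).
Proof.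
move=> aPsi n2 nW; rewrite coproduct_sum_false //; last first.
  by apply: sub_all n2 => k; apply: ltnW.
apply: eq_bigr => i _; rewrite (@refine_sumE (size n)) //.
- by move=> v x y; rewrite mulrDr aPsi.
- by rewrite size_drop leq_subr.
- by apply/allP => j /mem_drop; apply: (allP n2).
- by apply/allP => j /mem_drop; apply: (allP nW).
Qed.

End CoproductIndexWord.

(** * Convergent words and multiplicativity of [z] on them *)

Section Words.

Lemma word_cons c w : word (c :: w) = letter c * word w.
Proof. by rewrite /word big_cons. Qed.

Lemma word_rcons w c : word (rcons w c) = word w * letter c.
Proof. by rewrite /word big_rcons. Qed.

Lemma word_monomial w : word w = << (FMonom w : {fmonom bool}) >>.
Proof.
elim: w => [|c w IH].
  rewrite /word big_nil; congr (<< _ >>).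
  by apply: val_inj; rewrite /= fm1.
rewrite word_cons IH /letter malgM_def fgmulUU mulr1; congr (<< _ >>).
by rewrite [LHS]fmmulE fmuE.
Qed.

Lemma word_shuffleE u v : word_shuffle u v = \sum_(w <- shuffles u v) word w.
Proof.
elim: u v => [|x u IHu] v; first by rewrite shuffles0s big_seq1; case: v.
elim: v => [|y v IHv]; first by rewrite shuffless0 big_seq1.
rewrite shuffles_cons big_cat !big_map.
rewrite -[LHS]/(letter x * word_shuffle u (y :: v) + letter y * word_shuffle (x :: u) v).
rewrite IHu IHv !mulr_sumr.
by congr (_ + _); apply: eq_bigr => w _; rewrite word_cons.
Qed.

Lemma shuffle_word_word u v :
  shuffle (word u) (word v) = \sum_(w <- shuffles u v) word w.
Proof.
rewrite /shuffle !word_monomial !msuppU1 !big_seq_fset1 !mcoeffUU mulr1 scale1r.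
exact: word_shuffleE.
Qed.

Lemma word_index_word m : all (leq 1) m -> word_index (index_word m) = m.
Proof.
pose step (n : seq nat) (c : bool) :=
  if c then rcons n 1%N else incr_nth n (size n).-1.
have zeros n k j : foldl step (rcons n k) (nseq j false) = rcons n (k + j)%N.
  elim: j k => [|j IH] k; first by rewrite addn0.
  have e : step (rcons n k) false = rcons n k.+1.
    by rewrite /step size_rcons /= {IH}; elim: n => [|a n IHn] //=; rewrite IHn.
  by rewrite -[LHS]/(foldl step (step (rcons n k) false) (nseq j false)) e IH addSnnS.
suff h n : all (leq 1) m -> foldl step n (index_word m) = n ++ m by move/(h [::]).
elim: m n => [|k m IH] n; first by rewrite cats0.
case/andP => k1 m1; rewrite index_word_cons.
rewrite -[LHS]/(foldl step (rcons n 1%N) (nseq k.-1 false ++ index_word m)).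
rewrite foldl_cat zeros IH //.
by rewrite cat_rcons add1n prednK.
Qed.

Lemma word_indexK w : (w == [::]) || head false w ->
  index_word (word_index w) = w /\ all (leq 1) (word_index w).
Proof.
elim/last_ind: w => [|w c IH] //.
have -> : word_index (rcons w c) = if c then rcons (word_index w) 1%N
    else incr_nth (word_index w) (size (word_index w)).-1.
  by rewrite /word_index -cats1 foldl_cat.
case: w IH => [|d w]; first by case: c.
move=> /= IH d1; have [] := IH d1; move: (word_index (d :: w)) => n nw n1 {IH}.
case: c.
  split; last by rewrite all_rcons.
  by rewrite -[rcons n 1%N]cats1 index_word_cat nw -[rcons _ true in RHS]cats1.
case/lastP: n nw n1 => // n k; rewrite size_rcons all_rcons /= => nw /andP [k1 n1].
have -> : incr_nth (rcons n k) (size n) = rcons n k.+1.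
  by elim: {nw n1} n => [|a n IHn] //=; rewrite IHn.
split; last by rewrite all_rcons.
rewrite -[RHS]/(rcons (d :: w) false) -nw -!cats1 !index_word_cat -catA.
congr (_ ++ _); rewrite !index_word_cons /= cats0 /=.
by case: k k1 {nw} => // k _ /=; rewrite -catA nseq_cat_cons cats0.
Qed.

(** The words that span [H0]. *)
Definition convergent_word (w : seq bool) : bool :=
  (w == [::]) || head false w && ~~ last true w.

Lemma shuffles_last (d : bool) u v w : w \in shuffles u v ->
  last d w = last d u \/ last d w = last d v.
Proof.
elim: u d v w => [|x u IHu] d v w.
  by rewrite shuffles0s inE => /eqP ->; right.
elim: v d w => [|y v IHv] d w.
  by rewrite shuffless0 inE => /eqP ->; left.
rewrite shuffles_cons mem_cat => /orP [] /mapP [w' w'u ->] /=.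
  exact: (IHu x _ _ w'u).
exact: (IHv y _ w'u).
Qed.

Lemma convergent_shuffles u v w : convergent_word u -> convergent_word v ->
  w \in shuffles u v -> convergent_word w.
Proof.
case: u => [|x u]; first by rewrite shuffles0s inE => _ vc /eqP ->.
case: v => [|y v]; first by rewrite shuffless0 inE => uc _ /eqP ->.
move=> uc vc ws; have x1 : x = true by case: x uc {ws}.
have y1 : y = true by case: y vc {ws}.
rewrite x1 y1 in uc vc ws; have wl := shuffles_last true ws.
move: ws; rewrite shuffles_cons mem_cat => /orP [] /mapP [w' _ we]; move: wl;
  rewrite /convergent_word we /= => -[] ->; move: uc vc;
  by rewrite /convergent_word /= => uc vc.
Qed.

End Words.

Section ShuffleRegularisation.
Variables (R : realType) (Zsh : word_alg -> {poly R}).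
Hypothesis Zsh_def : is_Zsh Zsh.

Let Zsh_linear a x y : H1 x -> H1 y -> Zsh (a *: x + y) = ratr a *: Zsh x + Zsh y.
Proof. by case: Zsh_def => h _ _ _; apply: h. Qed.

Lemma H1_word w : convergent_word w -> H1 (word w).
Proof.
case: w => [|c w].
  by exists 1, 0; rewrite mulr0 addr0 /word big_nil scale1r.
rewrite /convergent_word eqE /= => /andP [c1 _]; exists 0, (word w).
by rewrite scale0r add0r word_cons c1.
Qed.

Lemma H1_add x y : H1 x -> H1 y -> H1 (x + y).
Proof.
move=> [a [x' ->]] [b [y' ->]]; exists (a + b), (x' + y').
by rewrite scalerDl mulrDr addrACA.
Qed.

Lemma H1_0 : H1 0.
Proof. by exists 0, 0; rewrite scale0r mulr0 addr0. Qed.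

Lemma Zsh0 : Zsh 0 = 0.
Proof.
have := Zsh_linear 1 H1_0 H1_0; rewrite scale1r addr0 rmorph1 scale1r => /eqP.
by rewrite -subr_eq subrr => /eqP.
Qed.

Lemma Zsh_sum (s : seq (seq bool)) : (forall w, w \in s -> convergent_word w) ->
  H1 (\sum_(w <- s) word w) /\ Zsh (\sum_(w <- s) word w) = \sum_(w <- s) Zsh (word w).
Proof.
elim: s => [|w s IH] sc; first by rewrite !big_nil Zsh0; split=> //; exact: H1_0.
have [|h e] := IH; first by move=> x xs; apply: sc; rewrite inE xs orbT.
have hw : H1 (word w) by apply: H1_word; apply: sc; rewrite mem_head.
rewrite !big_cons; split; first exact: H1_add.
by rewrite -[word w in LHS]scale1r Zsh_linear // rmorph1 scale1r e.
Qed.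

Lemma Zsh_word w : convergent_word w -> Zsh (word w) = (mzv R (word_index w))%:P.
Proof.
move=> wc; have [_ _ Z0 _] := Zsh_def.
have h : H0 (word w).
  move: wc; rewrite /convergent_word; case/orP => [/eqP ->|].
    by exists 1, 0; rewrite mulr0 mul0r addr0 /word big_nil scale1r.
  case: w => // c w /=; case/lastP: w => [|w d]; first by case: c.
  rewrite last_rcons => /andP [-> d0]; exists 0, (word w).
  by rewrite scale0r add0r word_cons word_rcons mulrA (negPf d0).
rewrite Z0 // /Zmap word_monomial msuppU1 big_seq_fset1 mcoeffUU rmorph1 mul1r.
by [].
Qed.

Variables (A : comAlgType rat) (I : bool -> seq bool -> bool -> A).
Hypothesis I_nil : forall a b, I a [::] b = 1.
Hypothesis I_shuffle : forall a u v b,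
  I a u b * I a v b = \sum_(w <- shuffles u v) I a w b.
Variable z : {linear A -> R | ratr \; *%R}.
Hypothesis z_def : forall n, all (leq 1) n ->
  z (I false (index_word n) true) = zeta_sh Zsh n.

Lemma z_word w : convergent_word w -> z (I false w true) = mzv R (word_index w).
Proof.
move=> wc; have [|wi w1] := @word_indexK w.
  by move: wc; rewrite /convergent_word; case: eqP => //= _ /andP [].
by rewrite -{1}wi z_def // /zeta_sh wi Zsh_word // coefC.
Qed.

(** Read off from the constant terms of the shuffle homomorphism [Zsh], which takes constant values
    on convergent words; the shuffle relations of the series are carried by [is_Zsh]. *)
Lemma mzv_mul_words u v : convergent_word u -> convergent_word v ->
  mzv R (word_index u) * mzv R (word_index v) =
  \sum_(w <- shuffles u v) mzv R (word_index w).
Proof.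
move=> uc vc; have [_ Zm _ _] := Zsh_def.
have := Zm _ _ (H1_word uc) (H1_word vc); rewrite shuffle_word_word.
have [|_ ->] := @Zsh_sum (shuffles u v); first by move=> w; apply: convergent_shuffles.
rewrite !Zsh_word // -polyCM => /(congr1 (fun p : {poly R} => p`_0)).
rewrite coefC eqxx => <-; rewrite coef_sum big_seq [RHS]big_seq.
by apply: eq_bigr => w wuv; rewrite Zsh_word ?(convergent_shuffles uc vc wuv) // coefC.
Qed.

(** [z] is only assumed linear; this is the set on which it is shown to be multiplicative, and the
    left factors that survive in the coproduct lie in it. *)
Definition convergent_span : set A :=
  in_span [set x | exists2 w, convergent_word w & x = I false w true]%classic.

Lemma span_word w : convergent_word w -> convergent_span (I false w true).
Proof.
move=> wc; exists [:: (1, I false w true)]; last by rewrite big_seq1 scale1r.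
by move=> p; rewrite inE => /eqP ->; exists w.
Qed.

Lemma span_linear a x y : convergent_span x -> convergent_span y ->
  convergent_span (a *: x + y).
Proof. exact: in_spanP. Qed.

Lemma span_sum (J : eqType) (r : seq J) (F : J -> A) :
  (forall j, j \in r -> convergent_span (F j)) -> convergent_span (\sum_(j <- r) F j).
Proof.
elim: r => [|j r IH] h; first by rewrite big_nil; apply: in_span0.
rewrite big_cons -[F j]scale1r; apply: span_linear; first by apply: h; rewrite mem_head.
by apply: IH => i ir; apply: h; rewrite inE ir orbT.
Qed.

Lemma z0 : z 0 = 0. Proof. exact: raddf0. Qed.
Lemma zD x y : z (x + y) = z x + z y. Proof. exact: raddfD. Qed.
Lemma zZ a x : z (a *: x) = ratr a * z x. Proof. exact: linearZ. Qed.
Lemma z_sum (J : Type) (r : seq J) (P : pred J) (F : J -> A) :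
  z (\sum_(j <- r | P j) F j) = \sum_(j <- r | P j) z (F j).
Proof. exact: raddf_sum. Qed.

(** On convergent words the regularisation plays no role: [z] is multiplicative
    there because [Zsh] is a shuffle homomorphism with constant values. *)
Lemma z_mul x y : convergent_span x -> convergent_span y ->
  convergent_span (x * y) /\ z (x * y) = z x * z y.
Proof.
suff h (s : seq (rat * A)) w : convergent_word w ->
    (forall p, p \in s -> exists2 u, convergent_word u & p.2 = I false u true) ->
    convergent_span ((\sum_(p <- s) p.1 *: p.2) * I false w true) /\
    z ((\sum_(p <- s) p.1 *: p.2) * I false w true) =
    z (\sum_(p <- s) p.1 *: p.2) * z (I false w true).
  move=> [s sG ->] [t tG ->]; elim: t tG => [|[b v] t IH] tG.
    by rewrite big_nil mulr0 z0 mulr0; split=> //; apply: in_span0.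
  have [|IH1 IH2] := IH; first by move=> p pt; apply: tG; rewrite inE pt orbT.
  have [w wc /= ->] : exists2 w, convergent_word w & (b, v).2 = I false w true.
    by apply: tG; rewrite mem_head.
  rewrite big_cons /= mulrDr -scalerAr; have [h1 h2] := h s w wc sG.
  split; first exact: span_linear.
  by rewrite zD zZ h2 IH2 zD zZ mulrDr; congr (_ + _); rewrite mulrCA.
move=> wc; elim: s => [|[a u] s IH] sG.
  by rewrite big_nil mul0r z0 mul0r; split=> //; apply: in_span0.
have [|IH1 IH2] := IH; first by move=> p ps; apply: sG; rewrite inE ps orbT.
have [u' uc /= ->] : exists2 u', convergent_word u' & (a, u).2 = I false u' true.
  by apply: sG; rewrite mem_head.
rewrite big_cons /= mulrDl -scalerAl I_shuffle.
split.
  apply: span_linear => //; apply: span_sum => w' ws; apply: span_word.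
  exact: convergent_shuffles ws.
have zz : z (\sum_(x0 <- shuffles u' w) I false x0 true) =
    z (I false u' true) * z (I false w true).
  rewrite !z_word // mzv_mul_words // z_sum big_seq [RHS]big_seq.
  by apply: eq_bigr => w' ws; rewrite z_word // (convergent_shuffles uc wc ws).
by rewrite zD zZ zz IH2 zD zZ mulrDl mulrA.
Qed.

End ShuffleRegularisation.

(** * Values of the block coefficients *)

Section ShiftedZeta.
Variable R : realType.

(** The coefficient of [x^b] in the sum of [(l_1 + x)^-m_1 ... (l_p + x)^-m_p]
    over [0 < l_1 < ... < l_p], computed by differentiating in [x]. *)
Fixpoint shifted_mzv (b : nat) (m : seq nat) : R :=
  if b is b'.+1 then
    - b'.+1%:R^-1 * \sum_(i < size m) shifted_mzv b' (incr_nth m i) *+ nth 0%N m i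
  else mzv R m.

(** The coefficient of the monotangent function of weight [k] in the
    multitangent function of index [n]. *)
Definition tangent_coef (n : seq nat) (k : nat) : R :=
  \sum_(s < size n) if (k <= nth 0%N n s)%N then
    \sum_(a < (nth 0%N n s - k).+1)
      (-1) ^+ (sumn (take s n) + a) * shifted_mzv a (rev (take s n)) *
      shifted_mzv (nth 0%N n s - k - a) (drop s.+1 n)
  else 0.

End ShiftedZeta.

Lemma all_incr_nth k m i : (i < size m)%N -> all (leq k) m -> all (leq k) (incr_nth m i).
Proof.
elim: m i => [|j m IH] [|i] //= im /andP [kj km]; first by rewrite km (leq_trans kj).
by rewrite kj IH.
Qed.

Lemma size_index_word m : all (leq 1) m -> size (index_word m) = sumn m.
Proof.
elim: m => [|k m IH] // /andP [k1 m1].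
by rewrite index_word_cons /= size_cat size_nseq IH // -addSn prednK.
Qed.

Lemma last_index_word c m : all (leq 2) m -> m != [::] -> last c (index_word m) = false.
Proof.
case/lastP: m => // m k; rewrite all_rcons => /andP [k2 _] _.
rewrite -cats1 index_word_cat last_cat index_word_cons cats0.
by case: k k2 => [|[|k]] // _ /=; elim: k.
Qed.

Lemma convergent_index_word m : all (leq 2) m -> convergent_word (index_word m).
Proof.
case: m => // k m m2; rewrite /convergent_word last_index_word // andbT.
Qed.

(** Read backwards, the trailing zeros come first and each remaining 1 is followed by the zeros that
    preceded it, whence the reversed index in [tangent_coef]. *)
Lemma rev_index_gap m a : all (leq 1) m ->
  rev (behead (index_word m ++ true :: nseq a false)) =
  nseq a false ++ index_word (rev m).
Proof.
have rev_nseq b : rev (nseq b false) = nseq b false.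
  by elim: b => [|b IH] //=; rewrite rev_cons IH -cats1 nseq_cat_cons cats0.
elim: m => [|k m IH]; first by rewrite /= rev_nseq cats0.
case/andP => k1 m1; rewrite index_word_cons /= -catA rev_cat rev_nseq.
have -> : index_word m ++ true :: nseq a false =
    true :: behead (index_word m ++ true :: nseq a false).
  by case: m {IH m1} => // ? ?; rewrite index_word_cons.
rewrite rev_cons IH // rev_cons -[rcons (rev m) k]cats1 index_word_cat -cats1 -!catA.
by rewrite index_word_cons cats0.
Qed.

Section BlockValues.
Variables (R : realType) (Zsh : word_alg -> {poly R}).
Hypothesis Zsh_def : is_Zsh Zsh.
Variables (A : comAlgType rat) (I : bool -> seq bool -> bool -> A).
Hypothesis I_nil : forall a b, I a [::] b = 1.
Hypothesis I_shuffle : forall a u v b,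
  I a u b * I a v b = \sum_(w <- shuffles u v) I a w b.
Hypothesis I_path : forall a w b x,
  I a w b = \sum_(k < (size w).+1) I a (take k w) x * I x (drop k w) b.
Hypothesis I_loop : forall a w, w != [::] -> I a w a = 0.
Hypothesis I_zero : I false [:: false] true = 0.
Variable z : {linear A -> R | ratr \; *%R}.
Hypothesis z_def : forall n, all (leq 1) n ->
  z (I false (index_word n) true) = zeta_sh Zsh n.

Local Notation span := (convergent_span I).

Lemma z_index_word m : all (leq 2) m -> z (I false (index_word m) true) = mzv R m.
Proof.
move=> m2; rewrite (z_word Zsh_def z_def) ?convergent_index_word //.
by rewrite word_index_word //; apply: sub_all m2 => k; apply: ltnW.
Qed.

(** [zero_shiftS] and the definition of [shifted_mzv] are the same recursion; raising an index keeps
    it at least 2, so only convergent words remain at the bottom. *)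
Lemma z_zero_shift b m : all (leq 2) m ->
  span (zero_shift I b m) /\ z (zero_shift I b m) = shifted_mzv R b m.
Proof.
elim: b m => [|b IH] m m2.
  by split; [apply/span_word/convergent_index_word | apply: z_index_word].
have m1 : all (leq 1) m by apply: sub_all m2 => k; apply: ltnW.
have IHi (i : 'I_(size m)) := IH _ (all_incr_nth (ltn_ord i) m2).
rewrite (zero_shiftS I_shuffle I_zero b m1); split.
  apply: in_spanZ; apply: span_sum => i _; rewrite -scaler_nat; apply: in_spanZ.
  by have [] := IHi i.
rewrite zZ z_sum rmorphN fmorphV rmorph_nat /=; congr (_ * _).
by apply: eq_bigr => i _; rewrite raddfMn /=; have [_ ->] := IHi i.
Qed.

Lemma span_sign k x : span x -> span ((-1) ^+ k * x) /\ z ((-1) ^+ k * x) = (-1) ^+ k * z x.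
Proof.
move=> xs; rewrite -signr_odd -[in RHS]signr_odd; case: (odd k).
  rewrite !expr1 !mulN1r raddfN /=; split=> //.
  by rewrite -scaleN1r; apply: in_spanZ.
by rewrite !expr0 !mul1r.
Qed.

(** The first gap is a path from 1 to 0. Path reversal turns it into a [zero_shift], with a sign
    given by its length [sumn (take s n) + a]. *)
Lemma z_block_coef n k : all (leq 2) n ->
  span (block_coef I n k) /\ z (block_coef I n k) = tangent_coef R n k.
Proof.
move=> n2.
have h s (a : nat) : (s < size n)%N ->
    span (I true (behead (index_word (take s n) ++ true :: nseq a false)) false *
       zero_shift I (nth 0%N n s - k - a) (drop s.+1 n)) /\
    z (I true (behead (index_word (take s n) ++ true :: nseq a false)) false *
       zero_shift I (nth 0%N n s - k - a) (drop s.+1 n)) =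
    (-1) ^+ (sumn (take s n) + a) * shifted_mzv R a (rev (take s n)) *
      shifted_mzv R (nth 0%N n s - k - a) (drop s.+1 n).
  move=> sn.
  have t2 : all (leq 2) (take s n) by apply/allP => j /mem_take; apply: (allP n2).
  have d2 : all (leq 2) (drop s.+1 n) by apply/allP => j /mem_drop; apply: (allP n2).
  have t1 : all (leq 1) (take s n) by apply: sub_all t2 => j; apply: ltnW.
  rewrite (I_reverse I_nil I_shuffle I_path I_loop) rev_index_gap //.
  have -> : size (behead (index_word (take s n) ++ true :: nseq a false)) =
      (sumn (take s n) + a)%N.
    by rewrite size_behead size_cat size_index_word //= size_nseq addnS.
  have r2 : all (leq 2) (rev (take s n)) by rewrite all_rev.
  have [s1 z1] := z_zero_shift a r2.
  have [s2 z2] := z_zero_shift (nth 0%N n s - k - a) d2.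
  have [s1' z1'] := span_sign (sumn (take s n) + a) s1.
  have [s3 z3] := z_mul Zsh_def I_shuffle z_def s1' s2.
  split=> //; rewrite z3 z1' z2.
  by rewrite z1.
split.
  apply: span_sum => s _; case: ifP => _; last exact: in_span0.
  by apply: span_sum => a _; have [] := h s a (ltn_ord s).
rewrite z_sum; apply: eq_bigr => s _; case: ifP => _; last exact: z0.
by rewrite z_sum; apply: eq_bigr => a _; have [_ ->] := h s a (ltn_ord s).
Qed.

(** [y] accumulates the block coefficients already read, so that [z] is split off one convergent
    factor at a time. *)
Lemma z_refine_sum (V : zmodType) (W p : nat) n (F : R -> seq nat -> V) y :
    all (leq 2) n -> span y ->
  refine_sum (block_coef I) W p n (fun x ks => F (z (y * x)) ks) =
  refine_sum (tangent_coef R) W p n (fun c ks => F (z y * c) ks).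
Proof.
elim: p n F y => [|p IH] n F y n2 ys.
  by case: n n2 => //= _; rewrite !mulr1.
have [->|n0] := eqVneq n [::]; first by rewrite /= !mulr1.
rewrite !refine_sum_cons //; apply: eq_bigr => i _; apply: eq_bigr => k _.
have [|bs bz] := @z_block_coef (take i.+1 n) k.
  by apply/allP => j /mem_take; apply: (allP n2).
have [ybs ybz] := z_mul Zsh_def I_shuffle z_def ys bs.
transitivity (refine_sum (block_coef I) W p (drop i.+1 n)
    (fun x ks => F (z ((y * block_coef I (take i.+1 n) k) * x)) (k :: ks))).
  by apply: eq_refine_sum => x ks _; rewrite mulrA.
rewrite (IH _ (fun c ks => F c (k :: ks))) //.
  by apply: eq_refine_sum => x ks _; rewrite ybz bz mulrA.
by apply/allP => j /mem_drop; apply: (allP n2).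
Qed.

End BlockValues.

(** * Evaluation in the quotient algebra *)

Section QuotientRelations.

Lemma iq_proj_rel (K : comNzRingType) (A : comAlgType K) (G : set A)
    (pf : ~ in_ideal G 1) (x y : A) :
  G (x - y) -> iq_proj pf x = iq_proj pf y.
Proof.
move=> h; apply/iq_projP; exists [:: (1, x - y)]; last by rewrite big_seq1 mul1r.
by move=> p; rewrite inE => /eqP ->.
Qed.

Lemma II_nil a b : II a [::] b = 1.
Proof.
rewrite -(rmorph1 (iq_proj Ibul_proper)); apply: iq_proj_rel.
exact: symb_rel1.
Qed.

Lemma II_shuffle a u v b : II a u b * II a v b = \sum_(w <- shuffles u v) II a w b.
Proof.
rewrite -(sum_shuffle_word (fun w => II a w b)) -rmorphM -rmorph_sum.
by apply: iq_proj_rel; apply: symb_rel2.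
Qed.

Lemma II_path a w b x :
  II a w b = \sum_(k < (size w).+1) II a (take k w) x * II x (drop k w) b.
Proof.
under eq_bigr do rewrite -rmorphM.
rewrite -rmorph_sum; apply: iq_proj_rel; exact: symb_rel3.
Qed.

Lemma II_loop a w : w != [::] -> II a w a = 0.
Proof.
move=> w0; rewrite -(rmorph0 (iq_proj Ibul_proper)); apply: iq_proj_rel.
by rewrite subr0; apply: symb_rel4.
Qed.

Lemma I1_nil a b : I1 a [::] b = 1.
Proof. by rewrite /I1 II_nil rmorph1. Qed.

Lemma I1_shuffle a u v b : I1 a u b * I1 a v b = \sum_(w <- shuffles u v) I1 a w b.
Proof. by rewrite /I1 -rmorphM II_shuffle rmorph_sum. Qed.

Lemma I1_path a w b x :
  I1 a w b = \sum_(k < (size w).+1) I1 a (take k w) x * I1 x (drop k w) b.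
Proof.
rewrite {1}/I1 (II_path a w b x) rmorph_sum; apply: eq_bigr => k _.
by rewrite rmorphM.
Qed.

Lemma I1_loop a w : w != [::] -> I1 a w a = 0.
Proof. by move=> w0; rewrite /I1 II_loop // rmorph0. Qed.

Lemma I1_zero : I1 false [:: false] true = 0.
Proof.
rewrite -(rmorph0 (iq_proj I1bul_proper)); apply: iq_proj_rel.
by rewrite subr0.
Qed.

End QuotientRelations.

Section CoproductValue.
Variables (R : realType) (Delta : {linear I1bul -> tensor I1bul I1bul}).
Hypothesis Delta_def : is_goncharov_coproduct Delta.
Variables (Zsh : word_alg -> {poly R}) (Zsh_def : is_Zsh Zsh).
Variables (zsh : {linear I1bul -> R | ratr \; *%R}) (zsh_def : is_zsh Zsh zsh).
Variables (g : {linear I1bul -> (nat -> R[i]) | ratr \; *:%R}) (g_def : is_g g).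

Lemma tensor_zg_add : {morph tensor_zg zsh g : x y / x + y}.
Proof.
have sb : semibilinear (ratr : {rmorphism rat -> R[i]}) (fun a b => (zsh a)%:C *: g b).
  split=> [k v v' w|k v w w'] /=.
    rewrite (linearP zsh) rmorphD rmorphM /=.
    by rewrite scalerDl scalerA -(fmorph_rat (real_complex R)).
  by rewrite (linearP g) /= scalerDr !scalerA mulrC.
move=> x y; have := tensor_lift_is_linear sb 1 x y.
by rewrite scale1r rmorph1 scale1r.
Qed.

(** One coefficient of the left-hand side in its final form: the initial segment contributes a zeta
    value, the rest a sum over block decompositions. The Eisenstein side is brought to the same
    shape. *)
Lemma coproduct_value (W : nat) (n : seq nat) (N : nat) :
    all (leq 2) n -> all (fun m => m < W)%N n ->
  tensor_zg zsh g (Delta (I1n n)) N =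
  \sum_(i < (size n).+1) refine_sum (tangent_coef R) W (size n) (drop i n)
    (fun c ks => (mzv R (take i n) * c)%:C * gser R ks N).
Proof.
move=> n2 nW; rewrite /I1n Delta_def.
pose h (t : tensor I1bul I1bul) : R[i] := tensor_zg zsh g t N.
have hD : {morph h : x y / x + y} by move=> x y; rewrite /h tensor_zg_add.
have h0 : h 0 = 0 by apply: (addIr (h 0)); rewrite -hD !add0r.
rewrite -/(h _) (goncharov_formulaE _ _ _ hD h0).
pose G v : R[i] := g (I1 false v true) N.
rewrite (eq_coproduct_sum _ _ _ _ _ (Psi' := fun x v => (zsh x)%:C * G v)); last first.
  by move=> x v; rewrite /h tensor_zg_tens.
rewrite (@coproduct_index_word _ _ I1 I1_nil I1_loop W) //; last first.
  by move=> v x y; rewrite raddfD /= rmorphD /= mulrDl.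
apply: eq_bigr => i _.
have t2 : all (leq 2) (take i n) by apply/allP => j /mem_take; apply: (allP n2).
have d2 : all (leq 2) (drop i n) by apply/allP => j /mem_drop; apply: (allP n2).
rewrite (@z_refine_sum R Zsh Zsh_def _ I1 I1_nil I1_shuffle I1_path I1_loop I1_zero
  zsh zsh_def _ W (size n) (drop i n) (fun c ks => c%:C * G (index_word ks))) //; last first.
  exact/span_word/convergent_index_word.
rewrite (z_index_word Zsh_def zsh_def) //; apply: eq_refine_sum => c ks ks2.
congr (_ * _); rewrite /G -/(I1n ks) g_def //.
by apply: sub_all ks2 => k; apply: ltnW.
Qed.

End CoproductValue.

(** * Truncated Eisenstein series *)

Lemma mzv_truncE (R : realType) n M :
  mzv_trunc R n M = chain (fun k (j : nat) => j%:R ^- k : R) (iota 1 M.-1) n.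
Proof.
apply: (sum_path_tuple (e := ltn) (u0 := 0%N) _ (fun k (j : nat) => j%:R ^- k : R)) => //.
- by move=> x; rewrite /= ltnn.
- exact: ltn_trans.
- exact: iota_ltn_sorted.
- case: M => [|M] u; rewrite mem_iota /= ?add1n ?ltnS //=; first by case: u.
  by case/andP => _ uM; exists (inord u); rewrite inordK.
- by case: M => [[]|M] // y; rewrite mem_iota /= add1n ltn_ord andbT.
Qed.

Section EisensteinRows.
Variables (R : realType) (tau : R[i]).

Definition lattice_row (M l : nat) : seq (int * int) :=
  [seq (l%:Z, j%:Z - M%:Z) | j <- iota 0 M.*2.+1].

Definition positive_row (M : nat) : seq (int * int) :=
  [seq (0, j%:Z) | j <- iota 1 M].

Definition lattice_rows (L M : nat) : seq (int * int) :=
  flatten [seq lattice_row M l | l <- iota 1 L].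

Lemma lattice_ltE x y : lattice_lt x y = (x.1 < y.1) || (x.1 == y.1) && (x.2 < y.2).
Proof. by rewrite /lattice_lt /lattice_pos /= !subr_gt0 subr_eq0 eq_sym. Qed.

Lemma lattice_lt_irr : irreflexive lattice_lt.
Proof. by move=> x; rewrite lattice_ltE !ltxx andbF. Qed.

Lemma lattice_lt_trans : transitive lattice_lt.
Proof. move=> y x z; rewrite !lattice_ltE; lia. Qed.

Lemma mem_lattice_row M l (x : int * int) :
  (x \in lattice_row M l) = (x.1 == l%:Z) && (- M%:Z <= x.2 <= M%:Z).
Proof.
apply/mapP/andP => [[j]|[]].
  by rewrite mem_iota => /andP [_ jM] -> /=; split=> //; lia.
case: x => a b /= /eqP -> bM; exists (absz (b + M%:Z)); last by congr (_, _); lia.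
by rewrite ?inE mem_iota; lia.
Qed.

Lemma mem_positive_row M (x : int * int) :
  (x \in positive_row M) = (x.1 == 0) && (0 < x.2 <= M%:Z).
Proof.
apply/mapP/andP => [[j]|[]].
  by rewrite mem_iota => jM -> /=; split=> //; lia.
case: x => a b /= /eqP -> bM; exists (absz b); last by congr (_, _); lia.
by rewrite ?inE mem_iota; lia.
Qed.

Lemma mem_lattice_rows L M (x : int * int) :
  (x \in lattice_rows L M) = (0 < x.1 <= L%:Z) && (- M%:Z <= x.2 <= M%:Z).
Proof.
apply/flattenP/andP => [[r /mapP [l]]|[xL xM]].
  by rewrite mem_iota => lL ->; rewrite mem_lattice_row => /andP [/eqP -> ->]; split=> //; lia.
exists (lattice_row M (absz x.1)); last by rewrite mem_lattice_row xM andbT; lia.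
by apply: map_f; rewrite mem_iota; lia.
Qed.

Lemma pairwise_map_iota (T : Type) (e : rel T) (h : nat -> T) m k :
  (forall i j, (i < j)%N -> e (h i) (h j)) -> pairwise e [seq h j | j <- iota m k].
Proof.
move=> he; rewrite pairwise_map.
apply: (sub_pairwise (r := ltn)); first by move=> i j; apply: he.
by rewrite -sorted_pairwise ?iota_ltn_sorted //; apply: ltn_trans.
Qed.

Lemma pairwise_lattice_rows m L M :
  pairwise lattice_lt (flatten [seq lattice_row M l | l <- iota m L]).
Proof.
elim: L m => [|L IH] m //.
rewrite -[flatten _]/(lattice_row M m ++ flatten [seq lattice_row M l | l <- iota m.+1 L]).
rewrite pairwise_cat IH andbT; apply/andP; split.
  apply/allrelP => x y; rewrite mem_lattice_row => /andP [/eqP x1 _].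
  move=> /flattenP [r /mapP [l]]; rewrite mem_iota => lm ->.
  rewrite mem_lattice_row => /andP [/eqP y1 _].
  by rewrite lattice_ltE x1 y1; lia.
by apply: pairwise_map_iota => i j ij; rewrite lattice_ltE /= ltxx eqxx /=; lia.
Qed.

(** Listed row by row, the positive points of the box increase for [lattice_lt]; as a [chain] over a
    concatenation, the sum then factors through the rows. *)
Lemma eisenstein_truncE n L M :
  eisenstein_trunc n tau L M =
  chain (fun k x => lattice_point tau x ^- k)
    (positive_row M ++ lattice_rows L M) n.
Proof.
apply: (sum_path_tuple (e := lattice_lt) (u0 := (0, 0)) (f := @box_point L M) _
  (fun k x => lattice_point tau x ^- k)).
- move=> [a b] [c d] [/addIr [ac] /addIr [bd]].
  by congr (_, _); apply: val_inj.
- exact: lattice_lt_irr.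
- exact: lattice_lt_trans.
- rewrite (sorted_pairwise lattice_lt_trans) pairwise_cat pairwise_lattice_rows andbT.
  apply/andP; split.
    apply/allrelP => x y; rewrite mem_positive_row mem_lattice_rows lattice_ltE; lia.
  by apply: pairwise_map_iota => i j ij; rewrite lattice_ltE /=; lia.
- move=> [a b]; rewrite mem_cat mem_positive_row mem_lattice_rows /= => h.
  have [ha hb] : - L%:Z <= a <= L%:Z /\ - M%:Z <= b <= M%:Z by lia.
  exists (inord (absz (a + L%:Z)), inord (absz (b + M%:Z))); rewrite /box_point /=.
  by rewrite !inordK; [congr (_, _); lia | lia | lia].
- move=> [a b]; rewrite mem_cat mem_positive_row mem_lattice_rows lattice_ltE /=.
  have := ltn_ord a; have := ltn_ord b; lia.
Qed.

End EisensteinRows.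

(** * Products over rows *)

Section RowProducts.
Variable K : comNzRingType.

(** The product of moulds: the index is deconcatenated into as many consecutive pieces, possibly
    empty, as there are factors. *)
Fixpoint mould_prod (Fs : seq (seq nat -> K)) (n : seq nat) : K :=
  if Fs is F :: Fs' then
    \sum_(i < (size n).+1) F (take i n) * mould_prod Fs' (drop i n)
  else (n == [::])%:R.

Lemma chain_flatten (T : Type) (f : nat -> T -> K) rows n :
  chain f (flatten rows) n = mould_prod (map (chain f) rows) n.
Proof.
elim: rows n => [|r rows IH] n //=.
by rewrite chain_cat; apply: eq_bigr => i _; rewrite IH.
Qed.

Variables (A : pzRingType) (B : seq nat -> nat -> A) (W : nat).

Lemma refine_sumD p n (Psi Psi' : A -> seq nat -> K) :
  refine_sum B W p n (fun x ks => Psi x ks + Psi' x ks) =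
  refine_sum B W p n Psi + refine_sum B W p n Psi'.
Proof.
elim: p n Psi Psi' => [|p IH] [|m n] Psi Psi' //=; first by rewrite addr0.
rewrite -big_split; apply: eq_bigr => i _ /=; rewrite -big_split.
by apply: eq_bigr => k _; rewrite IH.
Qed.

Lemma refine_sumZ a p n (Psi : A -> seq nat -> K) :
  refine_sum B W p n (fun x ks => a * Psi x ks) = a * refine_sum B W p n Psi.
Proof.
elim: p n Psi => [|p IH] [|m n] Psi //=; first by rewrite mulr0.
rewrite mulr_sumr; apply: eq_bigr => i _ /=; rewrite mulr_sumr.
by apply: eq_bigr => k _; rewrite IH.
Qed.

Lemma refine_sum0 p n (Psi : A -> seq nat -> K) : (forall x ks, Psi x ks = 0) ->
  refine_sum B W p n Psi = 0.
Proof.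
elim: p n Psi => [|p IH] [|m n] Psi e //=; rewrite ?e //.
by rewrite big1 // => i _; rewrite big1 // => k _; apply: IH.
Qed.

(** Each row takes either an empty piece, with factor 1, or a nonempty piece collapsed to an index
    [k]. The nonempty pieces form a decomposition of [n], and the rows that hold them form the
    increasing choice in [chain phi]. *)
Lemma mould_prod_refine (h : A -> K) (phi : nat -> nat -> K) (ls : seq nat) p n :
    h 1 = 1 -> {morph h : x y / x * y} -> (size n <= p)%N ->
  mould_prod [seq (fun n' => if n' is [::] then 1 else
     \sum_(2 <= k < W) h (B n' k) * phi k l) | l <- ls] n =
  refine_sum B W p n (fun x ks => h x * chain phi ls ks).
Proof.
move=> h1 hM; elim: ls p n => [|l ls IH] p n np.
  case: n np => [|m n] np; first by rewrite refine_sum_nil h1 mul1r.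
  case: p np => // p _; rewrite refine_sum_cons //= big1 // => i _.
  by rewrite big1 // => k _; apply: refine_sum0 => x ks; rewrite mulr0.
rewrite [LHS]/= big_ord_recl take0 drop0 mul1r (IH p) //.
case: n np => [|m n] np; first by rewrite big_ord0 addr0 !refine_sum_nil !chain_nil.
case: p np => // p np.
transitivity (refine_sum B W p.+1 (m :: n) (fun x ks => h x * chain phi ls ks) +
  refine_sum B W p.+1 (m :: n) (fun x ks => h x * (if ks is k :: ks' then
     phi k l * chain phi ls ks' else 0))); last first.
  rewrite -refine_sumD; apply: eq_refine_sum => x ks _.
  by rewrite -mulrDr.
congr (_ + _); rewrite refine_sum_cons //; apply: eq_bigr => i _.
rewrite [take _ _]/= [drop _ _]/= big_distrl /=; apply: eq_bigr => k _.
rewrite (IH p) ?size_drop; last by move: np => /=; lia.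
rewrite -refine_sumZ; apply: eq_refine_sum => x ks _.
by rewrite hM; ring.
Qed.

End RowProducts.

(** * Partial fractions *)

Lemma mul_bin_shift n j : (j.+1 * 'C((n + j.+1).-1, j.+1) = n * 'C(n + j, j))%N.
Proof.
case: n => [|n]; first by rewrite mul0n; apply/eqP; rewrite muln_eq0 orFb -leqn0 leqNgt bin_gt0 ltnn.
have h1 := mul_bin_diag (n + j.+1) j; have h2 := mul_bin_down (n + j.+1) j.
rewrite -[(n.+1 + j.+1).-1]/(n + j.+1)%N -h1 h2 -addSnnS addnK; reflexivity.
Qed.

Lemma coef_comp_polyNX (K : comNzRingType) (P : {poly K}) j :
  (P \Po (- 'X))`_j = (-1) ^+ j * P`_j.
Proof.
elim/poly_ind: P j => [|P a IH] j; first by rewrite comp_poly0 !coef0 mulr0.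
rewrite comp_polyD comp_polyM comp_polyX comp_polyC !coefD !coefC.
rewrite mulrN coefN !coefMX; case: j => [|j] /=; first by rewrite oppr0 !add0r mul1r.
by rewrite IH exprS !addr0 mulN1r mulNr.
Qed.

Section TruncatedPowers.
Variables (F : fieldType) (N : nat).
Implicit Types (P Q : {poly F}) (c x : F).

Definition trunc_eq P Q := forall j, (j < N)%N -> P`_j = Q`_j.

Lemma trunc_eqM P P' Q Q' : trunc_eq P P' -> trunc_eq Q Q' -> trunc_eq (P * Q) (P' * Q').
Proof.
move=> hP hQ j jN; rewrite !coefM; apply: eq_bigr => i _.
rewrite hP ?hQ //; first by apply: leq_ltn_trans (leq_subr _ _) jN.
by apply: leq_ltn_trans jN; rewrite -ltnS.
Qed.

Lemma trunc_eqMl P Q Q' : trunc_eq Q Q' -> trunc_eq (P * Q) (P * Q').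
Proof. exact: trunc_eqM. Qed.

(** The expansion of [(c + X)^-n] modulo [X^N], for [c != 0]. *)
Definition inv_pow (n : nat) (c : F) : {poly F} :=
  \poly_(j < N) ((-1) ^+ j * 'C((n + j).-1, j)%:R * c ^- (n + j)).

Lemma inv_pow0 c P : trunc_eq (inv_pow 0 c * P) P.
Proof.
rewrite -[P in X in trunc_eq _ X]mul1r; apply: trunc_eqM => // j jN.
rewrite coef_poly jN coef1; case: j {jN} => [|j].
  by rewrite expr0 bin0 invr1 !mulr1.
by rewrite bin_small // mulr0 mul0r.
Qed.

Lemma inv_powS n c P : c != 0 ->
  trunc_eq ((c%:P + 'X) * (inv_pow n.+1 c * P)) (inv_pow n c * P).
Proof.
move=> c0; rewrite mulrA; apply: trunc_eqM => // j jN.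
rewrite mulrDl coefD coefCM coefXM !coef_poly jN.
case: j jN => [|j] jN.
  rewrite !addn0 addr0 !expr0 !bin0 exprS invfM !mul1r mulrA mulfV //.
  by rewrite mul1r.
rewrite (ltnW jN) /= !addSn !addnS /= binS natrD !exprS.
have : c ^+ (n + j) != 0 by rewrite expf_neq0.
by move: (c ^+ (n + j)) => X X0; field; rewrite c0 X0.
Qed.

Lemma coef0_inv_pow n c : (0 < N)%N -> (inv_pow n c)`_0 = c ^- n.
Proof. by move=> N0; rewrite coef_poly N0 expr0 bin0 !mul1r addn0. Qed.

Lemma inv_powN n c : inv_pow n (- c) = (-1) ^+ n *: (inv_pow n c \Po (- 'X)).
Proof.
apply/polyP => j; rewrite coefZ coef_comp_polyNX !coef_poly; case: ifP => _; rewrite ?mulr0 //.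
rewrite -[- c]mulN1r exprMn invfM invr_sign exprD.
by move: ((-1) ^+ n) ((-1) ^+ j) (c ^- (n + j)) => s t X; ring.
Qed.

Lemma deriv_inv_pow n c j : (j.+1 < N)%N ->
  ((inv_pow n c)^`())`_j = - (inv_pow n.+1 c)`_j *+ n.
Proof.
move=> jN; rewrite coef_deriv !coef_poly jN (ltnW jN).
have key (s j1 n1 c1 c2 X : F) : j1 * c1 = n1 * c2 ->
    -1 * s * c1 * X * j1 = - (s * c2 * X) * n1.
  by move=> e; transitivity (- s * (j1 * c1) * X); [ring | rewrite e; ring].
rewrite addSnnS exprS -[LHS]mulr_natr -[RHS]mulr_natr; apply: key.
by rewrite -!natrM; congr (_%:R); apply: etrans (mul_bin_shift n j) _; rewrite addnS.
Qed.

End TruncatedPowers.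

Section PartialFractions.
Variables (F : fieldType) (N : nat) (x : F).
Implicit Types (L : F -> {poly F}) (ps : seq (F * nat)).
Local Notation pw := (inv_pow N).

(** In the local parameter t = x + a, with [P] the expansion of the cofactor, this is the polar part
    of P(t) t^-n. *)
Definition principal_part a n (P : {poly F}) : F :=
  \sum_(1 <= k < n.+1) P`_(n - k) * (x + a) ^- k.

(** In the parameter X = x + c, the factor x + p.1 reads (p.1 - c) + X. *)
Definition pole_prod ps (c : F) : {poly F} := \prod_(p <- ps) pw p.2 (p.1 - c).

Lemma pole_prod_cons p ps c : pole_prod (p :: ps) c = pw p.2 (p.1 - c) * pole_prod ps c.
Proof. by rewrite /pole_prod big_cons. Qed.

(** The sum, over the factors of [ps], of the principal parts of
    [L * \prod_(p <- ps) (x + p.1)^-p.2]. *)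
Fixpoint principal_parts L ps : F :=
  if ps is p :: ps' then
    principal_part p.1 p.2 (L p.1 * pole_prod ps' p.1) +
    principal_parts (fun c => L c * pw p.2 (p.1 - c)) ps'
  else 0.

Lemma principal_part_linear a n s P Q :
  principal_part a n (s *: P + Q) = s * principal_part a n P + principal_part a n Q.
Proof.
rewrite mulr_sumr -big_split; apply: eq_bigr => k _ /=.
by rewrite coefD coefZ mulrDl mulrA.
Qed.

Lemma eq_principal_part a n P Q : (n <= N)%N -> trunc_eq N P Q ->
  principal_part a n P = principal_part a n Q.
Proof.
move=> nN PQ; rewrite /principal_part !big_nat; apply: eq_bigr => k /andP [k1 kn].
by rewrite PQ //; lia.
Qed.

Lemma principal_part_rel a n s P Q Q' : (n <= N)%N -> trunc_eq N (s *: P) (Q - Q') ->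
  s * principal_part a n P = principal_part a n Q - principal_part a n Q'.
Proof.
move=> nN e; have /esym := principal_part_linear a n (-1) Q' Q.
rewrite mulN1r addrC => ->; rewrite scaleN1r addrC -(eq_principal_part a nN e).
by rewrite /principal_part mulr_sumr; apply: eq_bigr => k _; rewrite coefZ mulrA.
Qed.

Lemma principal_partX a n P :
  principal_part a n.+1 ('X * P) = principal_part a n P.
Proof.
rewrite /principal_part big_nat_recr //= subnn coefXM mul0r addr0 !big_nat.
by apply: eq_bigr => k /andP [k1 kn]; rewrite coefXM subSn // ltnS.
Qed.

Lemma principal_parts_linear s L L' ps :
  principal_parts (fun c => s *: L c + L' c) ps =
  s * principal_parts L ps + principal_parts L' ps.
Proof.
elim: ps L L' => [|p ps IH] L L' /=; first by rewrite mulr0 addr0.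
rewrite mulrDl -scalerAl principal_part_linear mulrDr addrACA -IH; congr (_ + _).
by congr principal_parts; apply/funext => c; rewrite mulrDl -scalerAl.
Qed.

Lemma eq_principal_parts L L' ps : all (fun p => p.2 <= N)%N ps ->
    (forall c, c \in unzip1 ps -> trunc_eq N (L c) (L' c)) ->
  principal_parts L ps = principal_parts L' ps.
Proof.
elim: ps L L' => [|p ps IH] L L' //= /andP [pN psN] LL; congr (_ + _).
  apply: eq_principal_part => //; apply: trunc_eqM => //.
  by apply: LL; rewrite mem_head.
by apply: IH => // c cps; apply: trunc_eqM => //; apply: LL; rewrite inE cps orbT.
Qed.

Lemma principal_parts_rel s L L1 L2 ps : all (fun p => p.2 <= N)%N ps ->
    (forall c, c \in unzip1 ps -> trunc_eq N (s *: L c) (L1 c - L2 c)) ->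
  s * principal_parts L ps = principal_parts L1 ps - principal_parts L2 ps.
Proof.
move=> psN e; rewrite -(eq_principal_parts (L := fun c => s *: L c + L2 c) (L' := L1) psN).
  by rewrite principal_parts_linear addrK.
by move=> c cps j jN; rewrite coefD (e c cps j jN) coefB subrK.
Qed.

(** With A = x + a and B = x + b, both sides satisfy (b - a) A^-(n+1) B^-(k+1) = A^-(n+1) B^-k -
    A^-n B^-(k+1); for the principal parts this is [inv_powS] in each local expansion. Induction
    leads to a single pole. Exponents 0 are dropped, and a pole weighs its exponent plus 1 so that
    dropping it lowers the measure. The hypothesis [has] excludes the constant 1, which has no
    principal part. *)
Lemma partial_fractions ps :
    uniq (unzip1 ps) -> all (fun p => x + p.1 != 0) ps ->
    all (fun p => p.2 <= N)%N ps -> has (fun p => 0 < p.2)%N ps ->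
  \prod_(p <- ps) (x + p.1) ^- p.2 = principal_parts (fun _ => 1) ps.
Proof.
have [m] := ubnP (\sum_(p <- ps) p.2.+1)%N.
have drop0 a r : all (fun p => p.2 <= N)%N r ->
    principal_parts (fun _ => 1) ((a, 0%N) :: r) = principal_parts (fun _ => 1) r.
  move=> rN /=; rewrite /principal_part big_geq // add0r.
  apply: eq_principal_parts => // c _; rewrite mul1r -[pw _ _]mulr1; exact: inv_pow0.
elim: m ps => // m IH [|[a n] ps] //.
rewrite [X in (X < _)%N -> _]big_cons ltnS.
case: n => [|n] hm ups /andP [xa xps] psN hps.
  have psN' : all (fun p => p.2 <= N)%N ps by case/andP: psN.
  rewrite drop0 // big_cons expr0 invr1 mul1r; apply: IH => //.
  by case/andP: ups.
case: ps hm ups xps psN {hps} => [|[b k] ps] hm ups xps psN.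
  rewrite big_seq1 /= addr0 /pole_prod big_nil mulr1 /principal_part.
  rewrite big_nat_recr //= subnn coef1 mul1r big_nat big1 ?add0r // => j /andP [j1 jn].
  have -> : (1 : {poly F})`_(n.+1 - j) = 0 by rewrite coef1 gtn_eqF // subn_gt0.
  by rewrite mul0r.
move: ups xps psN hm => /= /and3P [aps bps ups] /andP [xb xps] /and3P [nN kN psN] hm.
have ab : b - a != 0.
  by rewrite subr_eq0 eq_sym; apply: contra aps => /eqP ->; rewrite mem_head.
case: k kN hm => [|k] kN hm.
  transitivity (\prod_(p <- (a, n.+1) :: ps) (x + p.1) ^- p.2).
    by rewrite !big_cons /= expr0 invr1 mul1r.
  rewrite IH //=.
  - congr (_ + _).
      apply: eq_principal_part => //; rewrite !mul1r /pole_prod big_cons /=.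
      by move=> j jN; rewrite (inv_pow0 _ _ jN).
    rewrite [principal_part b 0 _]/principal_part big_geq // add0r.
    apply: eq_principal_parts => // c _ j jN.
    by rewrite [_ * pw 0 _]mulrC inv_pow0.
  - by move: hm; rewrite !big_cons /=; lia.
  - by rewrite ups andbT; move: aps; rewrite inE negb_or => /andP [].
  - by rewrite xa.
  - by rewrite nN.
have e1 : \prod_(p <- (a, n.+1) :: (b, k) :: ps) (x + p.1) ^- p.2 =
    principal_parts (fun _ => 1) ((a, n.+1) :: (b, k) :: ps).
  apply: IH; rewrite /= ?aps ?bps ?xa ?xb ?nN ?(ltnW kN) //.
  by move: hm; rewrite !big_cons /=; lia.
have e2 : \prod_(p <- (a, n) :: (b, k.+1) :: ps) (x + p.1) ^- p.2 =
    principal_parts (fun _ => 1) ((a, n) :: (b, k.+1) :: ps).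
  apply: IH; rewrite /= ?aps ?bps ?xa ?xb ?kN ?(ltnW nN) ?orbT //.
  by move: hm; rewrite !big_cons /=; lia.
apply: (mulfI ab).
transitivity (\prod_(p <- (a, n.+1) :: (b, k) :: ps) (x + p.1) ^- p.2 -
              \prod_(p <- (a, n) :: (b, k.+1) :: ps) (x + p.1) ^- p.2).
  rewrite !big_cons /= !exprS.
  have Xa : (x + a) ^+ n != 0 by rewrite expf_neq0.
  have Xb : (x + b) ^+ k != 0 by rewrite expf_neq0.
  move: ((x + a) ^+ n) ((x + b) ^+ k) Xa Xb => Xa Xb Xa0 Xb0.
  by field; rewrite xa xb Xa0 Xb0.
rewrite {}e1 {}e2 /= !mul1r.
set Pa := pole_prod ps a; set Pb := pole_prod ps b.
have shift c d j P : d - c != 0 ->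
    trunc_eq N ((d - c) *: (pw j.+1 (d - c) * P)) (pw j (d - c) * P - 'X * (pw j.+1 (d - c) * P)).
  move=> dc i iN; rewrite coefB -(inv_powS _ _ dc iN) mulrDl coefD mul_polyC.
  by rewrite addrK.
have ba : a - b != 0 by rewrite -opprB oppr_eq0.
have ha : (b - a) * principal_part a n.+1 (pw k.+1 (b - a) * Pa) =
    principal_part a n.+1 (pw k (b - a) * Pa) - principal_part a n (pw k.+1 (b - a) * Pa).
  rewrite -[principal_part a n _]principal_partX; apply: principal_part_rel => //.
  exact: shift.
have hb : (b - a) * principal_part b k.+1 (pw n.+1 (a - b) * Pb) =
    principal_part b k (pw n.+1 (a - b) * Pb) - principal_part b k.+1 (pw n (a - b) * Pb).
  rewrite -[principal_part b k _]principal_partX; apply: principal_part_rel => // j jN.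
  by rewrite -opprB scaleNr coefN shift // -coefN opprB.
pose L i j c := 1 * pw i (a - c) * pw j (b - c).
have hc : (b - a) * principal_parts (L n.+1 k.+1) ps =
    principal_parts (L n.+1 k) ps - principal_parts (L n k.+1) ps.
  apply: principal_parts_rel => // c cps.
  have ac : a - c != 0.
    rewrite subr_eq0; apply: contra aps => /eqP ->.
    by rewrite inE cps orbT.
  have bc : b - c != 0 by rewrite subr_eq0; apply: contra bps => /eqP ->.
  move=> j jN; rewrite /L !mul1r coefB.
  rewrite -(inv_powS n (pw k.+1 (b - c)) ac jN) [pw n.+1 (a - c) * pw k _]mulrC.
  rewrite -(inv_powS k (pw n.+1 (a - c)) bc jN).
  rewrite -coefB -mul_polyC.
  have -> : (b - a)%:P = ((b - c)%:P + 'X) - ((a - c)%:P + 'X).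
    by rewrite opprD addrACA subrr addr0 -polyCB opprB addrA subrK.
  by apply: (congr1 (fun P : {poly F} => P`_j)); ring.
by rewrite !pole_prod_cons !mulrDr ha hb hc; ring.
Qed.

End PartialFractions.

Section ChainPartialFractions.
Variables (F : fieldType) (N : nat) (x : F).
Implicit Types (L : F -> {poly F}) (X : seq F) (n : seq nat).
Local Notation pw := (inv_pow N).

(** The products of [chain], kept apart as lists of pairs (pole, exponent), because partial
    fractions apply to each product separately. *)
Fixpoint chain_terms X n : seq (seq (F * nat)) :=
  if X is a :: X' then
    chain_terms X' n ++ (if n is k :: n' then map (cons (a, k)) (chain_terms X' n') else [::])
  else if n is [::] then [:: [::]] else [::].

Lemma chain_termsE (K : comNzRingType) (f : nat -> F -> K) X n :
  chain f X n = \sum_(ps <- chain_terms X n) \prod_(p <- ps) f p.2 p.1.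
Proof.
elim: X n => [|a X IH] [|k n] /=; rewrite ?big_nil ?big_seq1 ?big_nil //.
  by rewrite cats0 IH addr0.
rewrite big_cat big_map !IH /= mulr_sumr; congr (_ + _).
by apply: eq_bigr => ps _; rewrite big_cons.
Qed.

Lemma chain_terms_nil X : chain_terms X [::] = [:: [::]].
Proof. by elim: X => //= a X ->. Qed.

Lemma chain_termsP X n ps : ps \in chain_terms X n ->
  subseq (unzip1 ps) X /\ unzip2 ps = n.
Proof.
elim: X n ps => [|a X IH] [|k n] ps //=; try by rewrite inE => /eqP ->.
  by rewrite cats0 => /IH [h ->]; split=> //; apply: subseq_trans h (subseq_cons _ _).
rewrite mem_cat => /orP [/IH [h ->]|/mapP [ps' /IH [h e] ->]].
  by split=> //; apply: subseq_trans h (subseq_cons _ _).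
by split; rewrite /= ?eqxx // -e.
Qed.

(** The principal parts grouped by the pole X_j and the index n_s placed there. Earlier indices use
    earlier points and later indices later points, independently, so the cofactor is a product of
    two chains. *)
Definition chain_principal L X n : F :=
  \sum_(j < size X) \sum_(s < size n)
    principal_part x (nth 0 X j) (nth 0%N n s)
      (L (nth 0 X j) *
       chain (fun k b => pw k (b - nth 0 X j)) (take j X) (take s n) *
       chain (fun k b => pw k (b - nth 0 X j)) (drop j.+1 X) (drop s.+1 n)).

Lemma principal_partD a k (P Q : {poly F}) :
  principal_part x a k (P + Q) = principal_part x a k P + principal_part x a k Q.
Proof. by have := principal_part_linear x a k 1 P Q; rewrite scale1r mul1r. Qed.

Lemma principal_part0 a k : principal_part x a k (0 : {poly F}) = 0.
Proof. by rewrite /principal_part big1 // => j _; rewrite coef0 mul0r. Qed.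

Lemma chain_principalE L X n :
  \sum_(ps <- chain_terms X n) principal_parts N x L ps = chain_principal L X n.
Proof.
rewrite /chain_principal; elim: X L n => [|a X IH] L n.
  by rewrite big_ord0; case: n => [|k n]; rewrite /= ?big_seq1 ?big_nil.
case: n => [|k n].
  rewrite chain_terms_nil big_seq1 big1 // => j _; exact: big_ord0.
rewrite big_ord_recl [chain_terms _ _]/= big_cat big_map /= IH.
rewrite [X in _ + X](_ : _ = principal_part x a k
    (L a * chain (fun k b => pw k (b - a)) X n) +
    chain_principal (fun c => L c * pw k (a - c)) X n); last first.
  rewrite big_split /=; congr (_ + _); last by rewrite IH.
  rewrite chain_termsE mulr_sumr.
  rewrite (big_morph (principal_part x a k) (@principal_partD a k) (@principal_part0 a k)).
  by [].
rewrite addrCA; congr (_ + _).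
  rewrite big_ord_recl /= mulr1 !drop0 big1 ?addr0 // => s _.
  by rewrite mulr0 mul0r principal_part0.
rewrite -big_split; apply: eq_bigr => j _ /=.
rewrite big_ord_recl [RHS]big_ord_recl /= !drop0 !chain_nil addr0 -!addrA.
congr (_ + _); rewrite -big_split; apply: eq_bigr => s _ /=.
rewrite -principal_partD; congr principal_part.
by rewrite mulrDr mulrDl; congr (_ + _); ring.
Qed.

Theorem chain_partial_fractions X n :
    uniq X -> all (fun a => x + a != 0) X ->
    all (leq 1) n -> all (fun k => k <= N)%N n -> n != [::] ->
  chain (fun k a => (x + a) ^- k) X n = chain_principal (fun _ => 1) X n.
Proof.
move=> uX xX n1 nN n0; rewrite -chain_principalE chain_termsE big_seq [RHS]big_seq.
apply: eq_bigr => ps /chain_termsP [psX psn].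
rewrite (partial_fractions (N := N)) //.
- exact: subseq_uniq uX.
- by rewrite -(all_map fst (fun a => x + a != 0)); apply/allP => a /(mem_subseq psX) /(allP xX).
- by rewrite -(all_map snd (fun k => k <= N)%N) -/(unzip2 ps) psn.
- rewrite -(has_map snd (leq 1)) -/(unzip2 ps) psn.
  by case: n n0 n1 {nN psn} => //= k n _ /andP [-> _].
Qed.

End ChainPartialFractions.

Local Open Scope classical_set_scope.

(** * Complex limits *)

Notation cabs := ComplexField.Normc.normc.

Section ComplexLimits.
Variable R : realType.
Implicit Types (u v : nat -> R[i]) (a b : nat -> R) (l m x y : R[i]).

Lemma normE x : `|x| = (cabs x)%:C.
Proof. by case: x => a b; rewrite normc_def. Qed.

Lemma cabs_ge0 x : 0 <= cabs x.
Proof. by case: x => a b; apply: sqrtr_ge0. Qed.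

Lemma cabsD x y : cabs (x + y) <= cabs x + cabs y.
Proof. exact: (@le_normcD R). Qed.

Lemma cabsM x y : cabs (x * y) = cabs x * cabs y.
Proof. exact: ComplexField.Normc.normcM. Qed.

Lemma cabsN x : cabs (- x) = cabs x.
Proof. exact: (@normcN R). Qed.

Lemma cabsB x y : cabs (x - y) = cabs (y - x).
Proof. by rewrite -cabsN opprB. Qed.

Lemma cabsV x : cabs x^-1 = (cabs x)^-1.
Proof. exact: ComplexField.Normc.normcV. Qed.

Lemma cabs0 : cabs (0 : R[i]) = 0.
Proof. exact: ComplexField.Normc.normc0. Qed.

Lemma cabs1 : cabs (1 : R[i]) = 1.
Proof. exact: ComplexField.Normc.normc1. Qed.

Lemma cabsX x k : cabs (x ^+ k) = cabs x ^+ k.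
Proof. by elim: k => [|k IH]; rewrite ?expr0 ?cabs1 // !exprS cabsM IH. Qed.

Lemma cabs_real (r : R) : cabs r%:C = `|r|.
Proof. by rewrite /= expr0n /= addr0 sqrtr_sqr. Qed.

Lemma cabs_nat k : cabs (k%:R : R[i]) = k%:R.
Proof. by rewrite -(rmorph_nat (real_complex R)) cabs_real ger0_norm. Qed.

Lemma cabs_eq0 x : (cabs x == 0) = (x == 0).
Proof. by apply/eqP/eqP => [/ComplexField.Normc.eq0_normc|->]; rewrite ?cabs0. Qed.

Lemma cabs_gt0 x : (0 < cabs x) = (x != 0).
Proof. by rewrite lt_def cabs_ge0 andbT cabs_eq0. Qed.

Lemma cabs_sum (J : Type) (r : seq J) (P : pred J) (F : J -> R[i]) :
  cabs (\sum_(j <- r | P j) F j) <= \sum_(j <- r | P j) cabs (F j).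
Proof.
elim: r => [|j r IH]; first by rewrite !big_nil cabs0.
rewrite !big_cons; case: ifP => // _.
by apply: le_trans (cabsD _ _) _; rewrite lerD2l.
Qed.

Lemma cabs_sqr x : cabs x ^+ 2 = complex.Re x ^+ 2 + complex.Im x ^+ 2.
Proof. by case: x => a b /=; rewrite sqr_sqrtr // addr_ge0 ?sqr_ge0. Qed.

Lemma Re_le_cabs x : `|complex.Re x| <= cabs x.
Proof.
by case: x => a b /=; rewrite -sqrtr_sqr ler_sqrt ?addr_ge0 ?sqr_ge0 // lerDl sqr_ge0.
Qed.

Lemma Im_le_cabs x : `|complex.Im x| <= cabs x.
Proof.
by case: x => a b /=; rewrite -sqrtr_sqr ler_sqrt ?addr_ge0 ?sqr_ge0 // lerDr sqr_ge0.
Qed.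

Lemma cabs_le_ReIm x : cabs x <= `|complex.Re x| + `|complex.Im x|.
Proof.
case: x => a b /=; rewrite -[leRHS]ger0_norm ?addr_ge0 // -sqrtr_sqr.
rewrite ler_sqrt ?sqr_ge0 // sqrrD !real_normK ?num_real //.
by rewrite -addrA lerD2l lerDr mulrn_wge0 // mulr_ge0.
Qed.

(** Stated on the real sequence of moduli, so that results on real sequences apply directly;
    [clim_cvg] translates it into the topology used in the theorem. *)
Definition clim u l : Prop := cabs (u n - l) @[n --> \oo] --> (0 : R).

Lemma squeeze0 a b : (forall n, 0 <= a n <= b n) -> b @ \oo --> (0 : R) -> a @ \oo --> (0 : R).
Proof.
move=> h b0; apply: (squeeze_cvgr _ (cvg_cst 0) b0).
by apply: nearW => n; exact: h.
Qed.

Lemma clim_le u l b : (forall n, cabs (u n - l) <= b n) -> b @ \oo --> (0 : R) -> clim u l.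
Proof. by move=> h; apply: squeeze0 => n; rewrite cabs_ge0 h. Qed.

Lemma eq_clim u v l : u =1 v -> clim u l -> clim v l.
Proof. by move=> /funext ->. Qed.

Lemma clim_cst l : clim (fun _ => l) l.
Proof. by rewrite /clim subrr cabs0; apply: cvg_cst. Qed.

Lemma climD u v l m : clim u l -> clim v m -> clim (fun n => u n + v n) (l + m).
Proof.
move=> ul vm; apply: (clim_le (b := fun n => cabs (u n - l) + cabs (v n - m))).
  by move=> n; rewrite opprD addrACA cabsD.
by rewrite -[0 in X in _ --> X]addr0; apply: cvgD.
Qed.

Lemma climN u l : clim u l -> clim (fun n => - u n) (- l).
Proof. by apply: squeeze0 => n; rewrite cabs_ge0 -opprD cabsN /=. Qed.

Lemma climB u v l m : clim u l -> clim v m -> clim (fun n => u n - v n) (l - m).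
Proof. by move=> ul vm; apply: climD => //; apply: climN. Qed.

Lemma climM u v l m : clim u l -> clim v m -> clim (fun n => u n * v n) (l * m).
Proof.
move=> ul vm; apply: (clim_le (b := fun n =>
  cabs (u n - l) * (cabs (v n - m) + cabs m) + cabs l * cabs (v n - m))).
  move=> n; have -> : u n * v n - l * m = (u n - l) * v n + l * (v n - m) by ring.
  apply: le_trans (cabsD _ _) _; rewrite !cabsM lerD2r ler_wpM2l ?cabs_ge0 //.
  by rewrite -{1}[v n](subrK m) cabsD.
rewrite [X in _ --> X](_ : 0 = 0 * (0 + cabs m) + cabs l * 0 :> R); last by ring.
apply: cvgD; apply: cvgM => //; last exact: cvg_cst.
by apply: cvgD => //; apply: cvg_cst.
Qed.

Lemma clim_sum (J : Type) (r : seq J) (P : pred J) (F : J -> nat -> R[i]) (G : J -> R[i]) :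
  (forall j, P j -> clim (F j) (G j)) ->
  clim (fun n => \sum_(j <- r | P j) F j n) (\sum_(j <- r | P j) G j).
Proof.
move=> h; elim: r => [|j r IH].
  by rewrite big_nil; apply: eq_clim (clim_cst 0) => n; rewrite big_nil.
rewrite big_cons; case: ifP => Pj; last first.
  by apply: eq_clim IH => n; rewrite big_cons Pj.
by apply: eq_clim (climD (h j Pj) IH) => n; rewrite big_cons Pj.
Qed.

Lemma rlim_sum (J : Type) (r : seq J) (P : pred J) (F : J -> nat -> R) (G : J -> R) :
  (forall j, P j -> F j @ \oo --> G j) ->
  (fun n => \sum_(j <- r | P j) F j n) @ \oo --> \sum_(j <- r | P j) G j.
Proof.
move=> h; elim: r => [|j r IH].
  by rewrite big_nil; under eq_fun do rewrite big_nil; apply: cvg_cst.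
rewrite big_cons; under eq_fun do rewrite big_cons.
by case: ifP => Pj //; apply: cvgD => //; apply: h.
Qed.

Lemma clim_real a (r : R) : a @ \oo --> r -> clim (fun n => (a n)%:C) r%:C.
Proof.
move=> ar; rewrite /clim; have -> : (fun n => cabs ((a n)%:C - r%:C)) = (fun n => `|a n - r|).
  by apply/funext => n; rewrite -rmorphB cabs_real.
rewrite [X in _ --> X](_ : 0 = `|r - r|); last by rewrite subrr normr0.
by apply: cvg_norm; apply: cvgB => //; apply: cvg_cst.
Qed.

Lemma climP u l : clim u l <->
  (forall e : R, 0 < e -> exists N, forall n, (N <= n)%N -> cabs (u n - l) < e).
Proof.
split=> [/cvgrPdist_lt h e /h [N _ hN]|h].
  by exists N => n Nn; have := hN n Nn; rewrite sub0r normrN ger0_norm ?cabs_ge0.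
apply/cvgrPdist_lt => e /h [N hN]; exists N => // n Nn /=.
by rewrite sub0r normrN ger0_norm ?cabs_ge0 // hN.
Qed.

Lemma clim_unique u l m : clim u l -> clim u m -> l = m.
Proof.
move=> ul um; apply/eqP; rewrite -subr_eq0 -cabs_eq0; apply/eqP.
apply: (cvg_unique (@Rhausdorff R) (F := (fun _ : nat => cabs (l - m)) @ \oo)).
  exact: cvg_cst.
apply: (squeeze0 (b := fun n => cabs (u n - l) + cabs (u n - m))).
  move=> n; rewrite cabs_ge0 /= (cabsB (u n) l).
  by rewrite -[l - m](subrKA (u n)) cabsD.
by rewrite -[0 in X in _ --> X]addr0; apply: cvgD.
Qed.

Lemma clim_subseq u l (h : nat -> nat) : (forall n, (n <= h n)%N) ->
  clim u l -> clim (fun n => u (h n)) l.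
Proof.
move=> hn /climP ul; apply/climP => e /ul [N hN]; exists N => n Nn.
by apply: hN; apply: leq_trans (hn n).
Qed.

Lemma clim_eventually u v l N : (forall n, (N <= n)%N -> u n = v n) ->
  clim u l -> clim v l.
Proof.
move=> uv /climP ul; apply/climP => e /ul [N' hN]; exists (maxn N N') => n.
by rewrite geq_max => /andP [h1 h2]; rewrite -uv //; apply: hN.
Qed.

Lemma climV u l : l != 0 -> clim u l -> clim (fun n => (u n)^-1) l^-1.
Proof.
move=> l0 /climP ul; apply/climP => e e0.
have L0 : 0 < cabs l by rewrite cabs_gt0.
have [N1 h1] := ul _ (divr_gt0 L0 (ltr0n R 2)).
have [N2 h2] : exists N, forall n, (N <= n)%N ->
    cabs (u n - l) < e * (cabs l / 2 * cabs l).
  by apply: ul; rewrite !mulr_gt0 // invr_gt0.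
exists (maxn N1 N2) => n; rewrite geq_max => /andP [/h1 g1 /h2 g2].
have uL : cabs l / 2 <= cabs (u n).
  have := cabsD (u n) (l - u n); rewrite subrKC cabsB; lra.
have u0 : u n != 0 by rewrite -cabs_gt0 (lt_le_trans _ uL) // divr_gt0.
have -> : (u n)^-1 - l^-1 = (l - u n) / (u n * l) by field; apply/andP.
rewrite cabsM cabsV cabsM cabsB ltr_pdivrMr; last by rewrite mulr_gt0 ?cabs_gt0.
apply: lt_le_trans g2 _; rewrite ler_pM2l // ler_wpM2r ?cabs_ge0 //.
Qed.

Lemma climX u l k : clim u l -> clim (fun n => u n ^+ k) (l ^+ k).
Proof.
move=> ul; elim: k => [|k IH]; first exact: clim_cst.
by rewrite exprS; apply: eq_clim (climM ul IH) => n; rewrite exprS.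
Qed.

Lemma clim_cvg u l : clim u l -> (u : nat -> (R[i])^o) @ \oo --> (l : (R[i])^o).
Proof.
move=> /climP ul; apply/cvgrPdist_lt => e e0.
have e_real : e = (complex.Re e)%:C.
  by case: e e0 => a b; rewrite ltcE /= => /andP [/eqP -> _].
have [|N hN] := ul (complex.Re e); first by rewrite -ltcR -e_real.
exists N => // n Nn /=; rewrite normE e_real ltcR cabsB; exact: hN.
Qed.

Lemma clim_bounded u l : clim u l -> exists2 B : R, 0 < B & forall n, cabs (u n) <= B.
Proof.
move=> /climP ul; have [N hN] := ul 1 ltr01.
exists (cabs l + 1 + \sum_(j < N) cabs (u j)).
  by rewrite ltr_wpDr ?sumr_ge0 // => [j _|]; rewrite ?cabs_ge0 // ltr_wpDl ?cabs_ge0.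
move=> n; case: (ltnP n N) => nN.
  rewrite (bigD1 (Ordinal nN)) //= addrCA lerDl addr_ge0 ?addr_ge0 ?cabs_ge0 //.
  by rewrite sumr_ge0 // => j _; apply: cabs_ge0.
have := hN n nN; have := cabsD (u n - l) l; rewrite subrK => h1 h2.
have h3 : 0 <= \sum_(j < N) cabs (u j) by rewrite sumr_ge0 // => j _; apply: cabs_ge0.
by lra.
Qed.

End ComplexLimits.

(** * Dominated convergence and lattice sums *)

Section Summability.
Variable R : realType.
Implicit Types (a b : nat -> R).

Lemma bounded_sum_cvg b K : (forall j, 0 <= b j) ->
    (forall P, \sum_(j < P) b j <= K) ->
  exists2 l : R, (fun P => \sum_(j < P) b j) @ \oo --> l &
    forall P, \sum_(j < P) b j <= l.
Proof.
move=> b0 bK; have nd : nondecreasing_seq (fun P => \sum_(j < P) b j).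
  apply/nondecreasing_seqP => P; by rewrite big_ord_recr /= lerDl.
have ub : has_ubound (range (fun P => \sum_(j < P) b j)).
  by exists K => _ [P _ <-].
exists (limn (fun P => \sum_(j < P) b j)); first exact: nondecreasing_is_cvgn.
by move=> P; apply: nondecreasing_cvgn_le => //; apply: nondecreasing_is_cvgn.
Qed.

Lemma bounded_sum_tail b K : (forall j, 0 <= b j) ->
    (forall P, \sum_(j < P) b j <= K) ->
  forall e, 0 < e -> exists P0, forall P, (P0 <= P)%N ->
    \sum_(j < P) b j - \sum_(j < P0) b j < e.
Proof.
move=> b0 bK e e0; have [l bl lb] := bounded_sum_cvg b0 bK.
move/cvgrPdist_lt: bl => /(_ _ e0) [N _ hN]; exists N => P NP.
have := hN N (leqnn _); rewrite /= ger0_norm ?subr_ge0 ?lb //.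
by have := lb P; lra.
Qed.

(** Tannery's theorem for sums whose length [J t] grows: [b] controls the tail uniformly in [t], and
    the head converges termwise. *)
Lemma tannery0 (w : nat -> nat -> R[i]) b K (J : nat -> nat) t0 :
    (forall t, (t <= J t)%N) ->
    (forall t j, (t0 <= t)%N -> (j < J t)%N -> cabs (w t j) <= b j) ->
    (forall j, 0 <= b j) -> (forall P, \sum_(j < P) b j <= K) ->
    (forall j, clim (w^~ j) 0) ->
  clim (fun t => \sum_(j < J t) w t j) 0.
Proof.
move=> Jt wb b0 bK wl; apply/climP => e e0.
have e2 : 0 < e / 2 by rewrite divr_gt0.
have [P0 hP] := bounded_sum_tail b0 bK e2.
have /climP/(_ _ e2) [N hN] : clim (fun t => \sum_(j < P0) w t j) 0.
  rewrite [X in clim _ X](_ : 0 = \sum_(j < P0) 0); last by rewrite big1.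
  by apply: clim_sum => j _; apply: wl.
exists (maxn t0 (maxn P0 N)) => t; rewrite !geq_max => /and3P [t0t Pt Nt].
have PJ : (P0 <= J t)%N := leq_trans Pt (Jt t).
rewrite subr0 -(big_mkord xpredT (w t)) (big_cat_nat (n := P0)) //= big_mkord.
apply: le_lt_trans (cabsD _ _) _; rewrite [e]splitr; apply: ltr_leD.
  by have := hN t Nt; rewrite subr0.
apply: le_trans (cabs_sum _ _ _) _; apply: le_trans (ltW (hP _ PJ)).
have -> : \sum_(j < J t) b j - \sum_(j < P0) b j = \sum_(P0 <= j < J t) b j.
  rewrite -(big_mkord xpredT b) (big_cat_nat (n := P0)) //= big_mkord.
  by rewrite addrAC subrr add0r.
rewrite big_nat [leRHS]big_nat; apply: ler_sum => j /andP [_ jJ].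
exact: wb.
Qed.

Lemma clim_abs_series (v : nat -> R[i]) b K :
    (forall j, cabs (v j) <= b j) -> (forall P, \sum_(j < P) b j <= K) ->
  exists s, clim (fun P => \sum_(j < P) v j) s.
Proof.
move=> vb bK.
have real_cvg (h : R[i] -> R) : (forall x, `|h x| <= cabs x) ->
    {morph h : x y / x + y} -> h 0 = 0 ->
    exists s : R, (fun P => \sum_(j < P) h (v j)) @ \oo --> s.
  move=> hle hD h0; pose c := [series `|h (v k)|]_k.
  have : cvgn [normed series (fun k => h (v k))].
    apply: nondecreasing_is_cvgn.
      by apply/nondecreasing_seqP => P; rewrite /= !seriesEord /= big_ord_recr /= lerDl.
    exists K => _ [P _ <-]; apply: le_trans (bK P); rewrite /= seriesEord /=.
    by apply: ler_sum => j _; apply: le_trans (hle _) (vb _).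
  move=> /normed_cvg; set u := series _ => cu; exists (limn u).
  by move: cu; rewrite /u seriesEord.
have [s1 h1] := real_cvg (@complex.Re R) (@Re_le_cabs R) (raddfD _) erefl.
have [s2 h2] := real_cvg (@complex.Im R) (@Im_le_cabs R) (raddfD _) erefl.
exists (s1 +i* s2); apply: (clim_le (b := fun P =>
  `|\sum_(j < P) complex.Re (v j) - s1| + `|\sum_(j < P) complex.Im (v j) - s2|)).
  move=> P; apply: le_trans (cabs_le_ReIm _) _.
  by rewrite !raddfB /= !raddf_sum.
rewrite [X in _ --> X](_ : 0 = `|s1 - s1| + `|s2 - s2|); last first.
  by rewrite !subrr normr0 addr0.
by apply: cvgD; apply: cvg_norm; apply: cvgB => //; apply: cvg_cst.
Qed.

(** Comparison with a telescoping series: (p + 1)^-2 <= 1/p - 1/(p + 1). *)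
Lemma sum_inv_square (a : R) P : 0 < a ->
  \sum_(j < P) (a + j.+1%:R) ^- 2 <= a^-1.
Proof.
move=> a0; suff : \sum_(j < P) (a + j.+1%:R) ^- 2 <= a^-1 - (a + P%:R)^-1.
  have : 0 <= (a + P%:R)^-1 by rewrite invr_ge0 addr_ge0 // ltW.
  by lra.
elim: P => [|P IH]; first by rewrite big_ord0 addr0 subrr.
rewrite big_ord_recr /=; apply: le_trans (lerD IH (lexx _)) _.
have p0 : 0 < a + P%:R by rewrite ltr_wpDr.
rewrite -natr1 addrA; set p := a + P%:R in p0 *.
have p1 : 0 < p + 1 by rewrite addr_gt0.
rewrite -subr_ge0.
have -> : a^-1 - (p + 1)^-1 - (a^-1 - p^-1 + (p + 1) ^- 2) = (p * (p + 1) ^+ 2)^-1.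
  by field; rewrite !gt_eqF.
by rewrite invr_ge0 mulr_ge0 ?sqr_ge0 ?ltW.
Qed.

Lemma sum_inv_square1 P : \sum_(j < P) (j.+1%:R ^- 2 : R) <= 2.
Proof.
case: P => [|P]; first by rewrite big_ord0.
rewrite big_ord_recl expr1n invr1 [2](_ : _ = 1 + 1^-1); last by rewrite invr1.
rewrite lerD2l; apply: le_trans (sum_inv_square P ltr01).
by apply: ler_sum => j _; rewrite lift0 nat1r.
Qed.

End Summability.

Section BilateralSums.
Variable R : realType.

(** The integers are paired as m = j and m = -(j + 1), which gives a sum over natural numbers to
    which [tannery0] applies; in the last pair only m = M lies in the range. *)
Definition bilateral_sum (V : nmodType) (M : nat) (F : int -> V) : V :=
  \sum_(j < M.+1) (F j%:Z + if (j < M)%N then F (- (j%:Z + 1)) else 0).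

Lemma bilateral_sumE (V : nmodType) (M : nat) (F : int -> V) :
  \sum_(m <- [seq j%:Z - M%:Z | j <- iota 0 M.*2.+1]) F m = bilateral_sum M F.
Proof.
have -> : (M.*2.+1 = M + M.+1)%N by rewrite -addnn addnS.
rewrite big_map /bilateral_sum big_split.
have -> : iota 0 (M + M.+1) = index_iota 0 (M + M.+1) by rewrite /index_iota subn0.
rewrite (big_cat_nat (n := M)) ?leq_addr //=.
rewrite addrC; congr (_ + _).
  rewrite -{1}[M]add0n big_addn addKn big_mkord; apply: eq_bigr => j _.
  by congr F; lia.
rewrite big_ord_recr /= ltnn addr0 big_mkord (reindex_inj rev_ord_inj).
apply: eq_bigr => j _; rewrite ltn_ord /=; congr F.
by have := ltn_ord j; lia.
Qed.

Lemma bilateral_sumM (A : pzRingType) (c : A) M (F : int -> A) :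
  bilateral_sum M (fun m => c * F m) = c * bilateral_sum M F.
Proof.
rewrite mulr_sumr; apply: eq_bigr => j _.
by rewrite mulrDr; case: ifP => _ //; rewrite mulr0.
Qed.

Lemma bilateral_sumB (V : zmodType) M (F G : int -> V) :
  bilateral_sum M (fun m => F m - G m) = bilateral_sum M F - bilateral_sum M G.
Proof.
rewrite -sumrB; apply: eq_bigr => j _.
by case: ifP => _; [rewrite addrACA -opprD | rewrite !addr0].
Qed.

Lemma eq_bilateral_sum (V : nmodType) M (F G : int -> V) :
  (forall m, - M%:Z <= m <= M%:Z -> F m = G m) -> bilateral_sum M F = bilateral_sum M G.
Proof.
move=> FG; apply: eq_bigr => j _; have := ltn_ord j => jM.
congr (_ + _); first by apply: FG; lia.
by case: ifP => // jM'; apply: FG; lia.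
Qed.

Lemma cabs_bilateral_sum M (F : int -> R[i]) (b : int -> R) :
  (forall m, - M%:Z <= m <= M%:Z -> cabs (F m) <= b m) ->
  cabs (bilateral_sum M F) <= bilateral_sum M b.
Proof.
move=> Fb; apply: le_trans (cabs_sum _ _ _) _; apply: ler_sum => j _.
have := ltn_ord j => jM; apply: le_trans (cabsD _ _) (lerD _ _).
  by apply: Fb; lia.
by case: ifP => jM'; [apply: Fb; lia | rewrite cabs0].
Qed.

Lemma bilateral_sum_le M (b : int -> R) : (forall m, 0 <= b m) ->
  bilateral_sum M b <= \sum_(j < M.+1) (b j%:Z + b (- (j%:Z + 1))).
Proof.
by move=> b0; apply: ler_sum => j _; rewrite lerD2l; case: ifP.
Qed.

Lemma bilateral_tannery (w : nat -> int -> R[i]) (b : int -> R) K :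
    (forall M m, - M%:Z <= m <= M%:Z -> cabs (w M m) <= b m) ->
    (forall m, 0 <= b m) ->
    (forall P, \sum_(j < P) (b j%:Z + b (- (j%:Z + 1))) <= K) ->
    (forall m, clim (w^~ m) 0) ->
  clim (fun M => bilateral_sum M (w M)) 0.
Proof.
move=> wb b0 bK wl.
apply: (@tannery0 R
  (fun M j => w M j%:Z + if (j < M)%N then w M (- (j%:Z + 1)) else 0) (fun j => b j%:Z + b (- (j%:Z + 1))) K S 0) => //.
- move=> M j _; rewrite ltnS => jM; apply: le_trans (cabsD _ _) (lerD _ _).
    by apply: wb; lia.
  by case: ifP => jM'; [apply: wb; lia | rewrite cabs0].
- by move=> j; apply: addr_ge0.
- move=> j; rewrite -[X in clim _ X]addr0; apply: climD; first exact: wl.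
  by apply: clim_eventually (wl (- (j%:Z + 1))) => M jM; rewrite [X in if X then _ else _](_ : _ = true) //; exact: jM.
Qed.

End BilateralSums.

Section LatticeSums.
Variable R : realType.
Implicit Types (x : R[i]) (m : int).

Lemma add_int_neq0 x m : complex.Im x != 0 -> x + m%:~R != 0.
Proof.
move=> y0; apply: contra y0 => /eqP /(congr1 (@complex.Im R)).
by rewrite raddfD /= -(rmorph_int (real_complex R)) /= addr0 => ->.
Qed.

Lemma Im_add_int x m : complex.Im (x + m%:~R) = complex.Im x.
Proof. by rewrite raddfD /= -(rmorph_int (real_complex R)) /= addr0. Qed.

Lemma Re_add_int x m : complex.Re (x + m%:~R) = complex.Re x + m%:~R.
Proof. by rewrite raddfD /= -(rmorph_int (real_complex R)) /=. Qed.

Lemma inv_square_bound x : complex.Im x != 0 ->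
  exists2 K : R, 0 < K &
    forall P, \sum_(j < P) (cabs (x + j%:Z%:~R) ^- 2 +
                            cabs (x + (- (j%:Z + 1))%:~R) ^- 2) <= K.
Proof.
move=> y0; set y := `|complex.Im x|; have yp : 0 < y by rewrite normr_gt0.
(* Chosen so that |m| + 1 <= D |x + m|: one has |m| <= |Re x + m| + |Re x|, and the constant |Re x|
   + 1 is absorbed by |x + m| >= |Im x|. *)
pose D := 1 + (`|complex.Re x| + 1) / y.
have D0 : 0 < D by rewrite ltr_wpDr // divr_ge0 ?addr_ge0 // ltW.
have hD m : `|m|%:~R + 1 <= D * cabs (x + m%:~R).
  have h1 : y <= cabs (x + m%:~R) by rewrite /y -(Im_add_int x m) Im_le_cabs.
  have h2 : `|complex.Re x + m%:~R| <= cabs (x + m%:~R).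
    by rewrite -Re_add_int Re_le_cabs.
  have h3 : `|m|%:~R <= `|complex.Re x + m%:~R| + `|complex.Re x| :> R.
    rewrite intr_norm -[X in `|X|](addKr (complex.Re x)) addrC.
    by apply: le_trans (ler_normD _ _) _; rewrite normrN.
  have h4 : `|complex.Re x| + 1 <= (`|complex.Re x| + 1) / y * cabs (x + m%:~R).
    by rewrite -mulrA ler_peMr ?addr_ge0 // mulrC ler_pdivlMr ?mul1r.
  by rewrite /D mulrDl mul1r; lra.
have hj m (j : nat) : j%:R <= (`|m|%:~R : R) ->
    cabs (x + m%:~R) ^- 2 <= D ^+ 2 * j.+1%:R ^- 2.
  move=> jm; have c0 : 0 < cabs (x + m%:~R) by rewrite cabs_gt0 add_int_neq0.
  rewrite ler_pdivlMr ?exprn_gt0 // mulrC ler_pdivrMr ?exprn_gt0 // -exprMn.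
  rewrite ler_pXn2r ?nnegrE ?mulr_ge0 ?(ltW c0) ?(ltW D0) // -natr1.
  by apply: le_trans (hD m); rewrite lerD2r.
exists (D ^+ 2 * 2 * 2); first by rewrite !mulr_gt0 // exprn_gt0.
move=> P; apply: (@le_trans _ _ (\sum_(j < P) D ^+ 2 * 2 * j.+1%:R ^- 2)).
  apply: ler_sum => j _; rewrite mulrAC mulr_natr mulr2n; apply: lerD; apply: hj.
    by rewrite ger0_norm.
  by rewrite normrN ger0_norm // rmorphD //= lerDl.
by rewrite -mulr_sumr ler_pM2l ?sum_inv_square1 // mulr_gt0 // exprn_gt0.
Qed.

(** A quantitative bound at the points iY and -iY, from (Y + |m|)^2 <= 2 (Y^2 + m^2). Its decay in Y
    is what eliminates weight 1. *)
Lemma inv_square_bound_imaginary (Y : nat) (s : R) P : (1 < Y)%N -> `|s| = 1 ->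
  \sum_(j < P) (cabs ((0 +i* (s * Y%:R)) + j%:Z%:~R) ^- 2 +
                cabs ((0 +i* (s * Y%:R)) + (- (j%:Z + 1))%:~R) ^- 2)
    <= 4 / (Y%:R - 1).
Proof.
move=> Y1 s1; have Yp : 0 < Y%:R - 1 :> R by rewrite subr_gt0 ltr1n.
set x := 0 +i* _.
have hm m (j : nat) : j%:R <= (`|m|%:~R : R) ->
    cabs (x + m%:~R) ^- 2 <= 2 * (Y%:R - 1 + j.+1%:R) ^- 2.
  move=> jm; have -> : cabs (x + m%:~R) ^+ 2 = Y%:R ^+ 2 + `|m|%:~R ^+ 2.
    rewrite cabs_sqr Re_add_int Im_add_int /= add0r exprMn -[s ^+ 2]real_normK ?num_real //.
    by rewrite s1 expr1n mul1r addrC intr_norm real_normK ?num_real.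
  have -> : Y%:R - 1 + j.+1%:R = Y%:R + j%:R :> R by rewrite -natr1; ring.
  have Yj : 0 < Y%:R + j%:R :> R by rewrite ltr_wpDr // ltr0n ltnW.
  have Y0 : 0 < Y%:R :> R by rewrite ltr0n ltnW.
  set mm := `|m|%:~R in jm *.
  rewrite ler_pdivlMr ?exprn_gt0 // mulrC ler_pdivrMr; last by rewrite ltr_wpDr ?sqr_ge0 ?exprn_gt0.
  apply: (@le_trans _ _ ((Y%:R + mm) ^+ 2)).
    by rewrite ler_pXn2r ?nnegrE ?lerD2l // ltW // (lt_le_trans Yj) ?lerD2l.
  by rewrite -subr_ge0 (_ : _ - _ = (Y%:R - mm) ^+ 2) ?sqr_ge0 //; ring.
apply: (@le_trans _ _ (\sum_(j < P) 4 * (Y%:R - 1 + j.+1%:R) ^- 2)).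
  apply: ler_sum => j _; rewrite (_ : 4 = 2 + 2 :> R); last by ring.
  rewrite mulrDl; apply: lerD; apply: hm.
    by rewrite ger0_norm.
  by rewrite normrN ger0_norm // rmorphD //= lerDl.
by rewrite -mulr_sumr ler_pM2l // sum_inv_square.
Qed.

End LatticeSums.

(** * Truncated zeta values and their Taylor coefficients *)

Section ChainBounds.
Variable R : numDomainType.

Lemma chain_ge0 (T : Type) (f : nat -> T -> R) X n : (forall k x, 0 <= f k x) ->
  0 <= chain f X n.
Proof.
move=> f0; elim: X n => [|x X IH] n /=; first exact: ler0n.
by case: n => [|k n]; rewrite addr_ge0 // mulr_ge0.
Qed.

Lemma chain_le_prod (T : Type) (f : nat -> T -> R) X n : (forall k x, 0 <= f k x) ->
  chain f X n <= \prod_(k <- n) \sum_(x <- X) f k x.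
Proof.
move=> f0; elim: X n => [|x X IH] [|k n] /=.
- by rewrite big_nil.
- by rewrite big_cons big_nil mul0r.
- by rewrite chain_nil addr0 big_nil.
have s0 j : 0 <= \sum_(y <- X) f j y by apply: sumr_ge0.
rewrite big_cons [\sum_(_ <- _ :: _) f k _]big_cons mulrDl addrC.
have mono : \prod_(j <- n) \sum_(y <- X) f j y <= \prod_(j <- n) \sum_(y <- x :: X) f j y.
  apply: ler_prod => j _; rewrite s0 big_cons /= -lerBlDr subrr //.
apply: lerD.
  by apply: ler_wpM2l => //; apply: le_trans (IH n) mono.
apply: le_trans (IH (k :: n)) _; rewrite big_cons; exact: ler_wpM2l.
Qed.

Lemma chain_norm (K : comNzRingType) (h : K -> R) (T : Type) (f : nat -> T -> K) X n :
    (forall x y, h (x + y) <= h x + h y) -> {morph h : x y / x * y} ->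
    h 0 = 0 -> h 1 = 1 -> (forall x, 0 <= h x) ->
  h (chain f X n) <= chain (fun k x => h (f k x)) X n.
Proof.
move=> hD hM h0 h1 hp; elim: X n => [|x X IH] n /=.
  by case: n => [|k n]; rewrite ?h0 ?h1.
case: n => [|k n]; first by rewrite !chain_nil !addr0 h1.
apply: le_trans (hD _ _) (lerD (IH _) _); rewrite hM.
exact: ler_wpM2l.
Qed.

End ChainBounds.

Section TruncatedZeta.
Variables (R : realType).

Definition zeta_chain J n : R := chain (fun k (j : nat) => j%:R ^- k : R) (iota 1 J) n.

Lemma zeta_chain_cvg n : all (leq 2) n -> (zeta_chain^~ n) @ \oo --> mzv R n.
Proof.
move=> n2; have f0 k (j : nat) : 0 <= (j%:R ^- k : R) by rewrite invr_ge0 exprn_ge0.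
have cv : cvgn (zeta_chain^~ n).
  apply: nondecreasing_is_cvgn.
    apply/nondecreasing_seqP => J; rewrite /zeta_chain -[J.+1]addn1 iotaD cats1.
    case/lastP: n {n2} => [|n k]; first by rewrite !chain_nil.
    by rewrite chain_rcons lerDl mulr_ge0 // chain_ge0.
  exists (2 ^+ size n) => _ [J _ <-]; apply: le_trans (chain_le_prod _ _ f0) _.
  have -> : 2 ^+ size n = \prod_(k <- n) (2 : R).
    by elim: (n) => [|k m IH]; rewrite ?big_nil // big_cons exprS IH.
  rewrite big_seq [leRHS]big_seq; apply: ler_prod => k kn; rewrite sumr_ge0 //=.
  apply: le_trans (sum_inv_square1 R J).
  rewrite -[1%N]/(1 + 0)%N iotaDl big_map -(big_mkord xpredT (fun j => j.+1%:R ^- 2)).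
  rewrite /index_iota subn0; apply: ler_sum => j _; rewrite add1n.
  rewrite lef_pV2 ?posrE ?exprn_gt0 // ler_weXn2l ?ler1n //.
  exact: (allP n2).
have -> : mzv R n = limn (zeta_chain^~ n); last exact: cv.
rewrite /mzv; apply: cvg_lim => //.
rewrite -(cvg_shiftS (mzv_trunc R n)).
have -> : [sequence mzv_trunc R n j.+1]_j = zeta_chain^~ n.
  by apply/funext => j; rewrite /= mzv_truncE.
exact: cv.
Qed.

Variable N : nat.

(** Modulo X^N, the Taylor expansion at 0 of the sum of (l_1 + x)^-n_1 ... (l_p + x)^-n_p over 0 <
    l_1 < ... < l_p <= J; its coefficients are truncations of [shifted_mzv]. *)
Definition right_poly J n : {poly R} :=
  chain (fun k (j : nat) => inv_pow N k (j%:R : R)) (iota 1 J) n.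

Definition left_poly J n : {poly R} :=
  chain (fun k (j : nat) => inv_pow N k (- j%:R : R)) (rev (iota 1 J)) n.

Lemma chain_exp_scale (K : comNzRingType) (T : Type) (c : K) (f : nat -> T -> K) X n :
  chain (fun k x => c ^+ k * f k x) X n = c ^+ sumn n * chain f X n.
Proof.
elim: X n => [|x X IH] n /=; first by case: n => [|k n]; rewrite ?mulr0 // expr0 mul1r.
case: n => [|k n]; first by rewrite !chain_nil mul1r addr0.
by rewrite !IH /= mulrDr exprD; congr (_ + _); ring.
Qed.

(** From (-l + X)^-k = (-1)^k (l - X)^-k and the reversed order of the points. This sign and this
    reversal match those that path reversal produces in [z_block_coef]. *)
Lemma left_polyE J n a :
  (left_poly J n)`_a = (-1) ^+ (sumn n + a) * (right_poly J (rev n))`_a.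
Proof.
rewrite /left_poly -[n in LHS]revK chain_rev.
have -> : chain (fun k (j : nat) => inv_pow N k (- j%:R : R)) (iota 1 J) (rev n) =
    chain (fun k (j : nat) => (-1)%:P ^+ k * (inv_pow N k (j%:R : R) \Po (- 'X)))
      (iota 1 J) (rev n).
  by apply: eq_chain => k j; rewrite inv_powN -mul_polyC rmorphXn.
rewrite chain_exp_scale -(chain_rmorph (comp_poly (- 'X))) /= -rmorphXn /= mul_polyC.
by rewrite coefZ coef_comp_polyNX mulrA -exprD sumn_rev.
Qed.

Lemma deriv_chain (f : nat -> nat -> {poly R}) X n :
    (forall k x, trunc_eq N.-1 ((f k x)^`()) (- (f k.+1 x *+ k))) ->
  trunc_eq N.-1 ((chain f X n)^`())
    (- \sum_(i < size n) chain f X (incr_nth n i) *+ nth 0%N n i).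
Proof.
move=> fd; elim: X n => [|x X IH] n.
  move=> j jN; rewrite /= big1 => [|i _].
    by case: n => [|k n]; rewrite /= -?[0%:R]/(0 : {poly R}) ?derivC oppr0.
  by case: n i => [[]|k n [[|i] //]]; rewrite //= mul0rn.
case: n => [|k n] j jN.
  by rewrite chain_nil big_ord0 oppr0 -[1]/(1%:P) derivC.
rewrite [chain _ _ _]/= derivD derivM !coefD (IH (k :: n) j jN).
rewrite (trunc_eqM (fd k x) (fun _ _ => erefl) jN) (trunc_eqMl _ (IH n) jN) -!coefD.
apply: (congr1 (fun P : {poly R} => P`_j)); rewrite !big_ord_recl /=.
rewrite [X in _ = - (_ + X)](_ : _ =
    \sum_(i < size n) chain f X (k :: incr_nth n i) *+ nth 0%N n i +
    f k x * \sum_(i < size n) chain f X (incr_nth n i) *+ nth 0%N n i); last first.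
  rewrite mulr_sumr -big_split; apply: eq_bigr => i _ /=.
  by rewrite mulrnDl mulrnAr.
move: (chain f X (k.+1 :: n)) (f k.+1 x) (chain f X n) (f k x) => a b c d.
move: (\sum_(i < size n) chain f X (k :: incr_nth n i) *+ nth 0%N n i) => S1.
move: (\sum_(i < size n) chain f X (incr_nth n i) *+ nth 0%N n i) => S2.
by ring.
Qed.

(** Differentiation raises one exponent, which is the recursion of [shifted_mzv]; convergence of all
    coefficients thus reduces to that of the constant ones, the truncated zeta values. *)
Lemma right_polyS J n j : (j.+1 < N)%N ->
  (right_poly J n)`_j.+1 =
  - j.+1%:R^-1 * \sum_(i < size n) (right_poly J (incr_nth n i))`_j *+ nth 0%N n i.
Proof.
move=> jN; have jN' : (j < N.-1)%N by case: N jN.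
have := @deriv_chain (fun k (j : nat) => inv_pow N k (j%:R : R)) (iota 1 J) n _ j jN'.
rewrite coef_deriv coefN coef_sum => e.
have {}e : (right_poly J n)`_j.+1 *+ j.+1 =
    - \sum_(i < size n) (right_poly J (incr_nth n i))`_j *+ nth 0%N n i.
  rewrite e => [|k x i iN]; last first.
    by rewrite deriv_inv_pow ?coefN ?coefMn ?mulNrn //; case: N iN.
  by congr (- _); apply: eq_bigr => i _; rewrite coefMn.
by rewrite mulNr -mulrN -e -[(right_poly J n)`_j.+1 *+ _]mulr_natl mulKf // pnatr_eq0.
Qed.

Lemma right_poly_cvg b n : (b < N)%N -> all (leq 2) n ->
  (fun J => (right_poly J n)`_b) @ \oo --> shifted_mzv R b n.
Proof.
elim: b n => [|b IH] n bN n2.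
  have -> : (fun J => (right_poly J n)`_0) = zeta_chain^~ n; last exact: zeta_chain_cvg.
  apply/funext => J; rewrite -horner_coef0.
  rewrite -[_.[0]]/(horner_eval 0 (right_poly J n)) chain_rmorph /zeta_chain.
  apply: eq_chain => k j; rewrite /= /horner_eval horner_coef0 coef0_inv_pow //.
have -> : (fun J => (right_poly J n)`_b.+1) = (fun J =>
  - b.+1%:R^-1 * \sum_(i < size n) (right_poly J (incr_nth n i))`_b *+ nth 0%N n i).
  by apply/funext => J; rewrite right_polyS.
apply: cvgM; first exact: cvg_cst.
apply: rlim_sum => i _; apply: cvgMn.
by apply: IH; [exact: ltnW | apply: all_incr_nth].
Qed.

Lemma right_poly_cvg_comp b n (p : nat -> nat) : p @ \oo --> \oo -> (b < N)%N ->
  all (leq 2) n -> (fun M => (right_poly (p M) n)`_b) @ \oo --> shifted_mzv R b n.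
Proof. by move=> poo bN n2; apply: cvg_comp poo (right_poly_cvg bN n2). Qed.

(** The coefficient of weight [k] at a point of the range that has [i] points below it and [j] above
    it. *)
Definition trunc_coef n k i j : R :=
  \sum_(s < size n) if (k <= nth 0%N n s)%N then
    (left_poly i (take s n) * right_poly j (drop s.+1 n))`_(nth 0%N n s - k)
  else 0.

Lemma trunc_coefE n k i j :
  trunc_coef n k i j = \sum_(s < size n) if (k <= nth 0%N n s)%N then
    \sum_(a < (nth 0%N n s - k).+1)
      (-1) ^+ (sumn (take s n) + a) * (right_poly i (rev (take s n)))`_a *
      (right_poly j (drop s.+1 n))`_(nth 0%N n s - k - a)
  else 0.
Proof.
apply: eq_bigr => s _; case: ifP => // _; rewrite coefM.
by apply: eq_bigr => a _; rewrite left_polyE.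
Qed.

Lemma trunc_coef_cvg n k (p r : nat -> nat) : (0 < k)%N -> all (leq 2) n ->
    all (fun m => m <= N)%N n -> p @ \oo --> \oo -> r @ \oo --> \oo ->
  (fun M => trunc_coef n k (p M) (r M)) @ \oo --> tangent_coef R n k.
Proof.
move=> k0 n2 nN poo roo; under eq_fun do rewrite trunc_coefE.
apply: rlim_sum => s _; case: ifP => kn; last exact: cvg_cst.
have nsN : (nth 0%N n s <= N)%N by apply: (allP nN); rewrite mem_nth.
apply: rlim_sum => a _; apply: cvgM; first apply: cvgM; first exact: cvg_cst.
  apply: right_poly_cvg_comp => //; first by have := ltn_ord a; lia.
  by rewrite all_rev; apply/allP => j /mem_take; apply: (allP n2).
apply: right_poly_cvg_comp => //; first by have := ltn_ord a; lia.
by apply/allP => j /mem_drop; apply: (allP n2).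
Qed.

(** The majorant for dominated convergence: each coefficient of [right_poly] converges as [J] grows,
    hence is bounded. *)
Lemma trunc_coef_bounded n k : (0 < k)%N -> all (leq 2) n ->
    all (fun m => m <= N)%N n ->
  exists2 C : R, 0 < C & forall i j, `|trunc_coef n k i j| <= C.
Proof.
move=> k0 n2 nN.
have bounded (a : nat) m : exists C : R,
    (a < N)%N -> all (leq 2) m -> forall J, `|(right_poly J m)`_a| <= C.
  have [/andP [aN m2]|h] := boolP ((a < N)%N && all (leq 2) m); last first.
    by exists 0 => aN m2; rewrite aN m2 in h.
  have [C _ hC] := clim_bounded (clim_real (right_poly_cvg aN m2)).
  by exists C => _ _ J; have := hC J; rewrite cabs_real.
have [C hC] := choice (fun am => bounded am.1 am.2).
exists (1 + \sum_(s < size n) \sum_(a < (nth 0%N n s - k).+1)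
  `|C (val a, rev (take s n))| * `|C ((nth 0%N n s - k - a)%N, drop s.+1 n)|).
  rewrite ltr_pwDl //; apply: sumr_ge0 => s _; apply: sumr_ge0 => a _.
  exact: mulr_ge0.
move=> i j; rewrite trunc_coefE; apply: le_trans (ler_norm_sum _ _ _) _.
rewrite ler_wpDl //; apply: ler_sum => s _; case: ifP => kn; last first.
  by rewrite normr0; apply: sumr_ge0 => a _; apply: mulr_ge0.
have nsN : (nth 0%N n s <= N)%N by apply: (allP nN); rewrite mem_nth.
apply: le_trans (ler_norm_sum _ _ _) _; apply: ler_sum => a _.
rewrite !normrM normrX normrN1 expr1n mul1r; apply: ler_pM => //.
  apply: le_trans (ler_norm _); apply: (hC (val a, rev (take s n))).
    by have := ltn_ord a; rewrite /=; lia.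
  by rewrite all_rev; apply/allP => l /mem_take; apply: (allP n2).
apply: le_trans (ler_norm _).
apply: (hC ((nth 0%N n s - k - a)%N, drop s.+1 n)).
  by have := ltn_ord a; rewrite /=; lia.
by apply/allP => l /mem_drop; apply: (allP n2).
Qed.

End TruncatedZeta.

(** * Multitangent functions *)

Section Multitangent.
Variable R : realType.
Implicit Types (x : R[i]) (n : seq nat).

Definition int_range (M : nat) : seq int := [seq j%:Z - M%:Z | j <- iota 0 M.*2.+1].

Definition tangent_sum (M : nat) n x : R[i] :=
  chain (fun k (m : int) => (x + m%:~R) ^- k) (int_range M) n.

Lemma size_int_range M : size (int_range M) = M.*2.+1.
Proof. by rewrite size_map size_iota. Qed.

Lemma nth_int_range M j : (j < M.*2.+1)%N -> nth 0 (int_range M) j = j%:Z - M%:Z.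
Proof. by move=> jM; rewrite (nth_map 0%N) ?size_iota // nth_iota. Qed.

Lemma inv_pow_real N k (r : R) :
  inv_pow N k (r%:C : R[i]) = map_poly (real_complex R) (inv_pow N k r).
Proof.
apply/polyP => j; rewrite coef_map !coef_poly; case: ifP => _ /=; last by rewrite rmorph0.
by rewrite !rmorphM fmorphV rmorphXn /= rmorphXn rmorphN1 rmorph_nat.
Qed.

Lemma chain_left_poles N M j n : (j < M.*2.+1)%N ->
  chain (fun k (m : int) => inv_pow N k (m%:~R - (j%:Z - M%:Z)%:~R : R[i]))
    (take j (int_range M)) n = map_poly (real_complex R) (left_poly R N j n).
Proof.
move=> jM; rewrite /left_poly (chain_rmorph (map_poly (real_complex R))).
have -> : take j (int_range M) = [seq (j%:Z - i%:Z) - M%:Z | i <- rev (iota 1 j)].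
  apply: (@eq_from_nth _ 0); rewrite size_takel ?size_map ?size_rev ?size_iota //;
    try exact: ltnW.
  move=> i ij; rewrite nth_take // nth_int_range; last by apply: ltn_trans jM.
  rewrite (nth_map 0%N) ?size_rev ?size_iota // nth_rev ?size_iota // nth_iota; lia.
rewrite chain_map; apply: eq_chain => k i /=; rewrite -inv_pow_real -rmorphB /=.
congr (inv_pow N k _); rewrite rmorphN rmorph_nat /= -[i%:R in RHS]/(i%:Z%:~R) -rmorphN /=.
by congr (_%:~R); lia.
Qed.

Lemma chain_right_poles N M j n : (j < M.*2.+1)%N ->
  chain (fun k (m : int) => inv_pow N k (m%:~R - (j%:Z - M%:Z)%:~R : R[i]))
    (drop j.+1 (int_range M)) n =
  map_poly (real_complex R) (right_poly R N (M.*2 - j) n).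
Proof.
move=> jM; rewrite /right_poly (chain_rmorph (map_poly (real_complex R))).
have -> : drop j.+1 (int_range M) = [seq (j%:Z + i%:Z) - M%:Z | i <- iota 1 (M.*2 - j)].
  apply: (@eq_from_nth _ 0); first by rewrite size_drop !size_map !size_iota subSS.
  move=> i; rewrite size_drop size_int_range subSS => ij.
  rewrite nth_drop nth_int_range; last by lia.
  by rewrite (nth_map 0%N) ?size_iota // nth_iota //; lia.
rewrite chain_map; apply: eq_chain => k i /=; rewrite -inv_pow_real -rmorphB /=.
congr (inv_pow N k _); rewrite rmorph_nat /= -[i%:R in RHS]/(i%:Z%:~R).
by congr (_%:~R); lia.
Qed.

(** Exact for every finite [M]: the point [m] has m + M points of the range below it and M - m above
    it, and its coefficient depends only on these two numbers. *)
Lemma tangent_sumE N M n x : complex.Im x != 0 ->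
    all (leq 1) n -> all (fun k => k <= N)%N n -> n != [::] ->
  tangent_sum M n x = \sum_(1 <= k < N.+1) bilateral_sum M (fun m =>
    (trunc_coef R N n k (absz (m + M%:Z)) (absz (M%:Z - m)))%:C * (x + m%:~R) ^- k).
Proof.
move=> x0 n1 nN n0.
pose X : seq R[i] := [seq m%:~R | m <- int_range M].
have -> : tangent_sum M n x = chain (fun k a => (x + a) ^- k) X n.
  by rewrite /X chain_map.
rewrite (@chain_partial_fractions _ N) //; last 2 first.
- rewrite map_inj_uniq ?map_inj_uniq ?iota_uniq //.
    by move=> i j /addIr [].
  by move=> i j /eqP; rewrite -subr_eq0 -rmorphB intr_eq0 subr_eq0 => /eqP.
- by rewrite all_map; apply/allP => m _ /=; apply: add_int_neq0.
transitivity (\sum_(j < M.*2.+1) \sum_(1 <= k < N.+1)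
    (trunc_coef R N n k j (M.*2 - j))%:C * (x + (j%:Z - M%:Z)%:~R) ^- k); last first.
  rewrite exchange_big /=; apply: eq_bigr => k _; rewrite -bilateral_sumE.
  rewrite big_map -[iota 0 _]/(index_iota 0 M.*2.+1) big_mkord; apply: eq_bigr => j _.
  have -> : absz (j%:Z - M%:Z + M%:Z)%R = j by lia.
  by have -> : absz (M%:Z - (j%:Z - M%:Z))%R = (M.*2 - j)%N by have := ltn_ord j; lia.
rewrite /chain_principal size_map size_int_range; apply: eq_bigr => j _.
have jM := ltn_ord j.
have Xj : nth 0 X j = (j%:Z - M%:Z)%:~R.
  by rewrite /X (nth_map 0) ?size_int_range // nth_int_range.
transitivity (\sum_(1 <= k < N.+1) \sum_(s < size n) (if (k <= nth 0%N n s)%N then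
    ((left_poly R N j (take s n) * right_poly R N (M.*2 - j) (drop s.+1 n))`_(nth 0%N n s - k))%:C
    else 0) * (x + (j%:Z - M%:Z)%:~R) ^- k); last first.
  apply: eq_bigr => k _; rewrite -mulr_suml /trunc_coef rmorph_sum; congr (_ * _).
  by apply: eq_bigr => s _; case: ifP.
rewrite exchange_big /=; apply: eq_bigr => s _.
rewrite Xj mul1r /X -map_take -map_drop !chain_map.
have -> : forall ys ms, chain (fun k => (fun b => inv_pow N k (b - (j%:Z - M%:Z)%:~R)) \o intr) ys ms
   = chain (fun k (m : int) => inv_pow N k (m%:~R - (j%:Z - M%:Z)%:~R : R[i])) ys ms by [].
rewrite chain_left_poles // chain_right_poles // -rmorphM /= /principal_part.
have nsN : (nth 0%N n s <= N)%N by apply: (allP nN); rewrite mem_nth.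
rewrite [LHS](big_nat_widen 1 _ N.+1) // [LHS]big_mkcond; apply: eq_bigr => k _ /=.
by rewrite ltnS; case: ifP; rewrite ?mul0r // coef_map.
Qed.

Lemma trunc_coef_clim N n k (m : int) : (0 < k)%N -> all (leq 2) n ->
    all (fun j => j <= N)%N n ->
  clim (fun M : nat => (trunc_coef R N n k (absz (m + M%:Z)) (absz (M%:Z - m)))%:C)
    (tangent_coef R n k)%:C.
Proof.
move=> k0 n2 nN; apply: clim_real.
have inf (f : nat -> nat) : (forall M, (M <= f M + absz m)%N) -> f @ \oo --> \oo.
  move=> fM; apply/cvgnyPge => A; exists (A + absz m)%N => // M /= AM.
  by have := fM M; lia.
by apply: (@trunc_coef_cvg R N n k (fun M => absz (m + M%:Z)) (fun M => absz (M%:Z - m))) => //;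
  apply: inf => M; lia.
Qed.

End Multitangent.

Section MultitangentLimit.
Variables (R : realType) (N : nat) (n : seq nat).
Hypotheses (n2 : all (leq 2) n) (nN : all (fun k => k <= N)%N n) (n0 : n != [::]).
Implicit Types (x : R[i]) (m : int).

Let n1 : all (leq 1) n. Proof. by apply: sub_all n2 => k; apply: ltnW. Qed.

Let gam k (M : nat) m : R[i] :=
  (trunc_coef R N n k (absz (m + M%:Z)) (absz (M%:Z - m)))%:C.
Let B k : R[i] := (tangent_coef R n k)%:C.

Let part k (M : nat) x : R[i] := bilateral_sum M (fun m => gam k M m * (x + m%:~R) ^- k).

Lemma gam_bounded k : (0 < k)%N -> exists2 C : R, 0 < C & forall M m, cabs (gam k M m) <= C.
Proof.
move=> k0; have [C C0 hC] := trunc_coef_bounded R k0 n2 nN.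
by exists C => // M m; rewrite cabs_real.
Qed.

Lemma gam_clim k m : (0 < k)%N -> clim (fun M => gam k M m - B k) 0.
Proof.
move=> k0; rewrite -[X in clim _ X](subrr (B k)); apply: climB; last exact: clim_cst.
exact: trunc_coef_clim.
Qed.

(** Replaces the coefficient, which varies with [m] and [M], by its limit [B k] in a dominated
    sum. *)
Lemma weighted_tannery k (a : int -> R[i]) (b : int -> R) K : (0 < k)%N ->
    (forall m, cabs (a m) <= b m) ->
    (forall P, \sum_(j < P) (b j%:Z + b (- (j%:Z + 1))) <= K) ->
  clim (fun M => bilateral_sum M (fun m => gam k M m * a m) -
                 B k * bilateral_sum M a) 0.
Proof.
move=> k0 ab bK; have [C C0 hC] := gam_bounded k0.
pose w M m := (gam k M m - B k) * a m.
have b0 m : 0 <= b m by apply: le_trans (ab m); apply: cabs_ge0.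
apply: (eq_clim (u := fun M => bilateral_sum M (w M))).
  move=> M; rewrite -bilateral_sumM -bilateral_sumB; apply: eq_bilateral_sum => m _.
  by rewrite /w mulrBl.
apply: (@bilateral_tannery R w (fun m => (C + cabs (B k)) * b m) ((C + cabs (B k)) * K)).
- move=> M m _; rewrite cabsM; apply: ler_pM; rewrite ?cabs_ge0 //.
  by apply: le_trans (cabsD _ _) _; rewrite cabsN lerD2r.
- by move=> m; rewrite mulr_ge0 // addr_ge0 ?cabs_ge0 // ltW.
- move=> P; under eq_bigr do rewrite -mulrDr.
  by rewrite -mulr_sumr ler_wpM2l // addr_ge0 ?cabs_ge0 // ltW.
- move=> m; rewrite -[X in clim _ X](mul0r (a m)); apply: climM; last exact: clim_cst.
  exact: gam_clim.
Qed.

Lemma cabs_pow_bound x k m : complex.Im x != 0 -> (2 <= k)%N ->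
  cabs ((x + m%:~R) ^- k) <= `|complex.Im x| ^- (k - 2) * cabs (x + m%:~R) ^- 2.
Proof.
move=> x0 k2; have c0 : 0 < cabs (x + m%:~R) by rewrite cabs_gt0 add_int_neq0.
have h1 : `|complex.Im x| <= cabs (x + m%:~R) by rewrite -(Im_add_int x m) Im_le_cabs.
rewrite cabsV cabsX -{1}(subnK k2) exprD invfM ler_wpM2r ?invr_ge0 ?sqr_ge0 //.
by rewrite lef_pV2 ?posrE ?exprn_gt0 ?normr_gt0 // lerXn2r ?nnegrE ?cabs_ge0.
Qed.

Lemma part_clim x k Phi : complex.Im x != 0 -> (2 <= k)%N ->
    clim (fun M => bilateral_sum M (fun m => (x + m%:~R) ^- k)) Phi ->
  clim (fun M => part k M x) (B k * Phi).
Proof.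
move=> x0 k2 hPhi; have [K K0 hK] := inv_square_bound x0.
have k0 : (0 < k)%N by apply: ltnW.
set D := `|complex.Im x| ^- (k - 2); have D0 : 0 <= D by rewrite invr_ge0 exprn_ge0.
have := @weighted_tannery k (fun m => (x + m%:~R) ^- k)
  (fun m => D * cabs (x + m%:~R) ^- 2) (D * K) k0.
move=> /(_ (fun m => cabs_pow_bound m x0 k2)) h.
rewrite -[X in clim _ X]add0r.
apply: (eq_clim _ (climD (h _) (climM (clim_cst (B k)) hPhi))) => [M|P].
  by rewrite subrK.
under eq_bigr do rewrite -mulrDr.
by rewrite -mulr_sumr ler_wpM2l.
Qed.

Let diff x x' m : R[i] := (x + m%:~R)^-1 - (x' + m%:~R)^-1.

(** The terms of weight 1 are not absolutely summable, but 1/(x + m) - 1/(x' + m) = (x' - x) / ((x +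
    m)(x' + m)) is dominated by inverse squares. *)
Lemma part1_diff x x' : complex.Im x != 0 -> complex.Im x' != 0 ->
  clim (fun M => part 1 M x - part 1 M x' - B 1 * bilateral_sum M (diff x x')) 0.
Proof.
move=> x0 x0'; have [K K0 hK] := inv_square_bound x0.
have [K' K0' hK'] := inv_square_bound x0'.
pose b m := cabs (x' - x) * (cabs (x + m%:~R) ^- 2 + cabs (x' + m%:~R) ^- 2).
apply: (eq_clim (u := fun M => bilateral_sum M (fun m => gam 1 M m * diff x x' m) -
                 B 1 * bilateral_sum M (diff x x'))).
  move=> M; congr (_ - _); rewrite /part -bilateral_sumB.
  by apply: eq_bilateral_sum => m _; rewrite /diff mulrBr !expr1.
apply: (@weighted_tannery 1 (diff x x') b (cabs (x' - x) * (K + K'))) => //.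
  move=> m; have h := add_int_neq0 m x0; have h' := add_int_neq0 m x0'.
  have -> : diff x x' m = (x' - x) * ((x + m%:~R)^-1 * (x' + m%:~R)^-1).
    by rewrite /diff; field; rewrite h h'.
  rewrite !cabsM !cabsV /b ler_wpM2l ?cabs_ge0 // -!exprVn.
  move: (cabs _)^-1 (cabs (x' + _))^-1 => u v.
  by have := sqr_ge0 (u - v); have := sqr_ge0 u; have := sqr_ge0 v; nra.
move=> P; rewrite /b; under eq_bigr do rewrite -mulrDr addrACA.
by rewrite -mulr_sumr ler_wpM2l ?cabs_ge0 // big_split lerD.
Qed.

Let iY (s : R) (Y : nat) : R[i] := 0 +i* (s * Y%:R).

(** At iY and -iY the whole multitangent sum and its parts of weight k >= 2 are O(1/Y) uniformly in
    [M], and weight 1 is what remains. The condition Y > 4 makes 4 / (Y - 1) at most 1, so that in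
    the product over the indices one factor gives the bound. *)
Lemma part1_imaginary_bound : exists2 C : R, 0 < C &
  forall Y (s : R) M, (4 < Y)%N -> `|s| = 1 -> cabs (part 1 M (iY s Y)) <= C / (Y%:R - 1).
Proof.
have hC k : exists C : R, (0 < k)%N -> 0 < C /\ forall M m, cabs (gam k M m) <= C.
  case: k => [|k]; first by exists 0.
  by have [C C0 hC] := @gam_bounded k.+1 isT; exists C.
have [C {}hC] := choice hC.
have Cpos : 0 <= \sum_(2 <= k < N.+1) C k.
  rewrite big_nat; apply: sumr_ge0 => k /andP [k2 _].
  by have [/ltW] := hC k (ltnW k2).
exists ((1 + \sum_(2 <= k < N.+1) C k) * 4) => [|Y s M Y4 s1].
  by rewrite mulr_gt0 // ltr_pwDl.
have Y1 : (1 < Y)%N by apply: leq_trans Y4.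
have Yp : 0 < Y%:R - 1 :> R by rewrite subr_gt0 ltr1n.
set x := iY s Y.
have Imx : `|complex.Im x| = Y%:R by rewrite /= normrM s1 mul1r ger0_norm.
have x0 : complex.Im x != 0.
  by rewrite -normr_gt0 Imx ltr0n ltnW.
have bM : bilateral_sum M (fun m => cabs (x + m%:~R) ^- 2) <= 4 / (Y%:R - 1).
  apply: le_trans (inv_square_bound_imaginary M.+1 Y1 s1).
  by apply: bilateral_sum_le => m; rewrite invr_ge0 sqr_ge0.
have pw k m : (2 <= k)%N -> cabs ((x + m%:~R) ^- k) <= cabs (x + m%:~R) ^- 2.
  move=> k2; apply: le_trans (cabs_pow_bound m x0 k2) _.
  rewrite ler_piMl ?invr_ge0 ?sqr_ge0 // invf_le1 ?exprn_gt0 ?Imx ?ltr0n ?(ltnW Y1) //.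
  by rewrite exprn_ege1 // ler1n ltnW.
have := tangent_sumE M x0 n1 nN n0.
have N0 : (0 < N)%N.
  by case: (n) n0 n2 nN => // k ? _ /andP [k2 _] /andP [kN _]; lia.
rewrite big_ltn // => e.
have -> : part 1 M x = tangent_sum M n x - \sum_(2 <= k < N.+1) part k M x.
  by rewrite e addrK.
rewrite mulrDl mul1r mulrDl; apply: le_trans (cabsD _ _) _; rewrite cabsN; apply: lerD.
  have cn := @chain_norm R _ (@ComplexField.Normc.normc R) int
    (fun k m => (x + m%:~R) ^- k) (int_range M) n
    (@cabsD R) (@cabsM R) (cabs0 R) (cabs1 R) (@cabs_ge0 R).
  apply: le_trans cn _.
  apply: le_trans (chain_le_prod _ _ _) _; first by move=> k m; apply: cabs_ge0.
  have sb k : (2 <= k)%N ->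
      \sum_(m <- int_range M) cabs ((x + m%:~R) ^- k) <= 4 / (Y%:R - 1).
    move=> k2; rewrite bilateral_sumE; apply: le_trans bM.
    by apply: ler_sum => j _; apply: lerD; [|case: ifP => // _]; apply: pw.
  have l1 : 4 / (Y%:R - 1) <= 1 :> R.
    rewrite ler_pdivrMr // mul1r.
    have : 5%:R <= Y%:R :> R by rewrite ler_nat.
    by lra.
  case: (n) n0 n2 => // k ms _ /andP [k2 m2].
  rewrite big_cons -[leRHS]mulr1; apply: ler_pM; rewrite ?sb //.
  - by apply: sumr_ge0 => j _; apply: cabs_ge0.
  - by apply: prodr_ge0 => j _; apply: sumr_ge0 => i _; apply: cabs_ge0.
  elim: ms m2 => [|j ms IH] /=; first by rewrite big_nil.
  case/andP => j2 m2; rewrite big_cons; apply: mulr_ile1; last exact: IH.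
  - by apply: sumr_ge0 => i _; apply: cabs_ge0.
  - by apply: prodr_ge0 => l _; apply: sumr_ge0 => i _; apply: cabs_ge0.
  - by apply: le_trans l1; apply: sb.
apply: le_trans (cabs_sum _ _ _) _; rewrite -mulrA mulr_suml !big_nat.
apply: ler_sum => k /andP [k2 kN]; have [Ck hk] := hC k (ltnW k2).
apply: le_trans (_ : _ <= C k * bilateral_sum M (fun m => cabs (x + m%:~R) ^- 2)) _; last first.
  by rewrite ler_wpM2l // ltW.
rewrite -bilateral_sumM; apply: cabs_bilateral_sum => m _.
by rewrite cabsM; apply: ler_pM; rewrite ?cabs_ge0 // pw.
Qed.

(** The difference at m is -2i Y/(m^2 + Y^2), of constant direction; each of the Y terms with 0 <= m
    < Y has Y/(m^2 + Y^2) >= 1/(2Y). *)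
Lemma diff_imaginary_ge1 Y M : (0 < Y)%N -> (Y <= M)%N ->
  1 <= cabs (bilateral_sum M (diff (iY 1 Y) (iY (-1) Y))).
Proof.
move=> Y0 YM; have Yp : 0 < Y%:R :> R by rewrite ltr0n.
pose q m : R := Y%:R / (m%:~R ^+ 2 + Y%:R ^+ 2).
have qpos m : 0 <= q m by rewrite divr_ge0 // addr_ge0 ?sqr_ge0.
have -> : bilateral_sum M (diff (iY 1 Y) (iY (-1) Y)) =
    (0 -i* 2) * (bilateral_sum M q)%:C.
  have -> : (bilateral_sum M q)%:C = bilateral_sum M (fun m => (q m)%:C).
    rewrite rmorph_sum; apply: eq_bigr => j _; rewrite rmorphD.
    by case: ifP => // _; rewrite rmorph0.
  rewrite -bilateral_sumM; apply: eq_bilateral_sum => m _; rewrite /diff /iY /q.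
  have d0 : m%:~R ^+ 2 + Y%:R ^+ 2 != 0 :> R.
    by rewrite gt_eqF // ltr_wpDl ?sqr_ge0 ?exprn_gt0.
  rewrite mul1r mulN1r -(rmorph_int (real_complex R)) /=.
  have e (s : R) : s ^+ 2 = 1 ->
     (0 +i* (s * Y%:R) + (m%:~R)%:C)^-1 =
     (m%:~R / (m%:~R ^+ 2 + Y%:R ^+ 2)) +i* - (s * Y%:R / (m%:~R ^+ 2 + Y%:R ^+ 2)).
    move=> s2; apply: (mulfI (x := 0 +i* (s * Y%:R) + (m%:~R)%:C)).
      rewrite -cabs_eq0 -(sqrf_eq0 (cabs _)) cabs_sqr /= add0r addr0 exprMn s2 mul1r.
      exact: d0.
    rewrite mulfV; last first.
      rewrite -cabs_eq0 -(sqrf_eq0 (cabs _)) cabs_sqr /= add0r addr0 exprMn s2 mul1r.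
      exact: d0.
    apply/eqP; rewrite eq_complex /=; apply/andP; split; apply/eqP.
      transitivity ((m%:~R ^+ 2 + s ^+ 2 * Y%:R ^+ 2) / (m%:~R ^+ 2 + Y%:R ^+ 2) : R).
        by rewrite s2 mul1r mulfV.
      by ring.
    by ring.
  have := e 1; rewrite expr1n mul1r => /(_ erefl) ->.
  have := e (-1); rewrite sqrrN expr1n mulN1r => /(_ erefl) ->.
  by apply/eqP; rewrite eq_complex /=; apply/andP; split; apply/eqP; ring.
rewrite cabsM cabs_real ger0_norm; last first.
  by apply: sumr_ge0 => j _; apply: addr_ge0 => //; case: ifP.
have -> : cabs (0 -i* 2 : R[i]) = 2.
  by rewrite /= expr0n /= add0r sqrrN sqrtr_sqr ger0_norm.
rewrite -ler_pdivrMl // mulr1.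
apply: le_trans (_ : \sum_(j < Y) (2 * Y%:R)^-1 <= _).
  by rewrite sumr_const card_ord -[(2 * Y%:R)^-1 *+ Y]mulr_natr invfM -mulrA mulVf ?mulr1 // gt_eqF.
rewrite (big_ord_widen M.+1 (fun _ => (2 * Y%:R)^-1) (leqW YM)) big_mkcond.
apply: ler_sum => j _; apply: le_trans (_ : q j%:Z <= _); last by rewrite lerDl; case: ifP.
case: ifP => // jY.
rewrite /q ler_pdivlMr; last by rewrite ltr_wpDl ?sqr_ge0 ?exprn_gt0.
rewrite ler_pdivrMl ?mulr_gt0 //.
have jY' : ((val j)%:R : R) <= Y%:R by rewrite ler_nat ltnW.
have j0 : (0 : R) <= (val j)%:R by [].
rewrite -[(Posz j)%:~R]/((val j)%:R : R).
by nra.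
Qed.

(** The multitangent sums at [i Y] and [- i Y] are [O(1 / Y)], while the
    monotangent sums of weight 1 at these two points stay at distance at least 1;
    hence weight 1 does not occur in the reduction. *)
Lemma tangent_coef1 : B 1 = 0.
Proof.
have [C C0 hC] := part1_imaginary_bound.
apply/eqP; rewrite -cabs_eq0; apply/eqP/le_anti; rewrite cabs_ge0 andbT.
apply/ler_addgt0Pl => e e0; rewrite addr0.
(* Y - 1 exceeds 4C/e, so each of the two imaginary points costs at most e/4; the other e/2 is spent
   on the limit in M. *)
pose Y := (Num.Def.trunc (4 * C / e) + 6)%N.
have Y4 : (4 < Y)%N by rewrite /Y; lia.
have Yp : 0 < Y%:R - 1 :> R by rewrite subr_gt0 ltr1n; apply: leq_trans Y4.
have CY : C / (Y%:R - 1) <= e / 4.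
  have : 4 * C / e < (Num.Def.trunc (4 * C / e)).+1%:R.
    by apply: truncnS_gt.
  rewrite ltr_pdivrMr // => h; rewrite ler_pdivrMr // mulrAC ler_pdivlMr //.
  have hY : (Num.Def.trunc (4 * C / e)).+1%:R <= Y%:R - 1 :> R.
    by rewrite lerBrDr natr1 ler_nat /Y; lia.
  have := ler_wpM2r (ltW e0) hY; lra.
have Im1 (s : R) : `|s| = 1 -> complex.Im (iY s Y) != 0.
  by move=> s1; rewrite -normr_gt0 /= normrM s1 mul1r normr_gt0 pnatr_eq0; lia.
have n11 : `|(-1 : R)| = 1 by rewrite normrN1.
have /climP/(_ (e / 2)) [|M0 hM] := part1_diff (Im1 1 (normr1 _)) (Im1 (-1) n11).
  by rewrite divr_gt0.
pose M := maxn M0 Y.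
have := hM M (leq_maxl _ _); rewrite subr0.
have h1 := hC Y 1 M Y4 (normr1 _); have h2 := hC Y (-1) M Y4 n11.
have h3 := @diff_imaginary_ge1 Y M (leq_trans (isT : 0 < 5)%N Y4) (leq_maxr _ _).
set p1 := part 1 M _ in h1 *; set p2 := part 1 M _ in h2 *; set S := bilateral_sum M _ in h3 *.
move=> h4.
have h5 : cabs (B 1 * S) <= cabs (p1 - p2 - B 1 * S) + cabs (p1 - p2).
  have := cabsD (p1 - p2) (- (p1 - p2 - B 1 * S)); rewrite cabsN.
  have -> : p1 - p2 + - (p1 - p2 - B 1 * S) = B 1 * S by ring.
  by rewrite addrC.
have h6 : cabs (p1 - p2) <= cabs p1 + cabs p2.
  by apply: le_trans (cabsD _ _) _; rewrite cabsN.
have h7 : cabs (B 1) <= cabs (B 1 * S) by rewrite cabsM ler_peMr ?cabs_ge0.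
lra.
Qed.

(** As [B 1] vanishes, the parts of weight 1 at [x] and at iY have the same asymptotic value, and
    the latter is small uniformly in [M]. *)
Lemma part1_clim x : complex.Im x != 0 -> clim (fun M => part 1 M x) 0.
Proof.
move=> x0; have [C C0 hC] := part1_imaginary_bound.
apply/climP => e e0.
pose Y := (Num.Def.trunc (4 * C / e) + 6)%N.
have Y4 : (4 < Y)%N by rewrite /Y; lia.
have Yp : 0 < Y%:R - 1 :> R by rewrite subr_gt0 ltr1n; apply: leq_trans Y4.
have CY : C / (Y%:R - 1) <= e / 4.
  have : 4 * C / e < (Num.Def.trunc (4 * C / e)).+1%:R.
    by apply: truncnS_gt.
  rewrite ltr_pdivrMr // => h; rewrite ler_pdivrMr // mulrAC ler_pdivlMr //.
  have hY : (Num.Def.trunc (4 * C / e)).+1%:R <= Y%:R - 1 :> R.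
    by rewrite lerBrDr natr1 ler_nat /Y; lia.
  have := ler_wpM2r (ltW e0) hY; lra.
have Y0 : complex.Im (iY 1 Y) != 0 by rewrite /= mul1r pnatr_eq0; lia.
have /climP/(_ (e / 2)) [|M0 hM] := part1_diff x0 Y0; first by rewrite divr_gt0.
exists M0 => M M0M; have := hM M M0M; rewrite tangent_coef1 mul0r !subr0 => h.
have := hC Y 1 M Y4 (normr1 _).
have := cabsD (part 1 M x - part 1 M (iY 1 Y)) (part 1 M (iY 1 Y)).
rewrite subrK; lra.
Qed.

Theorem tangent_sum_clim x (Phi : nat -> R[i]) : complex.Im x != 0 ->
    (forall k, (2 <= k)%N ->
       clim (fun M => bilateral_sum M (fun m => (x + m%:~R) ^- k)) (Phi k)) ->
  clim (fun M => tangent_sum M n x) (\sum_(2 <= k < N.+1) B k * Phi k).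
Proof.
move=> x0 hPhi.
have N0 : (0 < N)%N.
  by case: (n) n0 n2 nN => // k ? _ /andP [k2 _] /andP [kN _]; lia.
apply: (eq_clim (u := fun M => part 1 M x + \sum_(2 <= k < N.+1) part k M x)).
  by move=> M; rewrite (tangent_sumE M x0 n1 nN n0) [RHS]big_ltn.
rewrite -[X in clim _ X]add0r; apply: climD; first exact: part1_clim.
rewrite big_seq; apply: (eq_clim (u := fun M =>
    \sum_(k <- index_iota 2 N.+1 | k \in index_iota 2 N.+1) part k M x)).
  by move=> M; rewrite -big_seq.
apply: clim_sum => k; rewrite mem_index_iota => /andP [k2 _].
by apply: part_clim => //; apply: hPhi.
Qed.

End MultitangentLimit.

(** * The Lipschitz formula *)

Section PowerSums.
Variable R : realType.

Lemma binomial_series_le (t : R) i V : 0 <= t < 1 ->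
  \sum_(m < V) 'C(m + i, i)%:R * t ^+ m <= (1 - t)^-1 ^+ i.+1.
Proof.
case/andP => t0 t1; have s0 : 0 < 1 - t by rewrite subr_gt0.
have key (s : R) : (1 - t) * s <= (1 - t)^-1 ^+ i -> s <= (1 - t)^-1 ^+ i.+1.
  by rewrite exprS ler_pdivlMl.
elim: i V {key} => [|i IH] V.
  rewrite expr1 -[leRHS]mulr1 ler_pdivlMl //.
  have -> : \sum_(m < V) 'C(m + 0, 0)%:R * t ^+ m = \sum_(m < V) t ^+ m.
    by apply: eq_bigr => m _; rewrite bin0 mul1r.
  have -> : (1 - t) * \sum_(m < V) t ^+ m = 1 - t ^+ V.
    by rewrite -[1 - t]opprB mulNr -subrX1 opprB.
  by rewrite lerBlDr lerDl exprn_ge0.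
rewrite exprS ler_pdivlMl //; apply: le_trans (IH V).
case: V => [|V]; first by rewrite !big_ord0 mulr0.
have -> : (1 - t) * \sum_(m < V.+1) 'C(m + i.+1, i.+1)%:R * t ^+ m =
    \sum_(m < V.+1) 'C(m + i, i)%:R * t ^+ m - 'C(V.+1 + i, i.+1)%:R * t ^+ V.+1.
  elim: V => [|V IHV].
    by rewrite !big_ord1 !add0n addSn add0n !binn expr0; ring.
  rewrite big_ord_recr mulrDr IHV [in RHS]big_ord_recr /=.
  have -> : 'C(V.+1 + i.+1, i.+1) = ('C(V.+1 + i, i.+1) + 'C(V.+1 + i, i))%N by rewrite addnS binS.
  have -> : 'C(V.+2 + i, i.+1) = ('C(V.+1 + i, i.+1) + 'C(V.+1 + i, i))%N by rewrite addSn binS.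
  by rewrite !natrD !exprS; ring.
by rewrite lerBlDr lerDl mulr_ge0 ?exprn_ge0.
Qed.

Lemma binomial_term_cvg0 (t : R) i : 0 <= t < 1 ->
  (fun m => 'C(m + i, i)%:R * t ^+ m) @ \oo --> (0 : R).
Proof.
move=> t01; have /andP [t0 t1] := t01.
have b0 m : 0 <= 'C(m + i, i)%:R * t ^+ m by rewrite mulr_ge0 ?exprn_ge0.
have [l hl _] := bounded_sum_cvg b0 (fun V => binomial_series_le i V t01).
have hl' : (fun V => \sum_(m < V.+1) 'C(m + i, i)%:R * t ^+ m) @ \oo --> l.
  by rewrite (cvg_shiftS (fun V => \sum_(m < V) 'C(m + i, i)%:R * t ^+ m)).
have -> : (fun m => 'C(m + i, i)%:R * t ^+ m) = (fun V =>
    \sum_(m < V.+1) 'C(m + i, i)%:R * t ^+ m - \sum_(m < V) 'C(m + i, i)%:R * t ^+ m).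
  by apply/funext => V /=; rewrite big_ord_recr /= [RHS]addrAC subrr add0r.
by rewrite -[0 in X in _ --> X](subrr l); apply: cvgB.
Qed.

Lemma binomial_series_clim (x : R[i]) i : cabs x < 1 ->
  clim (fun V => \sum_(m < V) 'C(m + i, i)%:R * x ^+ m) ((1 - x)^-1 ^+ i.+1).
Proof.
move=> x1; have x01 : 0 <= cabs x < 1 by rewrite cabs_ge0.
have x0 : 1 - x != 0.
  by apply: contraTneq x1 => /eqP; rewrite subr_eq0 => /eqP <-; rewrite cabs1 ltxx.
have t0 j : clim (fun m => 'C(m + j, j)%:R * x ^+ m) 0.
  apply: clim_le (binomial_term_cvg0 j x01) => m.
  by rewrite subr0 cabsM cabs_nat cabsX.
elim: i => [|i IH].
  have e V : \sum_(m < V) 'C(m + 0, 0)%:R * x ^+ m = (1 - 'C(V + 0, 0)%:R * x ^+ V) * (1 - x)^-1.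
    apply: (mulIf x0); rewrite mulfVK // bin0 mul1r.
    have -> : \sum_(m < V) 'C(m + 0, 0)%:R * x ^+ m = \sum_(m < V) x ^+ m.
      by apply: eq_bigr => m _; rewrite bin0 mul1r.
    by rewrite -[1 - x]opprB mulrN mulrC -subrX1 opprB.
  apply: (eq_clim (fun V => esym (e V))); rewrite -[X in clim _ X]mul1r expr1.
  apply: climM; last exact: clim_cst.
  by rewrite -[X in clim _ X]subr0; apply: climB (t0 0%N); apply: clim_cst.
have e V : \sum_(m < V) 'C(m + i.+1, i.+1)%:R * x ^+ m =
    (\sum_(m < V) 'C(m + i, i)%:R * x ^+ m - 'C(V + i, i.+1)%:R * x ^+ V) * (1 - x)^-1.
  apply: (mulIf x0); rewrite mulfVK //; elim: V => [|V IHV].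
    by rewrite !big_ord0 mul0r add0n bin_small // mul0r subrr.
  rewrite !big_ord_recr /= mulrDl IHV.
  have -> : 'C(V + i.+1, i.+1) = ('C(V + i, i.+1) + 'C(V + i, i))%N by rewrite addnS binS.
  have -> : 'C(V.+1 + i, i.+1) = ('C(V + i, i.+1) + 'C(V + i, i))%N by rewrite addSn binS.
  by rewrite !natrD !exprS; ring.
apply: (eq_clim (fun V => esym (e V))); rewrite exprS mulrC; apply: climM; last exact: clim_cst.
rewrite -[X in clim _ X]subr0; apply: climB IH _.
apply: (clim_le (b := fun m => 'C(m + i.+1, i.+1)%:R * cabs x ^+ m)).
  move=> m; rewrite subr0 cabsM cabs_nat cabsX ler_wpM2r ?exprn_ge0 ?cabs_ge0 //.
  by rewrite ler_nat addnS binS leq_addr.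
exact: binomial_term_cvg0.
Qed.

(** [y * (eulerian j).[y]], with [y = 1 / (1 - X)], is the sum of [m^j X^m]. *)
Fixpoint eulerian (j : nat) : {poly R[i]} :=
  if j is j'.+1 then ('X - 1) * ('X * eulerian j')^`() else 1.

Lemma size_eulerian j : (size (eulerian j) <= j.+1)%N.
Proof.
elim: j => [|j IH]; first by rewrite size_polyC oner_eq0.
have h1 : size (('X - 1)%R : {poly R[i]}) = 2%N by rewrite -[X in 'X - X]polyC1 size_XsubC.
have h2 : (size (('X * eulerian j)^`() : {poly R[i]})%R <= j.+1)%N.
  apply: leq_trans (size_poly _ _) _.
  by have := size_polyMleq 'X (eulerian j); rewrite size_polyX; move: IH; lia.
apply: leq_trans (size_polyMleq ('X - 1) ('X * eulerian j)^`()) _.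
by rewrite h1.
Qed.

Lemma coef_eulerianS j i : (eulerian j.+1)`_i =
  (if i is i'.+1 then (eulerian j)`_i' *+ i else 0) - (eulerian j)`_i *+ i.+1.
Proof.
rewrite [eulerian _]/= mulrBl mul1r coefB coefXM !coef_deriv !coefXM /=.
by case: i => [|i] //=; rewrite coef_deriv coefXM.
Qed.

(** The only coefficient that survives in [scaled_power_sum_clim]; it yields the factorial in the
    Lipschitz formula. *)
Lemma coef_eulerian_lead j : (eulerian j)`_j = j`!%:R.
Proof.
elim: j => [|j IH]; first by rewrite coef1.
rewrite coef_eulerianS IH (nth_default 0 (size_eulerian j)) mul0rn subr0.
by rewrite -mulrnA mulnC factS.
Qed.

(** Induction on [j] by m C(m+i, i) = (i+1) (C(m+i+1, i+1) - C(m+i, i)), the recursion built into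
    [eulerian]. *)
Lemma power_eulerian j m :
  m%:R ^+ j = \sum_(i < j.+1) (eulerian j)`_i * 'C(m + i, i)%:R :> R[i].
Proof.
elim: j => [|j IH]; first by rewrite big_ord1 coef1 mul1r addn0 bin0.
rewrite exprS IH mulr_sumr; under [RHS]eq_bigr do rewrite coef_eulerianS mulrBl.
rewrite sumrB [X in _ = X - _]big_ord_recl [X in _ - X]big_ord_recr /= mul0r add0r.
rewrite (nth_default 0 (size_eulerian j)) mul0rn mul0r addr0 -sumrB.
apply: eq_bigr => i _; have -> : bump 0 i = i.+1 by [].
have h : (m + i.+1)%:R * 'C(m + i, i)%:R = i.+1%:R * 'C(m + i.+1, i.+1)%:R :> R[i].
  by rewrite -!natrM addnS -[X in (_ * 'C(X, _))%N]/((m + i).+1.-1) mul_bin_diag.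
transitivity ((eulerian j)`_i * (i.+1%:R * 'C(m + i.+1, i.+1)%:R) -
              (eulerian j)`_i * i.+1%:R * 'C(m + i, i)%:R).
  by rewrite -h natrD; ring.
by rewrite mulrA !mulr_natr.
Qed.

(** The closed form of the sum of m^j x^m. As a polynomial in 1/(1 - x) it displays the pole at x =
    1, near which it will be evaluated. *)
Definition power_sum j (x : R[i]) : R[i] :=
  \sum_(i < j.+1) (eulerian j)`_i * (1 - x)^-1 ^+ i.+1.

Lemma power_series_clim j (x : R[i]) : cabs x < 1 ->
  clim (fun V => \sum_(m < V) m%:R ^+ j * x ^+ m) (power_sum j x).
Proof.
move=> x1; apply: (eq_clim (u := fun V => \sum_(i < j.+1)
    (eulerian j)`_i * \sum_(m < V) 'C(m + i, i)%:R * x ^+ m)).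
  move=> V; under [RHS]eq_bigr do rewrite power_eulerian mulr_suml.
  rewrite exchange_big; apply: eq_bigr => i _; rewrite mulr_sumr.
  by apply: eq_bigr => m _; rewrite mulrA.
apply: clim_sum => i _; apply: climM; first exact: clim_cst.
exact: binomial_series_clim.
Qed.

(** Adding the series at x and at -x cancels the odd exponents, and the even ones give the series at
    x^2. *)
Lemma power_sum_double j (x : R[i]) : cabs x < 1 ->
  power_sum j x + power_sum j (- x) = 2 ^+ j.+1 * power_sum j (x ^+ 2).
Proof.
move=> x1; have xN1 : cabs (- x) < 1 by rewrite cabsN.
have x21 : cabs (x ^+ 2) < 1 by rewrite cabsX exprn_ilt1 // cabs_ge0.
have h1 := climD (power_series_clim j x1) (power_series_clim j xN1).
have h2 := climM (clim_cst (2 ^+ j.+1)) (power_series_clim j x21).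
have dbl V : (V <= V.*2)%N by rewrite -addnn leq_addr.
apply: clim_unique (clim_subseq dbl h1) _; apply: eq_clim h2 => V /=.
elim: V => [|V IH]; first by rewrite !big_ord0 mulr0 addr0.
rewrite doubleS !big_ord_recr /= mulrDr IH.
have -> : (V.*2)%:R = 2 * V%:R :> R[i] by rewrite -muln2 natrM mulrC.
have e : x ^+ V.*2 = (x ^+ 2) ^+ V by rewrite -muln2 mulnC exprM.
have eN : (- x) ^+ V.*2 = (x ^+ 2) ^+ V by rewrite -muln2 mulnC exprM sqrrN.
rewrite (exprS x V.*2) (exprS (- x) V.*2) (exprS 2 j) e eN (_ : (2 * V%:R) ^+ j = 2 ^+ j * V%:R ^+ j); last exact: exprMn.
move: (x ^+ 2 ^+ V) => s; ring.
Qed.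

End PowerSums.

(** * The function q = exp(2 pi i z) *)

Section Exponential.
Variable R : realType.
Implicit Types (z w : R[i]).

Lemma cexpD z w : cexp (z + w) = cexp z * cexp w.
Proof.
case: z w => a b [c d]; rewrite /cexp /= expRD cosD sinD.
by apply/eqP; rewrite eq_complex /=; apply/andP; split; apply/eqP; ring.
Qed.

Lemma cabs_cexp z : cabs (cexp z) = expR (complex.Re z).
Proof.
rewrite cabsM cabs_real ger0_norm ?expR_ge0 //.
by rewrite /= cos2Dsin2 sqrtr1 mulr1.
Qed.

Definition qexp z : R[i] := cexp (two_pi_i R * z).

Lemma qexpD z w : qexp (z + w) = qexp z * qexp w.
Proof. by rewrite /qexp mulrDr cexpD. Qed.

Lemma qexp0 : qexp 0 = 1.
Proof. by rewrite /qexp mulr0 /cexp /= expR0 cos0 sin0 mul1r. Qed.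

Lemma qexp_muln l z : qexp (l%:R * z) = qexp z ^+ l.
Proof.
elim: l => [|l IH]; first by rewrite mul0r qexp0.
by rewrite exprS -IH -qexpD -nat1r mulrDl mul1r.
Qed.

Lemma qexpE (a b : R) : qexp (a +i* b) =
  (expR (- (pi *+ 2 * b)))%:C * (cos (pi *+ 2 * a) +i* sin (pi *+ 2 * a)).
Proof.
by rewrite /qexp /cexp /two_pi_i /= !mul0r sub0r add0r mulr_natl.
Qed.

Lemma qexpDhalf z : qexp (z + 2^-1) = - qexp z.
Proof.
rewrite qexpD -[2^-1]/((2 : R[i])^-1).
have -> : (2 : R[i])^-1 = (2^-1 : R) +i* 0.
  by rewrite -[2 in LHS](rmorph_nat (real_complex R)) -fmorphV.
rewrite qexpE mulr0 oppr0 expR0 mul1r.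
have -> : pi *+ 2 * 2^-1 = pi :> R by rewrite -[pi *+ 2]mulr_natr mulfK.
rewrite cospi sinpi.
have -> : (-1 +i* 0 : R[i]) = -1 by apply/eqP; rewrite eq_complex /= oppr0 !eqxx.
by rewrite mulrN1.
Qed.

Lemma qexpD1 z : qexp (z + 1) = qexp z.
Proof.
have -> : z + 1 = z + 2^-1 + 2^-1.
  by rewrite -addrA -mulr2n -[2^-1 *+ 2]mulr_natr mulVf ?pnatr_eq0.
by rewrite !qexpDhalf opprK.
Qed.

Lemma cabs_qexp z : cabs (qexp z) = expR (- (pi *+ 2 * complex.Im z)).
Proof. by rewrite cabs_cexp; case: z => a b /=; rewrite mul0r sub0r mulr_natl. Qed.

Lemma cabs_qexp_lt1 z : 0 < complex.Im z -> cabs (qexp z) < 1.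
Proof. by move=> z0; rewrite cabs_qexp expR_lt1 oppr_lt0 mulr_gt0 // pmulrn_rgt0 ?pi_gt0. Qed.

(** One has sin u = 2 sin v cos v with v = u/2 <= 3 pi/8, and sin v = v cos c with 0 < c < v by the
    mean value theorem; both cosines are at least cos(3 pi/8). *)
Lemma sin_ge (u : R) : 0 <= u <= 3 / 4 * pi -> cos (3 / 8 * pi) ^+ 2 * u <= sin u.
Proof.
case/andP => u0 u1; have pi0 := @pi_gt0 R.
have [->|uN0] := eqVneq u 0; first by rewrite mulr0 sin0.
have up : 0 < u by rewrite lt_def uN0.
pose v := u / 2; have vE : u = v *+ 2 by rewrite -[v *+ 2]mulr_natr mulfVK.
have v0 : 0 < v by rewrite divr_gt0.
have v1 : v <= 3 / 8 * pi by rewrite /v; lra.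
have cmono (x : R) : 0 <= x -> x <= 3 / 8 * pi -> cos (3 / 8 * pi) <= cos x.
  move=> x0; rewrite le_eqVlt => /predU1P [->//|x1]; apply: ltW.
  by rewrite ltr_cos ?in_itv /=; [exact: x1 | lra | lra].
have c0 : 0 < cos (3 / 8 * pi : R) by apply: cos_gt0_pihalf; lra.
have [|c cv] := @MVT R (@sin R) (@cos R) 0 v v0 (fun x _ => is_derive_sin x).
  by apply: continuous_subspaceT => x; apply: continuous_sin.
rewrite sin0 !subr0 => sv; move: cv; rewrite in_itv /= => /andP [c0' c1].
rewrite vE sin_mulr2n sv mulrnAr ler_pMn2r //.
have C0 := ltW c0; have V0 := ltW v0; have Cv : cos (3 / 8 * pi) <= cos v by apply: cmono.
have Cc : cos (3 / 8 * pi) <= cos c by apply: cmono; lra.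
by rewrite expr2 -mulrA ler_pM ?mulr_ge0 // ler_wpM2r.
Qed.

(** For z = a + ib and E = exp(-2 pi b), |1 - qexp z|^2 = (1 - E)^2 + 4 E sin(pi a)^2, whose two
    terms are compared with b^2 and a^2. As [qexp] is 1 at all integers, |a| has to stay away from
    1. *)
Lemma qexp_sub1_ge : exists2 c : R, 0 < c & forall z,
  `|complex.Re z| <= 3 / 4 -> 0 < complex.Im z <= 1 -> c * cabs z <= cabs (1 - qexp z).
Proof.
have pi0 := @pi_gt0 R; have pi2 := @pi_ge2 R.
have [c0 [c0p c01 hsin]] : exists c0 : R,
    [/\ 0 < c0, c0 <= 1 & forall u, 0 <= u <= 3 / 4 * pi -> c0 * u <= sin u].
  exists (cos (3 / 8 * pi : R) ^+ 2); split; last exact: sin_ge.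
    by apply: exprn_gt0; apply: cos_gt0_pihalf; lra.
  by rewrite cos2sin2 lerBlDr lerDl sqr_ge0.
have E0p : 0 < expR (- (pi *+ 2) : R) by apply: expR_gt0.
exists (expR (- (pi *+ 2)) * c0); first exact: mulr_gt0.
move=> z ha /andP [b0 b1].
have E0p' := ltW E0p; have c0p' := ltW c0p; have b0' := ltW b0.
rewrite -(@ler_pXn2r R 2) ?nnegrE ?mulr_ge0 ?cabs_ge0 // exprMn cabs_sqr.
pose E := expR (- (pi *+ 2 * complex.Im z)); pose s := sin (pi * complex.Re z).
have -> : cabs (1 - qexp z) ^+ 2 = (1 - E) ^+ 2 + 4 * E * s ^+ 2.
  have -> : qexp z = qexp (complex.Re z +i* complex.Im z) by case: (z).
  rewrite cabs_sqr qexpE -/E /= !mul0r subr0 addr0.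
  have -> : pi *+ 2 * complex.Re z = (pi * complex.Re z) *+ 2 by rewrite mulrnAl.
  rewrite cos_mulr2n sin_mulr2n -/s.
  have h : cos (pi * complex.Re z) ^+ 2 = 1 - s ^+ 2 by rewrite cos2sin2.
  by ring: h.
have Ep : 0 < E by apply: expR_gt0.
have EE0 : expR (- (pi *+ 2)) <= E.
  by rewrite ler_expR lerN2; apply: ler_piMr => //; apply/mulrn_wge0/ltW.
have hE : pi *+ 2 * complex.Im z * E <= 1 - E.
  have := expR_ge1Dx (pi *+ 2 * complex.Im z); rewrite -(ler_pM2r Ep) mulrDl mul1r.
  by rewrite /E -expRD subrr expR0 lerBrDl.
have hs : c0 * (pi * `|complex.Re z|) <= `|s|.
  have -> : `|s| = `|sin (pi * `|complex.Re z|)|.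
    rewrite /s; case: (ger0P (complex.Re z)) => // _; by rewrite mulrN sinN normrN.
  apply: le_trans (ler_norm _); apply: hsin.
  by rewrite mulr_ge0 ?(ltW pi0) //= mulrC ler_pM2r.
have pi20 : 0 <= pi *+ 2 :> R by apply/mulrn_wge0/ltW.
have E01 : expR (- (pi *+ 2)) <= 1 :> R by rewrite expR_le1 oppr_le0.
have E1 : E <= 1 by rewrite expR_le1 oppr_le0 mulr_ge0.
clearbody E s; move: (expR _) E0p E0p' EE0 E01 => E0 E0p E0p' EE0 E01.
move: (complex.Im z) (complex.Re z) b0 b0' b1 ha hE hs => b a b0 b0' b1 ha hE hs.
rewrite mulrDr addrC; apply: lerD.
  rewrite -exprMn lerXn2r ?nnegrE ?mulr_ge0 ?subr_ge0 //.
  apply: le_trans hE; rewrite [leRHS]mulrAC ler_wpM2r //.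
  by rewrite mulrC ler_pM //; lra.
have hs' : (c0 * (pi * `|a|)) ^+ 2 <= s ^+ 2.
  by rewrite -[s ^+ 2]real_normK ?num_real // lerXn2r ?nnegrE ?mulr_ge0 ?(ltW pi0).
apply: le_trans (_ : 4 * E0 * (c0 * (pi * `|a|)) ^+ 2 <= _); last first.
  apply: ler_pM => //; first by rewrite mulr_ge0.
    exact: sqr_ge0.
  by rewrite ler_pM2l.
rewrite [(c0 * _) ^+ 2]exprMn [(pi * _) ^+ 2]exprMn real_normK ?num_real //.
have -> : (E0 * c0) ^+ 2 * a ^+ 2 = E0 * E0 * (c0 ^+ 2 * a ^+ 2) by ring.
have -> : 4 * E0 * (c0 ^+ 2 * (pi ^+ 2 * a ^+ 2)) =
  E0 * (4 * pi ^+ 2) * (c0 ^+ 2 * a ^+ 2) by ring.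
apply: ler_wpM2r; first by rewrite mulr_ge0 ?sqr_ge0.
apply: ler_wpM2l => //; apply: le_trans E01 _; nra.
Qed.

End Exponential.

(** * Dyadic distribution and the sum over integers *)

Section Lipschitz.
Variable R : realType.
Implicit Types (z w : R[i]).

Lemma pow2V_cvg0 : (fun t => (2 ^+ t)^-1 : R) @ \oo --> (0 : R).
Proof.
have h := @cvg_expr R 2^-1; under eq_fun do rewrite -exprVn.
by apply: h; rewrite ger0_norm ?invr_ge0 // invf_lt1 ?ltr1n.
Qed.

Lemma scaled_increment_cvg (f : R -> R) (d : R) : is_derive (0 : R) 1 f d ->
  (fun t => 2 ^+ t * (f (2 ^+ t)^-1 - f 0)) @ \oo --> d.
Proof.
move=> fd; have dv := @ex_derive _ _ _ _ _ _ _ fd.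
have h : (fun h : R => h^-1 *: (f (h *: (1 : R) + 0) - f 0)) x @[x --> 0^'] --> d.
  by rewrite -(@derive_val _ _ _ _ _ _ _ fd); exact: dv.
have /cvg_at_rightP h' := cvg_dnbhs_at_right h.
have -> : (fun t => 2 ^+ t * (f (2 ^+ t)^-1 - f 0)) =
    (fun t => (2 ^+ t)^-1^-1 *: (f ((2 ^+ t)^-1 *: (1 : R) + 0) - f 0)).
  by apply/funext => t; rewrite invrK addr0 [_ *: 1]mulr1.
apply: (h' (fun t => (2 ^+ t)^-1)); split; last exact: pow2V_cvg0.
by move=> t; rewrite invr_gt0 exprn_gt0.
Qed.

Lemma cexp_scaled_clim z :
  clim (fun t => 2 ^+ t * (1 - cexp (z / 2 ^+ t))) (- z).
Proof.
case: z => a b.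
pose f (s : R) := expR (a * s) * cos (b * s); pose g (s : R) := expR (a * s) * sin (b * s).
have linear_derive (c : R) : is_derive (0 : R) 1 (fun s : R => c * s) c.
  by apply: is_derive_eq; rewrite /= ?scaler0 ?addr0 /GRing.scale /= mulr1.
have hE := is_derive1_comp (is_derive_expR (a * 0)) (linear_derive a).
have hC := is_derive1_comp (is_derive_cos (b * 0)) (linear_derive b).
have hS := is_derive1_comp (is_derive_sin (b * 0)) (linear_derive b).
have fd : is_derive (0 : R) 1 f a.
  apply: (is_derive_eq (is_deriveM hE hC)).
  by rewrite /GRing.scale /= !mulr0 expR0 cos0 sin0 oppr0 !mul0r mulr0 add0r !mul1r.
have gd : is_derive (0 : R) 1 g b.
  apply: (is_derive_eq (is_deriveM hE hS)).
  by rewrite /GRing.scale /= !mulr0 expR0 cos0 sin0 !mul0r addr0 !mul1r.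
have /cvgrPdist_lt hf := scaled_increment_cvg fd.
have /cvgrPdist_lt hg := scaled_increment_cvg gd.
apply: (clim_le (b := fun t => `|a - 2 ^+ t * (f (2 ^+ t)^-1 - f 0)| +
                               `|b - 2 ^+ t * (g (2 ^+ t)^-1 - g 0)|)); last first.
  rewrite -[0 in X in _ --> X]addr0; apply: cvgD.
    by apply/cvgrPdist_lt => e e0; apply: filterS (hf e e0) => t; rewrite sub0r normrN normr_id.
  by apply/cvgrPdist_lt => e e0; apply: filterS (hg e e0) => t; rewrite sub0r normrN normr_id.
move=> t; set N : R := 2 ^+ t.
have NE : 2 ^+ t = N%:C by rewrite rmorphXn rmorph_nat.
have -> : (a +i* b) / 2 ^+ t = (a / N) +i* (b / N).
  by rewrite NE -fmorphV; apply/eqP; rewrite eq_complex /= !mulr0 subr0 add0r !eqxx.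
apply: le_trans (cabs_le_ReIm _) _; rewrite NE /cexp /= /f /g !mulr0 expR0 cos0 sin0.
rewrite !mul0r !subr0 !addr0 !mulr1 !opprK.
rewrite mulr0 subr0 sub0r.
by apply: lerD; rewrite le_eqVlt; apply/orP; left; apply/eqP; congr `|_|; ring.
Qed.

Lemma Im_div_pow2 z t : complex.Im (z / 2 ^+ t) = complex.Im z / 2 ^+ t.
Proof.
have -> : 2 ^+ t = (2 ^+ t : R)%:C :> R[i] by rewrite rmorphXn rmorph_nat.
by rewrite -fmorphV; case: z => a b /=; rewrite mulr0 add0r.
Qed.

Lemma Re_div_pow2 z t : complex.Re (z / 2 ^+ t) = complex.Re z / 2 ^+ t.
Proof.
have -> : 2 ^+ t = (2 ^+ t : R)%:C :> R[i] by rewrite rmorphXn rmorph_nat.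
by rewrite -fmorphV; case: z => a b /=; rewrite mulr0 subr0.
Qed.

Lemma power_sum_qexp_double j z : 0 < complex.Im z ->
  power_sum j (qexp (z / 2)) + power_sum j (qexp ((z + 1) / 2)) =
  2 ^+ j.+1 * power_sum j (qexp z).
Proof.
move=> z0; rewrite mulrDl mul1r qexpDhalf power_sum_double.
  by rewrite -qexp_muln [_ * (z / _)]mulrC mulfVK ?pnatr_eq0.
by apply: cabs_qexp_lt1; rewrite -[2]expr1 Im_div_pow2 divr_gt0.
Qed.

Lemma power_sum_qexp_split j t z : 0 < complex.Im z ->
  \sum_(i < 2 ^ t) power_sum j (qexp ((z + i%:R) / 2 ^+ t)) =
  (2 ^+ j.+1) ^+ t * power_sum j (qexp z).
Proof.
elim: t z => [|t IH] z z0.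
  by rewrite expn0 big_ord1 addr0 divr1 mul1r.
have -> : (2 ^ t.+1 = 2 ^ t + 2 ^ t)%N by rewrite expnS mul2n addnn.
have e (x : R[i]) : x / 2 ^+ t.+1 = (x / 2 ^+ t) / 2 by rewrite exprS invfM [2^-1 * _]mulrC mulrA.
rewrite big_split_ord /= -big_split /= [(2 ^+ _) ^+ _]exprS -mulrA -IH // mulr_sumr.
apply: eq_bigr => i _; rewrite -power_sum_qexp_double; last first.
  rewrite Im_div_pow2 divr_gt0 //.
  by have := Im_add_int z i%:Z; rewrite /= => ->.
rewrite !e; congr (_ + power_sum j (qexp (_ / 2))).
have N0 : 2 ^+ t != 0 :> R[i] by rewrite expf_neq0 ?pnatr_eq0.
by rewrite natrD natrX addrCA mulrDl mulfV // [LHS]addrC.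
Qed.

Lemma sum_ord_double (V : nmodType) (f : nat -> V) n :
  \sum_(i < n + n) f i = \sum_(i < n) (f i + f (n + (n - i.+1))%N).
Proof.
rewrite big_split_ord big_split /=; congr (_ + _).
by rewrite (reindex_inj rev_ord_inj).
Qed.

(** The distribution relation with the residues modulo 2^(t+1) taken, by periodicity of [qexp],
    between -2^t and 2^t - 1, so that each integer m keeps its place as [t] grows. *)
Lemma power_sum_qexp_bilateral j t z : 0 < complex.Im z ->
  \sum_(i < 2 ^ t) (power_sum j (qexp ((z + i%:Z%:~R) / 2 ^+ t.+1)) +
                    power_sum j (qexp ((z + (- (i%:Z + 1))%:~R) / 2 ^+ t.+1))) =
  (2 ^+ t.+1) ^+ j.+1 * power_sum j (qexp z).
Proof.
move=> z0; rewrite -exprM mulnC exprM -power_sum_qexp_split //.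
have -> : (2 ^ t.+1 = 2 ^ t + 2 ^ t)%N by rewrite expnS mul2n addnn.
rewrite (sum_ord_double (fun i => power_sum j (qexp ((z + i%:R) / 2 ^+ t.+1)))).
apply: eq_bigr => i _.
suff -> : qexp ((z + (- (i%:Z + 1))%:~R) / 2 ^+ t.+1) =
          qexp ((z + (2 ^ t + (2 ^ t - i.+1))%:R) / 2 ^+ t.+1) by [].
rewrite -[LHS]qexpD1; congr qexp.
have N0 : 2 ^+ t.+1 != 0 :> R[i] by rewrite expf_neq0 ?pnatr_eq0.
have -> : (2 ^ t + (2 ^ t - i.+1))%:R = 2 ^+ t.+1 - (i%:R + 1) :> R[i].
  rewrite natrD natrB; last by have := ltn_ord i.
  by rewrite exprS natrX -natr1; ring.
rewrite mulrDl [in RHS]mulrDl [in RHS]mulrDl mulfV // rmorphN rmorphD /=; ring.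
Qed.

Lemma scaled_power_sumE j (N x : R[i]) : N != 0 ->
  N^-1 ^+ j.+1 * power_sum j x =
  \sum_(i < j.+1) (eulerian R j)`_i * (N * (1 - x))^-1 ^+ i.+1 * N^-1 ^+ (j - i).
Proof.
move=> N0; rewrite mulr_sumr; apply: eq_bigr => i _.
have ij : (i <= j)%N by have := ltn_ord i.
have -> : N^-1 ^+ j.+1 = N^-1 ^+ i.+1 * N^-1 ^+ (j - i) by rewrite -exprD addSn subnKC.
by rewrite [(N * _)^-1]invfM [(N^-1 * _) ^+ _]exprMn; ring.
Qed.

(** As 2^t (1 - qexp(w/2^t)) tends to -2 pi i w, spare factors 2^-t kill every term of [power_sum]
    except the one of top degree. *)
Lemma scaled_power_sum_clim j w : w != 0 ->
  clim (fun t => (2 ^+ t)^-1 ^+ j.+1 * power_sum j (qexp (w / 2 ^+ t)))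
       (j`!%:R * (- two_pi_i R * w)^-1 ^+ j.+1).
Proof.
move=> w0; have c0 : - two_pi_i R * w != 0.
  rewrite mulf_neq0 // oppr_eq0 eq_complex /= eqxx /= mulf_neq0 ?pnatr_eq0 //.
  by rewrite gt_eqF // pi_gt0.
have h1 := climV c0 (_ : clim (fun t => 2 ^+ t * (1 - qexp (w / 2 ^+ t))) _).
have h2 : clim (fun t => (2 ^+ t)^-1) (0 : R[i]).
  apply: eq_clim (clim_real pow2V_cvg0) => t.
  by rewrite fmorphV rmorphXn rmorph_nat.
apply: (eq_clim (u := fun t => \sum_(i < j.+1) (eulerian R j)`_i *
    (2 ^+ t * (1 - qexp (w / 2 ^+ t)))^-1 ^+ i.+1 * (2 ^+ t)^-1 ^+ (j - i))).
  by move=> t; rewrite scaled_power_sumE // expf_neq0 ?pnatr_eq0.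
have -> : j`!%:R * (- two_pi_i R * w)^-1 ^+ j.+1 = \sum_(i < j.+1) (eulerian R j)`_i *
    (- two_pi_i R * w)^-1 ^+ i.+1 * 0 ^+ (j - i).
  rewrite big_ord_recr /= subnn mulr1 coef_eulerian_lead big1 ?add0r // => i _.
  by rewrite expr0n subn_eq0 leqNgt ltn_ord mulr0.
apply: clim_sum => i _; apply: climM (climX _ h2); apply: climM; first exact: clim_cst.
apply/climX/h1; rewrite mulNr; apply: eq_clim (cexp_scaled_clim _) => t.
by rewrite /qexp mulrA.
Qed.

Lemma ler_pX_pX (x y B : R) p q : 0 <= x -> 0 <= y -> x <= B -> y <= B ->
  x ^+ p * y ^+ q <= B ^+ (p + q).
Proof.
move=> x0 y0 xB yB; have B0 := le_trans x0 xB.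
by rewrite exprD ler_pM ?exprn_ge0 // lerXn2r.
Qed.

Lemma scaled_power_sum_bound j z : 0 < complex.Im z ->
  exists2 C : R, 0 <= C & exists t0, forall t m, (t0 <= t)%N ->
    `|m%:~R| <= 2 ^+ t :> R ->
    cabs ((2 ^+ t.+1)^-1 ^+ j.+1 * power_sum j (qexp ((z + m%:~R) / 2 ^+ t.+1)))
      <= C * cabs (z + m%:~R) ^- j.+1.
Proof.
move=> z0; have [c c0 hc] := qexp_sub1_ge R.
(* With N = 2^(t+1), A/|w| bounds both 1/(N |1 - qexp(w/N)|), through [c], and 1/N, because |w|/N <=
   2. *)
pose A := c^-1 + 2; have A0 : 0 < A by rewrite addr_gt0 ?invr_gt0.
exists ((\sum_(i < j.+1) cabs (eulerian R j)`_i) * A ^+ j.+1).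
  by rewrite mulr_ge0 ?exprn_ge0 ?(ltW A0) // sumr_ge0 // => i _; apply: cabs_ge0.
(* For such [t], |m| <= 2^t gives |Re(z + m)| / 2^(t+1) <= 1/4 + 1/2, within the strip where
   [qexp_sub1_ge] holds. *)
have [t0 ht0] : exists t0, forall t, (t0 <= t)%N ->
    `|complex.Re z| *+ 2 <= 2 ^+ t /\ complex.Im z <= 2 ^+ t.
  pose x := `|complex.Re z| *+ 2 + complex.Im z.
  have x0 : 0 <= x by rewrite addr_ge0 ?mulrn_wge0 // ltW.
  exists (Num.bound x) => t ht; have xt : x <= 2 ^+ t.
    apply: le_trans (ltW (archi_boundP x0)) _; rewrite -natrX ler_nat.
    by apply: leq_trans ht (ltnW (ltn_expl t _)).
  split; apply: le_trans xt; first by rewrite lerDl ltW.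
  by rewrite lerDr mulrn_wge0.
exists t0 => t m /ht0 [hRe hIm] mt; set w := z + m%:~R.
pose N : R := 2 ^+ t.+1; have N0 : 0 < N by apply: exprn_gt0.
have N2 : N = 2 * 2 ^+ t by rewrite /N exprS.
have w0 : 0 < cabs w by rewrite cabs_gt0 add_int_neq0 // gt_eqF.
have Re34 : `|complex.Re (w / 2 ^+ t.+1)| <= 3 / 4.
  rewrite Re_div_pow2 -/N normrM normfV (gtr0_norm N0) ler_pdivrMr // /w Re_add_int.
  apply: le_trans (ler_normD _ _) _; move: mt hRe; rewrite N2 mulr2n; lra.
have Im1 : 0 < complex.Im (w / 2 ^+ t.+1) <= 1.
  rewrite Im_div_pow2 -/N /w Im_add_int divr_gt0 //= ler_pdivrMr // mul1r N2.
  by move: hIm z0; lra.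
have hD := hc _ Re34 Im1.
have NE : cabs (2 ^+ t.+1) = N by rewrite cabsX cabs_nat.
have hw : cabs (w / 2 ^+ t.+1) = cabs w / N by rewrite cabsM cabsV NE.
have wN : cabs w / N <= 2.
  rewrite -hw; apply: le_trans (cabs_le_ReIm _) _.
  by case/andP: Im1 => h1 h2; rewrite (gtr0_norm h1); move: Re34 h2; lra.
have b1 : cabs (2 ^+ t.+1 * (1 - qexp (w / 2 ^+ t.+1)))^-1 <= A / cabs w.
  rewrite cabsV cabsM NE; apply: le_trans (_ : (c * cabs w)^-1 <= _); last first.
    by rewrite invfM ler_wpM2r ?invr_ge0 ?cabs_ge0 // lerDl ler0n.
  rewrite lef_pV2 ?posrE ?mulr_gt0 //.
    by rewrite [N * _]mulrC -ler_pdivrMr // -mulrA -hw.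
  by apply: lt_le_trans hD; rewrite mulr_gt0 // hw divr_gt0.
have b2 : cabs (2 ^+ t.+1)^-1 <= A / cabs w.
  rewrite cabsV NE ler_pdivlMr // mulrC; apply: le_trans wN _.
  by rewrite lerDr invr_ge0 ltW.
rewrite scaled_power_sumE ?expf_neq0 ?pnatr_eq0 //.
apply: le_trans (cabs_sum _ _ _) _; rewrite -mulrA mulr_suml; apply: ler_sum => i _.
rewrite !cabsM !cabsX -mulrA ler_wpM2l ?cabs_ge0 //.
rewrite (_ : A ^+ j.+1 * cabs w ^- j.+1 = (A / cabs w) ^+ (i.+1 + (j - i))).
  apply: ler_pX_pX; [exact: cabs_ge0|exact: cabs_ge0|exact: b1|exact: b2].
have ij : (i <= j)%N by have := ltn_ord i.
by rewrite addSn (subnKC ij) [RHS]exprMn exprVn.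
Qed.

Definition lipschitz_sum k (x : R[i]) : R[i] :=
  (- two_pi_i R) ^+ k / (k.-1)`!%:R * power_sum k.-1 x.

(** After scaling, the distribution relation writes [power_sum j (qexp z)], which does not depend on
    [t], as a sum over -2^t <= m < 2^t whose terms tend to a constant times (z + m)^-k; dominated
    convergence identifies it with the full sum. *)
Lemma lipschitz_formula k z : (2 <= k)%N -> 0 < complex.Im z ->
  clim (fun M => bilateral_sum M (fun m => (z + m%:~R) ^- k)) (lipschitz_sum k (qexp z)).
Proof.
move=> k2 z0; have zN0 : complex.Im z != 0 by rewrite gt_eqF.
case: k k2 => [//|j] j1; pose v (m : int) := (z + m%:~R) ^- j.+1.
pose F (i : nat) := v i%:Z + v (- (i%:Z + 1)).
have [K K0 hK] := inv_square_bound zN0.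
pose c := `|complex.Im z| ^- (j.+1 - 2).
have c0 : 0 <= c by rewrite invr_ge0 exprn_ge0.
pose sq (m : int) := cabs (z + m%:~R) ^- 2.
have sq0 m : 0 <= sq m by rewrite invr_ge0 sqr_ge0.
pose b (i : nat) := c * (sq i%:Z + sq (- (i%:Z + 1))).
have b0 i : 0 <= b i by rewrite mulr_ge0 // addr_ge0.
have bK P : \sum_(i < P) b i <= c * K by rewrite -mulr_sumr ler_wpM2l // hK.
have vb m : cabs (v m) <= c * sq m by apply: cabs_pow_bound.
have Fb i : cabs (F i) <= b i.
  by rewrite /b mulrDr; apply: le_trans (cabsD _ _) (lerD (vb _) (vb _)).
have [s hs] := clim_abs_series Fb bK.
have two0 : two_pi_i R != 0.
  by rewrite eq_complex /= eqxx /= mulf_neq0 ?pnatr_eq0 // gt_eqF // pi_gt0.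
have sE : s = lipschitz_sum j.+1 (qexp z).
  pose L := j`!%:R * (- two_pi_i R)^-1 ^+ j.+1.
  have L0 : L != 0.
    apply: mulf_neq0; first by rewrite pnatr_eq0 -lt0n fact_gt0.
    by rewrite expf_neq0 // invr_eq0 oppr_eq0.
  pose h t m := (2 ^+ t.+1)^-1 ^+ j.+1 * power_sum j (qexp ((z + m%:~R) / 2 ^+ t.+1)).
  pose w t i := h t i%:Z + h t (- (i%:Z + 1)) - L * F i.
  have [C C0 [t0 hC]] := scaled_power_sum_bound j z0.
  have w0 : clim (fun t => \sum_(i < 2 ^ t) w t i) 0.
    apply: (tannery0 (b := fun i => (C + cabs L) * b i) (K := (C + cabs L) * (c * K))
              (t0 := t0)).
    - by move=> t; apply: ltnW (ltn_expl t _).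
    - move=> t i tt0 it.
      have hb m : `|m%:~R| <= 2 ^+ t :> R -> cabs (h t m) <= C * c * sq m.
        move=> /(hC t m tt0) /le_trans -> //; rewrite -mulrA ler_wpM2l //.
        by have := vb m; rewrite cabsV cabsX.
      have it2 : (i.+1)%:R <= 2 ^+ t :> R by rewrite -natrX ler_nat.
      apply: le_trans (cabsD _ _) _; rewrite cabsN cabsM mulrDl; apply: lerD.
        rewrite /b mulrDr mulrDr !mulrA; apply: le_trans (cabsD _ _) _.
        apply: lerD; apply: hb; first by rewrite ger0_norm // (le_trans _ it2) // ler_nat.
        by rewrite intrN normrN ger0_norm ?ler0z // rmorphD /= natr1.
      by rewrite ler_wpM2l ?cabs_ge0.
    - by move=> i; rewrite mulr_ge0 // addr_ge0 ?cabs_ge0 ?mulr_ge0.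
    - move=> P; rewrite -mulr_sumr ler_wpM2l ?bK // addr_ge0 ?cabs_ge0 ?mulr_ge0 //.
    - move=> i.
      have hh m : clim (h^~ m) (L * v m).
        have zm := add_int_neq0 m zN0.
        have e : L * v m = j`!%:R * (- two_pi_i R * (z + m%:~R))^-1 ^+ j.+1.
          by rewrite /L /v -mulrA invfM exprMn [(z + _)^-1 ^+ _]exprVn.
        by rewrite e; apply: clim_subseq (scaled_power_sum_clim j zm) => t.
      rewrite -(subrr (L * F i)); apply: climB (clim_cst _).
      by rewrite mulrDr; apply: climD.
  have hL : clim (fun t => L * \sum_(i < 2 ^ t) F i) (L * s).
    apply: climM (clim_cst _) _.
    by apply: clim_subseq hs => t; apply: ltnW (ltn_expl t _).
  have := climD w0 hL; rewrite add0r => hs2.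
  have {hs2} hs3 : clim (fun t : nat => power_sum j (qexp z)) (L * s).
    apply: eq_clim hs2 => t; rewrite sumrB -mulr_sumr subrK.
    under eq_bigr do rewrite /h -mulrDr.
    rewrite -mulr_sumr.
    by rewrite power_sum_qexp_bilateral // mulrA exprVn mulVf ?mul1r // !expf_neq0 ?pnatr_eq0.

  rewrite /lipschitz_sum (clim_unique (clim_cst _) hs3) /L /= exprVn.
  by field; rewrite expf_neq0 ?oppr_eq0 // pnatr_eq0 -lt0n fact_gt0.
rewrite -sE; have [|s' hs'] := @clim_abs_series R (fun i => v i%:Z) b (c * K) _ bK.
  by move=> i; apply: le_trans (vb _) _; rewrite ler_wpM2l // lerDl.
(* The last term of [bilateral_sum] is unpaired; it vanishes in the limit as a difference of partial
   sums of a convergent series. *)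
have v0 : clim (fun M => v M%:Z) 0.
  rewrite -(subrr s'); apply: eq_clim (climB (clim_subseq leqnSn hs') hs').
  by move=> M; rewrite big_ord_recr /= addrAC subrr add0r.
rewrite -[s]addr0; apply: eq_clim (climD hs v0) => M.
rewrite /bilateral_sum big_ord_recr /= ltnn addr0; congr (_ + _).
by apply: eq_bigr => i _; rewrite ltn_ord.
Qed.

End Lipschitz.

(** * The q-series *)

Section QSeries.
Variable R : realType.
Implicit Types (p q : {poly R}) (n : seq nat).

Definition coef_le p q := forall i, 0 <= p`_i <= q`_i.

Lemma coef_leD p q p' q' : coef_le p q -> coef_le p' q' -> coef_le (p + p') (q + q').
Proof.
move=> h h' i; rewrite !coefD; case/andP: (h i) => a b; case/andP: (h' i) => c d.
by rewrite addr_ge0 //= lerD.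
Qed.

Lemma coef_leM p q p' q' : coef_le p q -> coef_le p' q' -> coef_le (p * p') (q * q').
Proof.
move=> h h' i; rewrite !coefM; apply/andP; split.
  by apply: sumr_ge0 => j _; case/andP: (h j) (h' (i - j)%N) => a _ /andP [c _]; apply: mulr_ge0.
apply: ler_sum => j _; case/andP: (h j) (h' (i - j)%N) => a b /andP [c d].
exact: ler_pM.
Qed.

Lemma coef_le_nat (m : nat) : coef_le m%:R m%:R.
Proof. by move=> i; rewrite lexx andbT -polyC_natr coefC; case: ifP. Qed.

Lemma coef_le_chain (T : Type) (f g : nat -> T -> {poly R}) X n :
  (forall k x, coef_le (f k x) (g k x)) -> coef_le (chain f X n) (chain g X n).
Proof.
move=> fg; elim: X n => [|x X IH] n /=; first exact: coef_le_nat.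
case: n => [|k n]; last exact: coef_leD (IH _) (coef_leM (fg _ _) (IH _)).
by rewrite !addr0; apply: IH.
Qed.

Lemma coef_le_chain_cat (T : Type) (f : nat -> T -> {poly R}) X Y n :
  (forall k x, coef_le 0 (f k x)) -> coef_le (chain f X n) (chain f (X ++ Y) n).
Proof.
move=> f0; have fN k x : coef_le (f k x) (f k x).
  by move=> i; case/andP: (f0 k x i); rewrite coef0 lexx andbT.
have h Z m i := proj1 (andP (coef_le_chain Z m fN i)).
move=> i; rewrite h /= chain_cat big_ord_recr /= take_size drop_size chain_nil mulr1.
rewrite coefD lerDr coef_sum sumr_ge0 // => j _; rewrite coefM sumr_ge0 // => l _.
by rewrite mulr_ge0.
Qed.

Definition coef_eq_upto (N : nat) p q := forall i, (i <= N)%N -> p`_i = q`_i.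

Lemma coef_eq_upto_chain (N : nat) (f g : nat -> nat -> {poly R}) X n :
  (forall k x, x \in X -> coef_eq_upto N (f k x) (g k x)) ->
  coef_eq_upto N (chain f X n) (chain g X n).
Proof.
elim: X n => [|x X IH] n fg i iN //=.
have IH' m : coef_eq_upto N (chain f X m) (chain g X m).
  by apply: IH => k y yX; apply: fg; rewrite in_cons yX orbT.
case: n => [|k n]; first by rewrite !addr0 IH'.
rewrite !coefD IH' // !coefM; congr (_ + _); apply: eq_bigr => j _.
have jN : (j <= N)%N by apply: leq_trans iN; rewrite -ltnS.
have ijN : (i - j <= N)%N by apply: leq_trans (leq_subr _ _) iN.
by rewrite (fg k x (mem_head _ _) j jN) IH'.
Qed.

Lemma chain_cat0 (T : eqType) (f : nat -> T -> {poly R}) X Y n :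
  (forall k y, y \in Y -> f k y = 0) -> chain f (X ++ Y) n = chain f X n.
Proof.
move=> f0; elim: X n => [|x X IH] n /=; last first.
  by rewrite IH; case: n => [|k n] //; rewrite IH.
elim: Y f0 n => [|y Y IH] f0 n //=; rewrite IH; last first.
  by move=> k z zY; apply: f0; rewrite in_cons zY orbT.
by case: n => [|k n]; rewrite ?addr0 // f0 ?mem_head // mul0r addr0.
Qed.

(** A Lambert series truncated in v: nested sums of these are polynomials, so comparing coefficients
    involves no convergence. *)
Definition lambert_poly (V k u : nat) : {poly R} :=
  \sum_(v < V) v.+1%:R ^+ k.-1 *: 'X^(u * v.+1).

Lemma coef_lambert_poly V k u N :
  (lambert_poly V k u)`_N = \sum_(v < V | (u * v.+1 == N)%N) v.+1%:R ^+ k.-1.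
Proof.
rewrite coef_sum [RHS]big_mkcond; apply: eq_bigr => v _.
by rewrite coefZ coefXn eq_sym; case: eqP => _; rewrite ?mulr1 ?mulr0.
Qed.

Lemma coef_le_lambert_poly V W k u : (V <= W)%N ->
  coef_le (lambert_poly V k u) (lambert_poly W k u).
Proof.
move=> VW; rewrite -(subnKC VW) => i; rewrite !coef_lambert_poly; apply/andP; split.
  by apply: sumr_ge0 => v _; apply: exprn_ge0.
rewrite [leLHS]big_mkcond [leRHS]big_mkcond big_split_ord /= lerDl; apply: sumr_ge0 => v _.
by case: ifP => // _; apply: exprn_ge0.
Qed.

Lemma lambert_poly_upto N V k u : (0 < u)%N -> (N <= V)%N ->
  coef_eq_upto N (lambert_poly V k u) (if (u <= N)%N then lambert_poly N k u else 0).
Proof.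
move=> u0 NV i iN; case: ifP => uN; last first.
  rewrite coef0 coef_lambert_poly big_pred0 // => v; apply/negbTE.
  rewrite neq_ltn; apply/orP; right; apply: leq_ltn_trans iN _.
  by rewrite (leq_trans _ (leq_pmulr _ _)) // ltnNge uN.
rewrite -(subnKC NV) !coef_lambert_poly [LHS]big_mkcond [RHS]big_mkcond big_split_ord /= [X in _ + X]big1 ?addr0 // => v _.
case: ifP => // /eqP e; have : (N < i)%N.
  by rewrite -e (leq_trans _ (leq_pmull _ u0)) // ltnS leq_addr.
by rewrite ltnNge iN.
Qed.

(** In degree N only u, v <= N contribute, so truncation at N gives the exact coefficient of the
    q-series, up to the normalisation supplied by [gserE]. *)
Definition qcoef n N := (chain (lambert_poly N) (iota 1 N) n)`_N.

Lemma coef_chain_lambert V L n N : (N <= V)%N -> (N <= L)%N ->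
  (chain (lambert_poly V) (iota 1 L) n)`_N = qcoef n N.
Proof.
move=> NV NL; pose g k u := if (u <= N)%N then lambert_poly N k u else 0.
rewrite (@coef_eq_upto_chain N _ g) //; last first.
  move=> k u; rewrite mem_iota => /andP [u0 _].
  exact: lambert_poly_upto.
rewrite -(subnKC NL) iotaD chain_cat0; last first.
  by move=> k u; rewrite mem_iota /g => /andP [h _]; rewrite leqNgt h.
rewrite /qcoef; apply: esym; apply: (coef_eq_upto_chain (N := N)) => // k u.
rewrite mem_iota => /andP [u0 uN]; have := @lambert_poly_upto N N k u u0 (leqnn _).
by rewrite /g.
Qed.

(** The coefficients are nonnegative and grow with both truncations, so their stable value is a
    majorant uniform in [V] and [L]. *)
Lemma coef_chain_lambert_le V L n N :
  0 <= (chain (lambert_poly V) (iota 1 L) n)`_N <= qcoef n N.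
Proof.
have h := coef_le_chain (iota 1 L) n
  (fun k u => coef_le_lambert_poly k u (leq_maxl V N)).
case/andP: (h N) => -> /= /le_trans; apply.
rewrite -(@coef_chain_lambert (maxn V N) (maxn L N)) ?leq_maxr //.
rewrite -(subnKC (leq_maxl L N)) iotaD.
have f0 k u : coef_le 0 (lambert_poly (maxn V N) k u).
  move=> i; have := coef_le_lambert_poly k u (leq0n (maxn V N)) i.
  by rewrite [X in 0 <= X <= _]coef_lambert_poly big_ord0 coef0.
by case/andP: (coef_le_chain_cat (iota 1 L) (iota (1 + L) (maxn L N - L)) n f0 N).
Qed.

Lemma qcoefE n N :
  \sum_(uv : (size n).-tuple 'I_N.+1 * (size n).-tuple 'I_N.+1 |
         [&& path ltn 0%N [seq val j | j <- uv.1],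
             all (fun j : 'I_N.+1 => 0 < j)%N uv.2
           & (\sum_(i < size n) tnth uv.1 i * tnth uv.2 i == N)%N])
    \prod_(i < size n) (val (tnth uv.2 i))%:R ^+ (nth 0%N n i).-1 = qcoef n N.
Proof.
rewrite -(pair_big_dep (fun u : (size n).-tuple 'I_N.+1 => path ltn 0%N [seq val j | j <- u])
  (fun u v : (size n).-tuple 'I_N.+1 => all (fun j : 'I_N.+1 => 0 < j)%N v &&
      (\sum_(i < size n) tnth u i * tnth v i == N)%N)
  (fun u v => \prod_(i < size n) (val (tnth v i))%:R ^+ (nth 0%N n i).-1)) /=.
have iota_val u : u \in iota 1 N -> exists y : 'I_N.+1, u = val y.
  by rewrite mem_iota add1n => /andP [_ h]; exists (Ordinal h).
have iota_pos (y : 'I_N.+1) : (0 < val y)%N = (val y \in iota 1 N).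
  by rewrite mem_iota add1n ltn_ord andbT.
rewrite /qcoef -(sum_path_tuple n _ val_inj ltnn ltn_trans (iota_ltn_sorted 1 N)
  iota_val iota_pos).
rewrite coef_sum; apply: eq_bigr => u _.
have e k w : lambert_poly N k w = \sum_(v < N.+1 | (0 < v)%N) v%:R ^+ k.-1 *: 'X^(w * v).
  rewrite [RHS]big_mkcond big_ord_recl /= add0r.
  by apply: eq_bigr => v _.
have {e} -> := eq_bigr _ (fun (i : 'I_(size n)) _ => e (nth 0%N n i) (tnth u i)).
rewrite bigA_distr_big coef_sum.
rewrite (reindex (@finfun_of_tuple _ (size n))) /=; last first.
  exists (@tuple_of_finfun _ (size n)) => t _.
    exact: finfun_of_tupleK.
  exact: tuple_of_finfunK.
rewrite big_mkcondr; apply: eq_big => [v|v _].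
  apply/idP/ffun_onP => [/all_tnthP h i|h]; first by rewrite ffunE; apply: h.
  by apply/all_tnthP => i; have := h i; rewrite ffunE.
rewrite scaler_prod prodrXr coefZ coefXn eq_sym.
have -> : (\sum_(i < size n) tnth u i * finfun_of_tuple v i = \sum_(i < size n) tnth u i * tnth v i)%N.
  by apply: eq_bigr => i _; rewrite ffunE.
case: eqP => _; last by rewrite mulr0.
by rewrite mulr1; apply: eq_bigr => i _; rewrite ffunE.
Qed.

Lemma gserE n N : gser R n N =
  (- two_pi_i R) ^+ sumn n / (\prod_(k <- n) (k.-1)`!)%:R * (qcoef n N)%:C.
Proof.
rewrite /gser -qcoefE rmorph_sum; congr (_ * _); apply: eq_bigr => uv _.
by rewrite rmorph_prod; apply: eq_bigr => i _; rewrite rmorphXn rmorph_nat.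
Qed.

End QSeries.

(** * Summation of the q-series at a point of the unit disc *)

Section QSeriesLimit.
Variable R : realType.
Implicit Types (n : seq nat) (q : R[i]).

Lemma chain_scale (K : comNzRingType) (T : Type) (c : nat -> K) (f : nat -> T -> K) X n :
  chain (fun k x => c k * f k x) X n = (\prod_(k <- n) c k) * chain f X n.
Proof.
elim: X n => [|x X IH] n /=.
  by case: n => [|k n]; rewrite ?mulr0 // big_nil mul1r.
case: n => [|k n]; first by rewrite big_nil !chain_nil mul1r addr0.
by rewrite !IH /= mulrDr !big_cons; congr (_ + _); ring.
Qed.

Lemma clim_chain (T : eqType) (f : nat -> nat -> T -> R[i]) (g : nat -> T -> R[i]) X n :
  (forall k x, k \in n -> x \in X -> clim (fun V => f V k x) (g k x)) ->
  clim (fun V => chain (f V) X n) (chain g X n).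
Proof.
elim: X n => [|x X IH] n h /=; first exact: clim_cst.
case: n h => [|k n] h.
  by apply: climD (clim_cst _); apply: IH => k y.
apply: climD; first by apply: IH => j y jn yX; apply: h; rewrite // in_cons yX orbT.
apply: climM; first by apply: h; rewrite mem_head.
by apply: IH => j y jn yX; apply: h; rewrite in_cons ?jn ?yX orbT.
Qed.

Lemma expn_le_fact_bin v j : (v.+1 ^ j <= j`! * 'C(v + j, j))%N.
Proof.
elim: j => [|j IH]; first by rewrite addn0 bin0.
have e : (j.+1 * 'C(v + j.+1, j.+1) = (v + j).+1 * 'C(v + j, j))%N.
  by rewrite addnS -mul_bin_diag.
rewrite factS expnS [(j.+1 * _)%N]mulnC -mulnA e mulnCA.
by apply: leq_mul => //; rewrite ltnS leq_addr.
Qed.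

(** The inequality (u + 1)(v + 1) >= u + (v + 1) separates the two summations; [expn_le_fact_bin]
    then compares the sum over v with a binomial series. *)
Lemma lambert_bound (t : R) k V L : 0 <= t < 1 ->
  \sum_(u <- iota 1 L) (lambert_poly R V k u).[t] <=
  (1 - t)^-1 * ((k.-1)`!%:R * (1 - t)^-1 ^+ k.-1.+1).
Proof.
case/andP => t0 t1; have s0 : 0 < 1 - t by rewrite subr_gt0.
have h1 : \sum_(u < L) t ^+ u <= (1 - t)^-1.
  have := @binomial_series_le R t 0 L; rewrite t0 t1 expr1 => /(_ isT).
  by under eq_bigr do rewrite bin0 mul1r.
have h2 : \sum_(v < V) v.+1%:R ^+ k.-1 * t ^+ v.+1 <= (k.-1)`!%:R * (1 - t)^-1 ^+ k.-1.+1.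
  have := @binomial_series_le R t k.-1 V; rewrite t0 t1 => /(_ isT).
  rewrite -(ler_pM2l (_ : 0 < (k.-1)`!%:R)) ?ltr0n ?fact_gt0 //; apply: le_trans.
  rewrite mulr_sumr; apply: ler_sum => v _; rewrite mulrA -natrM -natrX.
  apply: ler_pM; rewrite ?exprn_ge0 // ?ler_nat ?expn_le_fact_bin //.
  by rewrite exprS ler_piMl ?exprn_ge0 // ltW.
apply: le_trans (ler_pM _ _ h1 h2); last 2 first.
- by apply: sumr_ge0 => u _; apply: exprn_ge0.
- by apply: sumr_ge0 => v _; rewrite mulr_ge0 ?exprn_ge0.
have -> : iota 1 L = index_iota 1 L.+1 by rewrite /index_iota subSS subn0.
rewrite mulr_suml big_add1 big_mkord.
apply: ler_sum => u _; rewrite mulr_sumr /lambert_poly horner_sum.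
apply: ler_sum => v _; rewrite hornerZ hornerXn mulrCA ler_wpM2l ?exprn_ge0 // -exprD.
apply: ler_wiXn2l => //; first exact: ltW.
by rewrite mulSn addnC leq_add2l leq_pmulr.
Qed.

Lemma qcoef_ge0 n N : 0 <= qcoef R n N.
Proof. by case/andP: (coef_chain_lambert_le R N N n N). Qed.

Lemma horner_truncE (K : comNzRingType) (p : {poly K}) (x : K) P :
  p.[x] = \sum_(i < P) p`_i * x ^+ i + \sum_(i < size p) p`_(P + i) * x ^+ (P + i).
Proof.
by rewrite (@horner_coef_wide _ (P + size p)) ?leq_addl // big_split_ord.
Qed.

Lemma qcoef_sum_bounded n (t : R) : 0 <= t < 1 ->
  exists K, forall P, \sum_(N < P) qcoef R n N * t ^+ N <= K.
Proof.
move=> t01; have /andP [t0 _] := t01.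
exists (\prod_(k <- n) ((1 - t)^-1 * ((k.-1)`!%:R * (1 - t)^-1 ^+ k.-1.+1))) => P.
have lam0 k u : 0 <= (lambert_poly R P k u).[t].
  rewrite horner_sum sumr_ge0 // => v _.
  by rewrite hornerZ hornerXn mulr_ge0 ?exprn_ge0.
pose p := chain (lambert_poly R P) (iota 1 P) n.
apply: (@le_trans _ _ p.[t]).
  rewrite (horner_truncE p t P) ler_wpDr //.
    apply: sumr_ge0 => i _; rewrite mulr_ge0 ?exprn_ge0 //.
    by case/andP: (coef_chain_lambert_le R P P n (P + i)).
  apply: ler_sum => i _; rewrite coef_chain_lambert //; exact: ltnW.
have -> : p.[t] = chain (fun k u => (lambert_poly R P k u).[t]) (iota 1 P) n.
  exact: (chain_rmorph (horner_eval t)).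
apply: le_trans (chain_le_prod _ _ lam0) _; apply: ler_prod => k _.
by rewrite sumr_ge0 // lambert_bound.
Qed.

Lemma lambert_eval_clim k u q : (2 <= k)%N -> cabs (q ^+ u) < 1 ->
  clim (fun V => (map_poly (real_complex R) (lambert_poly R V k u)).[q])
       (power_sum k.-1 (q ^+ u)).
Proof.
move=> k2 qu; apply: eq_clim (clim_subseq leqnSn (power_series_clim k.-1 qu)) => V.
(* For k >= 2 the term m = 0 of the power series vanishes, in accordance with v starting at 1. *)
have k1 : (k.-1 == 0)%N = false by case: k k2 => [|[]].
rewrite big_ord_recl /= expr0n k1 mul0r add0r.
rewrite rmorph_sum horner_sum; apply: eq_bigr => v _.
by rewrite /= map_polyZ map_polyXn hornerZ hornerXn exprM rmorphXn rmorph_nat.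
Qed.

(** For fixed [L] the nested closed form is a limit in [V] of polynomials in q. Their low
    coefficients are those of the q-series and their high ones are bounded by [qcoef], uniformly in
    [V] and [L]; the tail of one convergent series thus controls the exchange of limits. *)
Lemma qseries_clim n q : all (leq 2) n -> cabs q < 1 ->
  exists2 s, clim (fun P => \sum_(N < P) (qcoef R n N)%:C * q ^+ N) s &
    clim (fun L => chain (fun k u => power_sum k.-1 (q ^+ u)) (iota 1 L) n) s.
Proof.
move=> n2 q1; pose t := cabs q; have t01 : 0 <= t < 1 by rewrite cabs_ge0.
have [K hK] := qcoef_sum_bounded n t01.
pose b N := qcoef R n N * t ^+ N.
have b0 N : 0 <= b N by rewrite mulr_ge0 ?exprn_ge0 ?cabs_ge0 ?qcoef_ge0.
pose v N := (qcoef R n N)%:C * q ^+ N.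
have vb N : cabs (v N) <= b N by rewrite cabsM cabs_real ger0_norm ?qcoef_ge0 // cabsX.
have [s hs] := clim_abs_series vb hK; exists s => //.
apply/climP => e e0; have e3 : 0 < e / 3 by rewrite divr_gt0.
have [P0 hP0] := bounded_sum_tail b0 hK e3.
have [P1 hP1] := (climP _ _).1 hs _ e3.
pose M := maxn P0 P1; exists M => L ML.
have tail d : \sum_(i < d) b (M + i)%N < e / 3.
  apply: le_lt_trans (hP0 (M + d)%N _); last exact: leq_trans (leq_maxl _ _) (leq_addr _ _).
  have h : \sum_(i < P0) b i <= \sum_(i < M) b i.
    by rewrite -(subnKC (leq_maxl P0 P1 : (P0 <= M)%N)) big_split_ord /= lerDl sumr_ge0.
  by rewrite big_split_ord /=; move: h; lra.
pose p V := chain (lambert_poly R V) (iota 1 L) n.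
have Ycvg : clim (fun V => (map_poly (real_complex R) (p V)).[q])
    (chain (fun k u => power_sum k.-1 (q ^+ u)) (iota 1 L) n).
  apply: (eq_clim (u := fun V => chain (fun k u =>
     (map_poly (real_complex R) (lambert_poly R V k u)).[q]) (iota 1 L) n)).
    move=> V; rewrite /p (chain_rmorph (map_poly (real_complex R))).
    by rewrite -[RHS]/(horner_eval q _) (chain_rmorph (horner_eval q)).
  apply: clim_chain => k u kn; rewrite mem_iota => /andP [u0 _].
  apply: lambert_eval_clim; first exact: (allP n2).
  by rewrite cabsX exprn_ilt1 ?cabs_ge0 // -lt0n.
have [V0 hV0] := (climP _ _).1 Ycvg _ e3.
pose V := maxn V0 M; have := hV0 V (leq_maxl _ _).
rewrite cabsB; set X := chain _ _ _; set Y := horner _ _ => XY.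
have YS : cabs (Y - \sum_(i < M) v i) < e / 3.
  apply: le_lt_trans (tail (size (map_poly (real_complex R) (p V)))).
  rewrite /Y (horner_truncE _ _ M) addrAC.
  rewrite [X in X - _](_ : _ = \sum_(i < M) v i).
    rewrite subrr add0r; apply: le_trans (cabs_sum _ _ _) _; apply: ler_sum => i _.
    rewrite cabsM cabsX coef_map cabs_real ler_wpM2r ?exprn_ge0 ?cabs_ge0 //.
    by case/andP: (coef_chain_lambert_le R V L n (M + i)) => h1 h2; rewrite ger0_norm.
  apply: eq_bigr => i _; have iM := ltnW (ltn_ord i); rewrite coef_map coef_chain_lambert //.
    exact: leq_trans iM (leq_maxr _ _).
  exact: leq_trans iM ML.
have -> : X - s = (X - Y) + ((Y - \sum_(i < M) v i) + (\sum_(i < M) v i - s)) by ring.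
have hMs := hP1 M (leq_maxr _ _).
apply: le_lt_trans (cabsD _ _) _; apply: le_lt_trans (lerD (lexx _) (cabsD _ _)) _.
by move: XY YS hMs; lra.
Qed.

End QSeriesLimit.

(** * The limit *)

Section RefinementLimits.
Variables (R : realType) (A : pzRingType) (B : seq nat -> nat -> A) (W : nat).

Lemma refine_sum_clim p n (Psi : nat -> A -> seq nat -> R[i]) Psi' :
    (forall x ks, all (leq 2) ks -> clim (fun L => Psi L x ks) (Psi' x ks)) ->
  clim (fun L => refine_sum B W p n (Psi L)) (refine_sum B W p n Psi').
Proof.
elim: p n Psi Psi' => [|p IH] [|m n] Psi Psi' h /=; try exact: h; first exact: clim_cst.
apply: clim_sum => i _; rewrite big_nat; apply: (eq_clim (u := fun L =>
  \sum_(2 <= k < W | (2 <= k < W)%N) refine_sum B W p (drop i n)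
    (fun y ks => Psi L (B (m :: take i n) k * y) (k :: ks)))).
  by move=> L; rewrite -big_nat.
apply: clim_sum => k /andP [k2 _].
by apply: (IH _ (fun L y ks => Psi L (B _ k * y) (k :: ks))) => x ks ks2; apply: h; rewrite /= k2.
Qed.

Lemma refine_sum_sum p n P (Psi : nat -> A -> seq nat -> R[i]) :
  \sum_(k < P) refine_sum B W p n (Psi k) =
  refine_sum B W p n (fun x ks => \sum_(k < P) Psi k x ks).
Proof.
elim: P => [|P IH].
  by rewrite big_ord0 refine_sum0 // => x ks; rewrite big_ord0.
rewrite big_ord_recr /= IH -refine_sumD; apply: eq_refine_sum => x ks _.
by rewrite big_ord_recr.
Qed.

Lemma clim_mould_prod (T : eqType) (F : nat -> T -> seq nat -> R[i])
    (G : T -> seq nat -> R[i]) ls n (P : pred nat) : all P n ->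
    (forall l n', l \in ls -> all P n' -> subseq n' n -> clim (fun M => F M l n') (G l n')) ->
  clim (fun M => mould_prod (map (F M) ls) n) (mould_prod (map G ls) n).
Proof.
elim: ls n => [|l ls IH] n Pn h /=; first exact: clim_cst.
apply: clim_sum => i _; apply: climM.
  apply: h; rewrite ?mem_head ?take_subseq //; apply/allP => x /mem_take; exact: (allP Pn).
apply: IH; first by apply/allP => x /mem_drop; apply: (allP Pn).
move=> l' n' l'ls Pn' sub; apply: h => //; first by rewrite in_cons l'ls orbT.
exact: subseq_trans sub (drop_subseq _ _).
Qed.

End RefinementLimits.

Section EisensteinLimit.
Variables (R : realType) (tau : R[i]) (n : seq nat).
Hypotheses (tau0 : 0 < complex.Im tau) (n2 : all (leq 2) n).

(** A strict upper bound for the entries of [n], valid for all its pieces at once, hence for every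
    index [k] that can replace a piece. *)
Let W := (sumn n).+1.
Let phi k l : R[i] := lipschitz_sum k (qexp tau ^+ l).

Definition eisenstein_rows L : R[i] :=
  \sum_(i < (size n).+1) (mzv R (take i n))%:C *
    refine_sum (tangent_coef R) W (size n) (drop i n)
      (fun c ks => c%:C * chain phi (iota 1 L) ks).

Lemma all_leq_sumn : all (fun m => m <= sumn n)%N n.
Proof.
elim: n => //= m n' IH; rewrite leq_addr; apply: sub_all IH => k /leq_trans -> //.
exact: leq_addl.
Qed.

Lemma lattice_row_clim l n' : (0 < l)%N -> all (leq 2) n' -> subseq n' n ->
  clim (fun M => chain (fun k x => lattice_point tau x ^- k) (lattice_row M l) n')
    (if n' is [::] then 1 else \sum_(2 <= k < W) (tangent_coef R n' k)%:C * phi k l).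
Proof.
move=> l0 n2' sub; case e: n' => [|m n''].
  apply: eq_clim (clim_cst 1) => M; exact/esym/chain_nil.
rewrite -e; pose z : R[i] := l%:R * tau.
have Imz : 0 < complex.Im z.
  rewrite /z -(rmorph_nat (real_complex R)); case: (tau) tau0 => a b /= b0.
  by rewrite mul0r addr0 mulr_gt0 // ltr0n.
apply: (eq_clim (u := fun M => tangent_sum M n' z)).
  move=> M; have -> : lattice_row M l = [seq (l%:Z, m) | m <- int_range M].
    by rewrite -map_comp.
  by rewrite chain_map.
apply: tangent_sum_clim => //.
- apply/allP => k kn; have := allP all_leq_sumn k; apply; exact: (mem_subseq sub).
- by rewrite e.
- by rewrite gt_eqF.
- by move=> k k2; rewrite /phi -qexp_muln; apply: lipschitz_formula.
Qed.

Lemma eisenstein_trunc_clim L : clim (eisenstein_trunc n tau L) (eisenstein_rows L).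
Proof.
apply: (eq_clim (u := fun M => \sum_(i < (size n).+1)
    chain (fun k x => lattice_point tau x ^- k) (positive_row M) (take i n) *
    chain (fun k x => lattice_point tau x ^- k) (lattice_rows L M) (drop i n))).
  by move=> M; rewrite eisenstein_truncE chain_cat.
have t2 i : all (leq 2) (take i n) by apply/allP => j /mem_take; apply: (allP n2).
have d2 i : all (leq 2) (drop i n) by apply/allP => j /mem_drop; apply: (allP n2).
apply: clim_sum => i _; apply: climM.
  apply: eq_clim (clim_real (zeta_chain_cvg (t2 i))) => M.
  rewrite /zeta_chain chain_map (chain_rmorph (real_complex R)).
  apply: eq_chain => k j; rewrite /lattice_point /= mul0r add0r.
  by rewrite fmorphV rmorphXn rmorph_nat.
rewrite -(mould_prod_refine _ _ (h := real_complex R)) ?rmorph1 ?size_drop ?leq_subr //; last first.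
  exact: rmorphM.
apply: (eq_clim (u := fun M => mould_prod [seq chain (fun k x => lattice_point tau x ^- k)
    (lattice_row M l) | l <- iota 1 L] (drop i n))).
  by move=> M; rewrite /lattice_rows chain_flatten -map_comp.
apply: (@clim_mould_prod _ _ (fun M l => chain _ (lattice_row M l)) _ _ _ (leq 2)) => //.
move=> l n' ; rewrite mem_iota => /andP [l0 _] n2' sub; apply: lattice_row_clim => //.
exact: subseq_trans sub (drop_subseq _ _).
Qed.

End EisensteinLimit.

(** Since [limn] is total, convergence of both iterated limits is part of the claim; the identity
    itself is the convergence of the power series at [q] to the Eisenstein series. *)
Theorem theorem1p1 (R : realType)
  (Delta : {linear I1bul -> tensor I1bul I1bul})
  (Delta_def : is_goncharov_coproduct Delta)
  (Zsh : word_alg -> {poly R}) (Zsh_def : is_Zsh Zsh)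
  (zsh : {linear I1bul -> R | ratr \; *%R}) (zsh_def : is_zsh Zsh zsh)
  (g : {linear I1bul -> (nat -> R[i]) | ratr \; *:%R}) (g_def : is_g g)
  (r : nat) (r_ge1 : (1 <= r)%N)
  (n : r.-tuple nat) (n_ge2 : forall i : 'I_r, (2 <= tnth n i)%N)
  (tau : R[i]) (tau_upper : 0 < complex.Im tau) :
  let q : R[i] := cexp (two_pi_i R * tau) in
  let c : nat -> R[i] := tensor_zg zsh g (Delta (I1n n)) in
  [/\ forall L : nat, cvgn (eisenstein_trunc n tau L : nat -> (R[i])^o),
      cvgn (eisenstein_limM n tau)
    & series (fun k => c k * q ^+ k : (R[i])^o) @ \oo --> eisenstein n tau].
Proof.
move=> q c; have n2 : all (leq 2) n by apply/all_tnthP.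
have q1 : cabs q < 1 by apply: cabs_qexp_lt1.
(* [S ks] is the value at [q] of the series g of index [ks], reached both as a power series and as a
   limit over the rows; for other indices it is arbitrary. *)
have /choice [S hS] : forall ks, exists s : R[i], all (leq 2) ks ->
    clim (fun P => \sum_(k < P) gser R ks k * q ^+ k) s /\
    clim (fun L => chain (fun k l => lipschitz_sum k (q ^+ l)) (iota 1 L) ks) s.
  move=> ks; case: (boolP (all (leq 2) ks)) => ks2; last by exists 0.
  have [s hs1 hs2] := qseries_clim ks2 q1.
  pose C : R[i] := (- two_pi_i R) ^+ sumn ks / (\prod_(k <- ks) (k.-1)`!)%:R.
  exists (C * s) => _; split.
    apply: eq_clim (climM (clim_cst C) hs1) => P; rewrite mulr_sumr.
    by apply: eq_bigr => k _; rewrite gserE mulrA.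
  apply: eq_clim (climM (clim_cst C) hs2) => L.
  rewrite chain_scale; congr (_ * _); rewrite /C {hs1 hs2 C ks2}.
  elim: ks => [|k ks IH]; first by rewrite !big_nil expr0 divr1.
  by rewrite !big_cons -IH /= natrM invfM exprD; ring.
(* The finite sum to which both sides converge. *)
pose T := \sum_(i < (size n).+1) refine_sum (tangent_coef R) (sumn n).+1 (size n) (drop i n)
  (fun c ks => (mzv R (take i n) * c)%:C * S ks).
have rows_clim : clim (eisenstein_rows tau n) T.
  apply: clim_sum => i _; rewrite /T.
  rewrite (_ : refine_sum _ _ _ _ _ = (mzv R (take i n))%:C *
     refine_sum (tangent_coef R) (sumn n).+1 (size n) (drop i n) (fun c ks => c%:C * S ks)).
    apply: climM (clim_cst _) _; apply: refine_sum_clim => x ks ks2.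
    by apply: climM (clim_cst _) _; case: (hS ks ks2).
  rewrite -refine_sumZ; apply: eq_refine_sum => x ks _.
  by rewrite rmorphM mulrA.
have coef_clim : clim (fun P => \sum_(k < P) c k * q ^+ k) T.
  apply: (eq_clim (u := fun P => \sum_(i < (size n).+1)
     refine_sum (tangent_coef R) (sumn n).+1 (size n) (drop i n)
       (fun c ks => (mzv R (take i n) * c)%:C * \sum_(k < P) gser R ks k * q ^+ k))).
    move=> P; rewrite /c; under [RHS]eq_bigr => k _.
      rewrite (coproduct_value Delta_def Zsh_def zsh_def g_def (W := (sumn n).+1)) //; last first.
        exact: all_leq_sumn.
      rewrite mulrC mulr_sumr; under eq_bigr do rewrite -refine_sumZ.
      over.
    rewrite exchange_big; apply: eq_bigr => i _.
    rewrite (refine_sum_sum (tangent_coef R) (sumn n).+1 (size n) (drop i n) P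
      (fun (k : nat) x ks => q ^+ k * ((mzv R (take i n) * x)%:C * gser R ks k))).
    apply: eq_refine_sum => x ks _; rewrite mulr_sumr; apply: eq_bigr => k _.
    by rewrite mulrA [RHS]mulrC.
  apply: clim_sum => i _; apply: refine_sum_clim => x ks ks2.
  by apply: climM (clim_cst _) _; case: (hS ks ks2).
have hausdorff : hausdorff_space (R[i])^o by apply: norm_hausdorff.
have truncE L := clim_cvg (eisenstein_trunc_clim tau_upper n2 L).
have limME : eisenstein_limM n tau = eisenstein_rows tau n.
  by apply/funext => L; apply: cvg_lim.
have eisE : eisenstein n tau = T.
  by rewrite /eisenstein limME; apply: cvg_lim => //; apply: clim_cvg.
split.
- by move=> L; apply/cvg_ex; exists (eisenstein_rows tau n L); apply: truncE.
- by apply/cvg_ex; exists T; rewrite limME; apply: clim_cvg.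
rewrite eisE /series /=; apply: clim_cvg; apply: eq_clim coef_clim => P.
by rewrite big_mkord.
Qed.
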